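(* Let $\alpha,\beta\in\mathbb{R}$ with $\beta\neq0$ and $\gamma,\delta,\epsilon\in\mathbb{C}$. There exist $u_0\in\mathcal{S}(\mathbb{R})$ with $u_0\neq0$ and $T>0$ such that the initial value problem $$\partial_{t}u+i\alpha\partial^{2}_{x}u+\beta\partial^{3}_{x}u+i\gamma|u|^{2}u+\delta|u|^{2}\partial_{x}u+\epsilon u^{2}\partial_{x}\overline{u}=0,\qquad u(x,0)=u_0(x),$$ has a solution $u\in C([0,T];\mathcal{S}(\mathbb{R}))$ which satisfies $$|u(x,t)|\le c\,e^{-x^{3/2}/3},\qquad x>1,\ t\in[0,T],$$ for some constant $c>0$.
   Context: $u=u(x,t)$ is complex valued and $\mathcal{S}(\mathbb{R})$ is the Schwartz space. *)

(* Defs.v *)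
From Stdlib Require Import Reals.
From Coquelicot Require Import Coquelicot.

Open Scope R_scope.

Definition CDerive_n (f : R -> C) (n : nat) (x : R) : C :=
  (Derive_n (fun y => Re (f y)) n x, Derive_n (fun y => Im (f y)) n x).

Definition Csmooth (f : R -> C) : Prop :=
  forall (n : nat) (x : R),
    ex_derive_n (fun y => Re (f y)) n x /\ ex_derive_n (fun y => Im (f y)) n x.

(* The Schwartz seminorms are p_{k,j}(f) = sup_x |x|^k |f^(j)(x)|. *)
Definition Schwartz (f : R -> C) : Prop :=
  Csmooth f /\
  forall k j : nat, exists M : R, forall x : R,
    Rabs x ^ k * Cmod (CDerive_n f j x) <= M.

(* Continuity on [0,T] for the Frechet topology of the Schwartz space:
   p_{k,j}(u(t) - u(t0)) -> 0 as t -> t0 in [0,T], for all k, j. The values of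
   u at times outside [0,T] are irrelevant. *)
Definition C_Schwartz (T : R) (u : R -> R -> C) : Prop :=
  (forall t : R, 0 <= t <= T -> Schwartz (fun x => u x t)) /\
  forall (k j : nat) (t0 : R), 0 <= t0 <= T ->
  forall eps : R, 0 < eps ->
  exists eta : R, 0 < eta /\
    forall t : R, 0 <= t <= T -> Rabs (t - t0) < eta ->
    forall x : R,
      Rabs x ^ k * Cmod (CDerive_n (fun y => (u y t - u y t0)%C) j x) <= eps.

(* Derivative at t of g restricted to [0,T]: one-sided at the endpoints. *)
Definition is_derive_on (T : R) (g : R -> C) (t : R) (l : C) : Prop :=
  filterlim (fun s : R => ((g s - g t) / RtoC (s - t))%C)
    (within (fun s : R => 0 <= s <= T) (locally' t)) (locally l).

Definition solves_IVP (alpha beta : R) (gamma delta epsilon : C)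
    (T : R) (u0 : R -> C) (u : R -> R -> C) : Prop :=
  (forall x t : R, 0 <= t <= T ->
     exists dtu : C, is_derive_on T (fun s => u x s) t dtu /\
       (dtu
        + Ci * RtoC alpha * CDerive_n (fun y => u y t) 2 x
        + RtoC beta * CDerive_n (fun y => u y t) 3 x
        + Ci * gamma * RtoC (Cmod (u x t) ^ 2) * u x t
        + delta * RtoC (Cmod (u x t) ^ 2) * CDerive_n (fun y => u y t) 1 x
        + epsilon * (u x t * u x t)
            * CDerive_n (fun y => Cconj (u y t)) 1 x
        = RtoC 0)%C) /\
  (forall x : R, u x 0 = u0 x).

(* Main.v *)
(** For [beta > 0] the datum is a Gaussian, and the nonlinearity is written as [u * V] with
    the potential [V = -(i gamma |u|^2 + delta conj(u) u_x + epsilon u conj(u_x))].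

    Existence.  Writing [u(x,t)] as the Fourier integral of [A(xi,t)], the equation becomes
    a Duhamel equation for [A].  It is solved by contraction in the weighted sup norm of
    [exp(-rho(t) (1 + |xi|)) / (1 + xi^2)] with [rho(t) = 2 - kappa t]: convolution with one
    factor [xi] costs a factor [1 + |xi|], which is exactly what the shrinking radius of
    analyticity [rho] gains after integration in time.

    Decay.  Each derivative of [u] solves [v_t + i alpha v_xx + beta v_xxx = P] with [P]
    controlled by lower derivatives, and for a real weight [w] the integral of [w |v|^2] has
    time derivative [int (-3 beta w' |v_x|^2 + beta w''' |v|^2 - 2 alpha w' Im(conj(v) v_x)
    + 2 w Re(conj(v) P))].  With truncations of powers of [|x|] as weights one gains one
    power of [|x|] at the price of one derivative, so [u] is Schwartz.  With the increasing
    weight [w = e^(kx) / (1 + d e^(kx))] the [v_x] terms have a sign and the growth rate is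
    [beta k^3 + O(k)]; taking [k = 2 sqrt x] gives the right-hand decay when [T] is small.

    For [beta < 0] the solution is obtained from the case of [- beta] by reversing time. *)

Require Import Defs.
From Stdlib Require Import Reals.
From Coquelicot Require Import Coquelicot.
From Stdlib Require Import Lra Lia Psatz.

Open Scope R_scope.

(** * Improper integrals of dominated continuous functions *)

(** The derivative in the nonlinearity has arbitrary complex coefficients, so no cancellation by
    parts can be counted on; among analytic functions its loss is only a factor of the frequency.
    But the solution found there has no decay in [x] yet: its transform is merely Lipschitz in the
    frequency. For decay the form [u * V] pays: as all derivatives of [V] are bounded, the weighted
    estimates are linear in [u] and no weight falls on [V]. Weights are truncated so that energies
    are finite before they are estimated; all bounds are uniform in the truncation [d], which is
    fixed last, depending on the point [x].

    The constant [1/3]: with [k = 2 sqrt x] the bound on [|u|^4] has exponent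
    [8 beta T x^(3/2) - 2 x^(3/2)] up to lower order. Making the first term at most [x^(3/2) / 3]
    and spending another [x^(3/2) / 3] on the lower order leaves [- 4/3 x^(3/2)], the fourth power
    of the claim. A Gaussian serves both arguments: its transform is a Gaussian, and against it
    [e^(kx)] costs only [e^(k^2)]. *)

Definition om (x : R) : R := / (1 + x ^ 2).

Lemma om_pos x : 0 < om x.
Proof. apply Rinv_0_lt_compat; nra. Qed.

Lemma om_le1 x : om x <= 1.
Proof.
  unfold om; rewrite <- Rinv_1 at 2; apply Rinv_le_contravar; nra.
Qed.

Lemma om_even x : om (- x) = om x.
Proof. unfold om; f_equal; ring. Qed.

Lemma om_inv x : om x * (1 + x ^ 2) = 1.
Proof. unfold om; field; nra. Qed.

Lemma om_cont x : continuous om x.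
Proof.
  apply (ex_derive_continuous om); unfold om; auto_derive; nra.
Qed.

(** The majorant [om] has primitive [atan], so tails and total mass are explicit, and a common [M]
    bounds the tails of a whole family of functions at once. This uniformity does the work of
    dominated convergence. *)
Definition dom (M : R) (f : R -> R) : Prop :=
  (forall x, continuous f x) /\ forall x, Rabs (f x) <= M * om x.

(* An improper Riemann integral over the line; a junk value unless [f] is [dom]inated. *)
Definition intR (f : R -> R) : R :=
  real (Lim_seq (fun n => RInt f (- INR n) (INR n))).

Lemma cont_ex_RInt (f : R -> R) a b :
  (forall x, continuous f x) -> ex_RInt f a b.
Proof. intros H; apply (ex_RInt_continuous (V := R_CompleteNormedModule)); auto. Qed.

Lemma dom_pos M f : dom M f -> 0 <= M.
Proof.
  intros [_ H]. specialize (H 0). pose proof (om_pos 0).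
  pose proof (Rabs_pos (f 0)). nra.
Qed.

Lemma RInt_om a b : RInt om a b = atan b - atan a.
Proof.
  apply is_RInt_unique.
  apply (is_RInt_derive atan om).
  - intros x _. apply is_derive_Reals.
    replace (om x) with (/ (1 + x ^ 2)) by reflexivity.
    apply derivable_pt_lim_atan.
  - intros x _; apply om_cont.
Qed.

Lemma dom_RInt M f a b : dom M f -> a <= b ->
  Rabs (RInt f a b) <= M * (atan b - atan a).
Proof.
  intros [Hc Hb] Hab.
  eapply Rle_trans; [apply abs_RInt_le; [auto | now apply cont_ex_RInt] |].
  rewrite <- RInt_om.
  replace (M * RInt om a b) with (RInt (fun x => M * om x) a b).
  2:{ apply (RInt_scal om a b M). apply cont_ex_RInt, om_cont. }
  apply RInt_le; auto.
  - apply cont_ex_RInt; intros x. apply (continuous_comp f Rabs); [apply Hc | apply continuous_Rabs].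
  - apply cont_ex_RInt; intros x.
    apply (continuous_scal_r M om), om_cont.
Qed.

Lemma RInt_split (f : R -> R) a b c : (forall x, continuous f x) ->
  RInt f a c = RInt f a b + RInt f b c.
Proof.
  intros H. symmetry. apply (RInt_Chasles f a b c); now apply cont_ex_RInt.
Qed.

(** For [a >= 0] this is the mass of [om] outside [[-a, a]]. *)
Definition tl (a : R) : R := PI - 2 * atan a.

Lemma tl_pos a : 0 < tl a.
Proof. unfold tl; pose proof (atan_bound a); lra. Qed.

Lemma dom_diff M f a b : dom M f -> a <= b ->
  Rabs (RInt f (- b) b - RInt f (- a) a) <= M * (2 * atan b - 2 * atan a).
Proof.
  intros D Hab. pose proof D as [Hc _].
  rewrite (RInt_split f (- b) (- a) b), (RInt_split f (- a) a b) by auto.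
  pose proof (dom_RInt M f (- b) (- a) D ltac:(lra)) as H1.
  pose proof (dom_RInt M f a b D Hab) as H2.
  rewrite !atan_opp in H1.
  replace (RInt f (- b) (- a) + (RInt f (- a) a + RInt f a b) - RInt f (- a) a)
    with (RInt f (- b) (- a) + RInt f a b) by ring.
  eapply Rle_trans; [apply Rabs_triang |]. lra.
Qed.

Lemma tl_lim : is_lim_seq (fun n => tl (INR n)) 0.
Proof.
  apply is_lim_seq_spec. intros eps.
  pose proof PI_RGT_0 as HPI. pose proof (cond_pos eps) as He.
  set (d := Rmin (eps / 2) (PI / 2)).
  assert (Hd : 0 < d) by (apply Rmin_pos; lra).
  assert (Hd1 : d <= eps / 2) by apply Rmin_l.
  assert (Hd2 : d <= PI / 2) by apply Rmin_r.
  destruct (nfloor_ex (Rmax 0 (tan (PI / 2 - d / 2)))) as [N [_ HN]]; [apply Rmax_l |].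
  exists (S N). intros n Hn.
  rewrite Rminus_0_r, Rabs_pos_eq by (left; apply tl_pos).
  assert (tan (PI / 2 - d / 2) < INR n).
  { pose proof (Rmax_r 0 (tan (PI / 2 - d / 2))).
    apply le_INR in Hn. rewrite S_INR in Hn. lra. }
  assert (PI / 2 - d / 2 < atan (INR n)).
  { rewrite <- (atan_tan (PI / 2 - d / 2)) by lra. now apply atan_increasing. }
  unfold tl; lra.
Qed.

Lemma intR_lim M f : dom M f -> is_lim_seq (fun n => RInt f (- INR n) (INR n)) (intR f).
Proof.
  intros D. apply Lim_seq_correct'.
  apply ex_lim_seq_cauchy_corr. intros eps.
  pose proof (dom_pos _ _ D) as HM.
  destruct (proj2 (is_lim_seq_spec _ _) tl_lim
     (mkposreal (eps / (M + 1)) ltac:(apply Rdiv_lt_0_compat; [apply cond_pos | lra])))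
    as [N HN]. simpl in HN.
  assert (Hk : forall n m, (N <= n)%nat -> (n <= m)%nat ->
     Rabs (RInt f (- INR m) (INR m) - RInt f (- INR n) (INR n)) < eps).
  { intros n m Hn Hm. specialize (HN n Hn).
    rewrite Rminus_0_r, Rabs_pos_eq in HN by (left; apply tl_pos).
    eapply Rle_lt_trans; [apply (dom_diff M); auto; now apply le_INR |].
    apply Rlt_div_r in HN; [| lra].
    pose proof (tl_pos (INR m)). pose proof (tl_pos (INR n)).
    unfold tl in *. nra. }
  exists N. intros n m Hn Hm.
  destruct (Nat.le_ge_cases n m).
  - rewrite Rabs_minus_sym; auto.
  - auto.
Qed.

(** The rate depends on [f] only through [M], and [a] is any real number. In this form the limit in
    [n] is exchanged with parameters, shifts and a second integral. *)
Lemma intR_close M f a : dom M f -> Rabs (intR f - RInt f (- a) a) <= M * tl a.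
Proof.
  intros D.
  destruct (nfloor_ex (Rmax 0 a)) as [N [_ HN]]; [apply Rmax_l |].
  pose proof (intR_lim _ _ D) as H.
  assert (H2 : is_lim_seq (fun n => Rabs (RInt f (- INR n) (INR n) - RInt f (- a) a))
            (Rabs (intR f - RInt f (- a) a))).
  { apply (is_lim_seq_abs _ (intR f - RInt f (- a) a)).
    apply is_lim_seq_minus'; [exact H | apply is_lim_seq_const]. }
  change (Rbar_le (Rabs (intR f - RInt f (- a) a)) (M * tl a)).
  eapply is_lim_seq_le_loc; [| exact H2 | apply is_lim_seq_const].
  exists (S N). intros n Hn.
  assert (a <= INR n).
  { pose proof (Rmax_r 0 a). apply le_INR in Hn. rewrite S_INR in Hn. lra. }
  eapply Rle_trans; [apply (dom_diff M); auto |].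
  pose proof (dom_pos _ _ D). pose proof (atan_bound (INR n)). unfold tl; nra.
Qed.

Lemma intR_unique f (l : R) :
  is_lim_seq (fun n => RInt f (- INR n) (INR n)) l -> intR f = l.
Proof. intros H; unfold intR. now rewrite (is_lim_seq_unique _ _ H). Qed.

Lemma intR_ext f g : (forall x, f x = g x) -> intR f = intR g.
Proof.
  intros H. unfold intR. f_equal. apply Lim_seq_ext; intros n.
  apply RInt_ext; intros; apply H.
Qed.

Lemma dom_ext M f g : (forall x, f x = g x) -> dom M f -> dom M g.
Proof.
  intros H [H1 H2]; split; intros x.
  - apply (continuous_ext f g); auto.
  - rewrite <- H; apply H2.
Qed.

Lemma dom_le M N f : M <= N -> dom M f -> dom N f.
Proof.
  intros H [H1 H2]; split; auto. intros x. specialize (H2 x).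
  pose proof (om_pos x). nra.
Qed.

Lemma dom_plus M N f g : dom M f -> dom N g -> dom (M + N) (fun x => f x + g x).
Proof.
  intros [H1 H2] [H3 H4]; split; intros x.
  - apply (continuous_plus f g); auto.
  - eapply Rle_trans; [apply Rabs_triang |].
    specialize (H2 x); specialize (H4 x); nra.
Qed.

Lemma dom_scal M f c : dom M f -> dom (Rabs c * M) (fun x => c * f x).
Proof.
  intros [H1 H2]; split; intros x.
  - apply (continuous_scal_r c f), H1.
  - rewrite Rabs_mult. specialize (H2 x). pose proof (Rabs_pos c); nra.
Qed.

Lemma intR_plus M N f g : dom M f -> dom N g ->
  intR (fun x => f x + g x) = intR f + intR g.
Proof.
  intros Hf Hg. apply intR_unique.
  apply (is_lim_seq_ext (fun n => RInt f (- INR n) (INR n) + RInt g (- INR n) (INR n))).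
  - intros n. symmetry. apply (RInt_plus f g); apply cont_ex_RInt; [apply Hf | apply Hg].
  - apply is_lim_seq_plus'; eapply intR_lim; eauto.
Qed.

Lemma intR_scal M f c : dom M f -> intR (fun x => c * f x) = c * intR f.
Proof.
  intros Hf. apply intR_unique.
  apply (is_lim_seq_ext (fun n => c * RInt f (- INR n) (INR n))).
  - intros n. symmetry. apply (RInt_scal f); apply cont_ex_RInt; apply Hf.
  - apply (is_lim_seq_scal_l _ c (intR f)). eapply intR_lim; eauto.
Qed.

Lemma intR_minus M N f g : dom M f -> dom N g ->
  intR (fun x => f x - g x) = intR f - intR g.
Proof.
  intros Hf Hg.
  rewrite (intR_ext _ (fun x => f x + (-1) * g x)) by (intros; ring).
  rewrite (intR_plus M (Rabs (-1) * N)); auto using dom_scal.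
  rewrite (intR_scal N); auto. ring.
Qed.

Lemma intR_le M N f g : dom M f -> dom N g -> (forall x, f x <= g x) -> intR f <= intR g.
Proof.
  intros Hf Hg H.
  apply (is_lim_seq_le (fun n => RInt f (- INR n) (INR n))
           (fun n => RInt g (- INR n) (INR n)) (intR f) (intR g)).
  - intros n. apply RInt_le; auto.
    + pose proof (pos_INR n); lra.
    + apply cont_ex_RInt, Hf.
    + apply cont_ex_RInt, Hg.
  - eapply intR_lim; eauto.
  - eapply intR_lim; eauto.
Qed.

Lemma dom_om : dom 1 om.
Proof.
  split; [apply om_cont |]. intros x. rewrite Rabs_pos_eq; [lra |].
  left; apply om_pos.
Qed.

Lemma intR_om : intR om = PI.
Proof.
  apply intR_unique.
  apply (is_lim_seq_ext (fun n => PI - tl (INR n))).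
  - intros n. rewrite RInt_om, atan_opp. unfold tl; ring.
  - replace (Finite PI) with (Finite (PI - 0)) by (f_equal; ring).
    apply is_lim_seq_minus'; [apply is_lim_seq_const | apply tl_lim].
Qed.

Lemma intR_pos M f : dom M f -> (forall x, 0 <= f x) -> 0 <= intR f.
Proof.
  intros D H. apply (is_lim_seq_le (fun _ => 0)
           (fun n => RInt f (- INR n) (INR n)) 0 (intR f)).
  - intros n. apply RInt_ge_0; auto.
    + pose proof (pos_INR n); lra.
    + apply cont_ex_RInt, D.
  - apply is_lim_seq_const.
  - eapply intR_lim; eauto.
Qed.

Lemma intR_abs_le M N f g : dom M f -> dom N g -> (forall x, Rabs (f x) <= g x) ->
  Rabs (intR f) <= intR g.
Proof.
  intros Hf Hg H. apply Rabs_le. split.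
  - replace (- intR g) with (-1 * intR g) by ring. rewrite <- (intR_scal N) by auto.
    eapply intR_le; [apply dom_scal; eauto | eauto |].
    intros x. specialize (H x). pose proof (Rle_abs (- f x)). rewrite Rabs_Ropp in *. lra.
  - eapply intR_le; eauto. intros x. eapply Rle_trans; [apply Rle_abs | apply H].
Qed.

Lemma intR_bound M f : dom M f -> Rabs (intR f) <= PI * M.
Proof.
  intros D. rewrite <- intR_om, Rmult_comm, <- (intR_scal 1) by apply dom_om.
  eapply intR_abs_le; [eauto | apply dom_scal, dom_om |]. apply D.
Qed.

(** Peetre's inequality, [1 + x^2 <= 2 (1 + s^2) (1 + (x - s)^2)]: the right side minus the left is
    [1 + (x - 2 s)^2 + 2 s^2 (x - s)^2]. *)
Lemma om_shift s x : om (x - s) <= 2 * (1 + s ^ 2) * om x.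
Proof.
  pose proof (om_pos x). pose proof (om_pos (x - s)).
  pose proof (om_inv x). pose proof (om_inv (x - s)).
  apply Rmult_le_reg_r with ((1 + x ^ 2) * (1 + (x - s) ^ 2)); [nra |].
  replace (om (x - s) * ((1 + x ^ 2) * (1 + (x - s) ^ 2)))
    with ((om (x - s) * (1 + (x - s) ^ 2)) * (1 + x ^ 2)) by ring.
  replace (2 * (1 + s ^ 2) * om x * ((1 + x ^ 2) * (1 + (x - s) ^ 2)))
    with (2 * (1 + s ^ 2) * (om x * (1 + x ^ 2)) * (1 + (x - s) ^ 2)) by ring.
  rewrite H1, H2. pose proof (pow2_ge_0 (x - 2 * s)). pose proof (pow2_ge_0 (s * (x - s))).
  nra.
Qed.

Lemma dom_shift M f s : dom M f -> dom (M * (2 * (1 + s ^ 2))) (fun x => f (x - s)).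
Proof.
  intros D. pose proof D as [H1 H2]. split; intros x.
  - apply (continuous_comp (fun x => x - s) f); auto.
    apply (continuous_minus (fun x => x) (fun _ => s));
      [apply continuous_id | apply continuous_const].
  - eapply Rle_trans; [apply H2 |]. rewrite Rmult_assoc.
    apply Rmult_le_compat_l; [eapply dom_pos; eauto | apply om_shift].
Qed.

Lemma RInt_shift (f : R -> R) s a b : (forall x, continuous f x) ->
  RInt (fun x => f (x - s)) a b = RInt f (a - s) (b - s).
Proof.
  intros H.
  pose proof (RInt_comp_lin f 1 (- s) a b) as E.
  assert (HE : ex_RInt f (1 * a + - s) (1 * b + - s)) by now apply cont_ex_RInt.
  specialize (E HE).
  replace (1 * a + - s) with (a - s) in E by ring.
  replace (1 * b + - s) with (b - s) in E by ring.
  rewrite <- E. apply RInt_ext. intros x _.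
  unfold scal; simpl; unfold mult; simpl. rewrite Rmult_1_l. f_equal; ring.
Qed.

Lemma RInt_reflect (f : R -> R) a b : (forall x, continuous f x) ->
  RInt (fun x => f (- x)) a b = - RInt f (- a) (- b).
Proof.
  intros H.
  pose proof (RInt_comp_lin f (-1) 0 a b) as E.
  assert (HE : ex_RInt f (-1 * a + 0) (-1 * b + 0)) by now apply cont_ex_RInt.
  specialize (E HE).
  replace (-1 * a + 0) with (- a) in E by ring.
  replace (-1 * b + 0) with (- b) in E by ring.
  rewrite <- E. rewrite <- (RInt_opp (fun y => scal (-1) (f (-1 * y + 0)))).
  - apply RInt_ext. intros x _.
    unfold scal, opp; simpl; unfold mult; simpl.
    replace (-1 * x + 0) with (- x) by ring. lra.
  - apply cont_ex_RInt. intros x. apply (continuous_scal_r (-1) (fun y => f (-1 * y + 0))).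
    apply (continuous_comp (fun y => -1 * y + 0) f); auto.
    apply (ex_derive_continuous (fun y : R => -1 * y + 0)); auto_derive; auto.
Qed.

Lemma intR_reflect M f : dom M f -> intR (fun x => f (- x)) = intR f.
Proof.
  intros D. apply intR_unique.
  apply (is_lim_seq_ext (fun n => RInt f (- INR n) (INR n))); [| eapply intR_lim; eauto].
  intros n. rewrite RInt_reflect by apply D. rewrite Ropp_involutive.
  symmetry. apply (opp_RInt_swap f). apply cont_ex_RInt, D.
Qed.

Lemma atan_le a b : a <= b -> atan a <= atan b.
Proof. intros [H | ->]; [left; now apply atan_increasing | lra]. Qed.

Lemma tl_lim_shift s : is_lim_seq (fun n => tl (INR n - Rabs s)) 0.
Proof.
  destruct (nfloor_ex (Rabs s) (Rabs_pos s)) as [N [_ HN]].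
  apply (is_lim_seq_incr_n _ (S N)).
  apply (is_lim_seq_le_le (fun _ => 0) _ (fun n => tl (INR n))).
  - intros n. split; [left; apply tl_pos |].
    unfold tl. assert (atan (INR n) <= atan (INR (n + S N) - Rabs s)); [| lra].
    apply atan_le. rewrite plus_INR, S_INR. lra.
  - apply is_lim_seq_const.
  - apply tl_lim.
Qed.

(** The shifted window [[- n - s, n - s]] contains [[- c, c]] with [c = n - |s|], and what it has
    beyond that is at most a tail of [f] on either side. *)
Lemma intR_shift M f s : dom M f -> intR (fun x => f (x - s)) = intR f.
Proof.
  intros D. apply intR_unique.
  pose proof (dom_pos _ _ D) as HM.
  apply (is_lim_seq_le_le_loc
    (fun n => intR f - 2 * M * tl (INR n - Rabs s)) _
    (fun n => intR f + 2 * M * tl (INR n - Rabs s)) (intR f)).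
  - exists 0%nat. intros n _.
    assert (H : Rabs (RInt f (- INR n - s) (INR n - s) - intR f) <= 2 * M * tl (INR n - Rabs s)).
    { set (c := INR n - Rabs s). pose proof D as [Hc _].
      rewrite (RInt_split f (- INR n - s) (- c) (INR n - s)), (RInt_split f (- c) c (INR n - s)) by auto.
      pose proof (dom_RInt M f (- INR n - s) (- c) D) as H1.
      pose proof (dom_RInt M f c (INR n - s) D) as H2.
      pose proof (intR_close M f c D) as H3.
      assert (- Rabs s <= s <= Rabs s) by (pose proof (Rabs_maj2 s); pose proof (Rle_abs s); lra).
      specialize (H1 ltac:(unfold c; lra)). specialize (H2 ltac:(unfold c; lra)).
      rewrite atan_opp in H1.
      pose proof (atan_bound (- INR n - s)). pose proof (atan_bound (INR n - s)).
      rewrite Rabs_minus_sym in H3.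
      replace (RInt f (- INR n - s) (- c) + (RInt f (- c) c + RInt f c (INR n - s)) - intR f)
        with (RInt f (- INR n - s) (- c) + RInt f c (INR n - s) + (RInt f (- c) c - intR f)) by ring.
      eapply Rle_trans; [apply Rabs_triang |].
      eapply Rle_trans; [apply Rplus_le_compat_r, Rabs_triang |].
      unfold tl in *. nra. }
    rewrite RInt_shift by apply D. apply Rabs_le_between in H. lra.
  - replace (Finite (intR f)) with (Finite (intR f - 2 * M * 0)) by (f_equal; ring).
    apply is_lim_seq_minus'; [apply is_lim_seq_const |].
    apply (is_lim_seq_scal_l _ (2 * M) 0), tl_lim_shift.
  - replace (Finite (intR f)) with (Finite (intR f + 2 * M * 0)) by (f_equal; ring).
    apply is_lim_seq_plus'; [apply is_lim_seq_const |].
    apply (is_lim_seq_scal_l _ (2 * M) 0), tl_lim_shift.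
Qed.

(** * Continuity in a parameter, Fubini and integration by parts *)

Definition cont2 (h : R -> R -> R) : Prop := forall x y, continuity_2d_pt h x y.

Lemma cont2_snd h x y : cont2 h -> continuous (h x) y.
Proof.
  intros H. apply continuity_pt_filterlim. intros eps He.
  destruct (H x y (mkposreal eps He)) as [d Hd].
  exists d. split; [apply cond_pos |]. intros z [_ Hz]. simpl in *.
  apply Hd; [rewrite Rminus_diag, Rabs_R0; apply cond_pos | exact Hz].
Qed.

Lemma cont2_fst h x y : cont2 h -> continuous (fun x => h x y) x.
Proof.
  intros H. apply continuity_pt_filterlim. intros eps He.
  destruct (H x y (mkposreal eps He)) as [d Hd].
  exists d. split; [apply cond_pos |]. intros z [_ Hz]. simpl in *.
  apply Hd; [exact Hz | rewrite Rminus_diag, Rabs_R0; apply cond_pos].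
Qed.

Lemma cont2_swap h : cont2 h -> cont2 (fun x y => h y x).
Proof.
  intros H x y eps. destruct (H y x eps) as [d Hd]. exists d.
  intros u v Hu Hv. now apply Hd.
Qed.

Lemma cont_param_RInt h a b x0 : cont2 h -> a <= b ->
  continuous (fun x => RInt (h x) a b) x0.
Proof.
  intros H Hab. apply continuity_pt_filterlim. intros eps He.
  assert (He' : 0 < eps / (b - a + 1)) by (apply Rdiv_lt_0_compat; lra).
  destruct (uniform_continuity_2d_1d' h a b x0 (fun x _ => H x0 x) (mkposreal _ He'))
    as [d Hd].
  exists d. split; [apply cond_pos |]. intros z [_ Hz]. simpl in *.
  unfold Rdist in *.
  rewrite <- (RInt_minus (h z) (h x0)) by (apply cont_ex_RInt; intros; now apply cont2_snd).
  apply Rle_lt_trans with ((b - a) * (eps / (b - a + 1))).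
  - apply abs_RInt_le_const; auto.
    + apply cont_ex_RInt. intros y.
      apply (continuous_minus (h z) (h x0)); now apply cont2_snd.
    + intros y Hy. left. apply (Hd y x0 y z); auto; try lra.
      * pose proof (cond_pos d); lra.
      * apply Rabs_lt_between in Hz. lra.
      * rewrite Rminus_diag, Rabs_R0; apply cond_pos.
  - apply Rmult_lt_reg_r with (b - a + 1); [lra |].
    field_simplify; nra.
Qed.

(** A common [M] makes the tails small for all parameters at once, which reduces the claim to one
    compact interval. *)
Lemma cont_param_intR h M x0 : cont2 h -> (forall x, dom M (h x)) ->
  continuous (fun x => intR (h x)) x0.
Proof.
  intros H D. apply continuity_pt_filterlim. intros eps He.
  pose proof (dom_pos _ _ (D x0)) as HM.
  assert (He' : 0 < eps / 3 / (M + 1)) by (apply Rdiv_lt_0_compat; lra).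
  destruct (proj2 (is_lim_seq_spec _ _) tl_lim (mkposreal _ He')) as [N HN].
  specialize (HN N (le_n N)). simpl in HN.
  rewrite Rminus_0_r, Rabs_pos_eq in HN by (left; apply tl_pos).
  apply Rlt_div_r in HN; [| lra].
  assert (Hc := cont_param_RInt h (- INR N) (INR N) x0 H ltac:(pose proof (pos_INR N); lra)).
  apply continuity_pt_filterlim in Hc.
  destruct (Hc (eps / 3) ltac:(lra)) as [d [Hd1 Hd2]].
  exists d. split; auto. intros z Hz. specialize (Hd2 z Hz).
  simpl in *. unfold Rdist in *.
  pose proof (intR_close _ _ (INR N) (D z)) as H1.
  pose proof (intR_close _ _ (INR N) (D x0)) as H2.
  apply Rabs_lt_between in Hd2. apply Rabs_le_between in H1, H2.
  apply Rabs_lt_between. split; nra.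
Qed.

(** As functions of the endpoint [b], both iterated integrals vanish at [a] and have the derivative
    [RInt (h b) c d]: one by the fundamental theorem, the other by differentiation under the
    integral. *)
Lemma Fubini_rect h a b c d : cont2 h -> a < b -> c <= d ->
  RInt (fun x => RInt (h x) c d) a b = RInt (fun y => RInt (fun x => h x y) a b) c d.
Proof.
  intros H Hab Hcd.
  set (Phi := fun b => RInt (fun x => RInt (h x) c d) a b).
  set (Psi := fun b => RInt (fun y => RInt (fun x => h x y) a b) c d).
  assert (HPhi : forall z, is_derive Phi z (RInt (h z) c d)).
  { intros z. apply (is_derive_RInt (fun x => RInt (h x) c d) Phi a).
    - exists (mkposreal 1 Rlt_0_1). intros t _.
      apply (RInt_correct (fun x => RInt (h x) c d)). apply cont_ex_RInt.
      intros x; now apply cont_param_RInt.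
    - now apply cont_param_RInt. }
  assert (Hin : forall y z, is_derive (fun z => RInt (fun x => h x y) a z) z (h z y)).
  { intros y z. apply (is_derive_RInt (fun x => h x y) _ a).
    - exists (mkposreal 1 Rlt_0_1). intros t _.
      apply (RInt_correct (fun x => h x y)). apply cont_ex_RInt.
      intros x; now apply cont2_fst.
    - now apply cont2_fst. }
  assert (HPsi : forall z, is_derive Psi z (RInt (h z) c d)).
  { intros z. unfold Psi.
    rewrite (RInt_ext (h z) (fun y => Derive (fun z => RInt (fun x => h x y) a z) z)).
    2:{ intros y _. symmetry. apply is_derive_unique, Hin. }
    apply (is_derive_RInt_param (fun z y => RInt (fun x => h x y) a z)).
    - exists (mkposreal 1 Rlt_0_1). intros t _ y _. eexists; apply Hin.
    - intros y _. apply (continuity_2d_pt_ext h); [| apply H].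
      intros u v. symmetry. apply is_derive_unique, Hin.
    - exists (mkposreal 1 Rlt_0_1). intros t _. apply cont_ex_RInt. intros y.
      destruct (Rle_lt_dec a t).
      + apply (cont_param_RInt (fun y x => h x y)); auto. now apply cont2_swap.
      + apply (continuous_ext (fun y => - RInt (fun x => h x y) t a)).
        * intros y'. apply (opp_RInt_swap (fun x => h x y')).
          apply cont_ex_RInt. intros; now apply cont2_fst.
        * apply (continuous_opp (fun y => RInt (fun x => h x y) t a)).
          apply (cont_param_RInt (fun y x => h x y)); [now apply cont2_swap | lra]. }
  assert (E : Phi a - Psi a = Phi b - Psi b).
  { apply (eq_is_derive (fun z => Phi z - Psi z)); auto. intros t _.
    change (is_derive (fun z => Phi z - Psi z) t 0).
    rewrite <- (Rminus_diag (RInt (h t) c d)).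
    apply (is_derive_minus Phi Psi); auto. }
  fold (Phi b) (Psi b).
  assert (Phi a = 0) by (apply (RInt_point (V := R_CompleteNormedModule) a (fun x => RInt (h x) c d))).
  assert (Psi a = 0).
  { unfold Psi. rewrite (RInt_ext _ (fun _ => 0)).
    - rewrite RInt_const. apply (scal_zero_r (V := R_ModuleSpace)).
    - intros x _; apply (RInt_point (V := R_CompleteNormedModule) a (fun x0 => h x0 x)). }
  lra.
Qed.

(** Both iterated improper integrals are limits of integrals over the same squares [[-n, n]^2], on
    which [Fubini_rect] applies. *)
Lemma Fubini_intR h M : cont2 h -> (forall x y, Rabs (h x y) <= M * om x * om y) ->
  intR (fun x => intR (h x)) = intR (fun y => intR (fun x => h x y)).
Proof.
  intros H Hb.
  assert (main : forall h, cont2 h -> (forall x y, Rabs (h x y) <= M * om x * om y) ->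
    is_lim_seq (fun n => RInt (fun x => RInt (h x) (- INR n) (INR n)) (- INR n) (INR n))
      (intR (fun x => intR (h x)))).
  { clear h H Hb. intros h H Hb.
    assert (D : forall x, dom (M * om x) (h x)).
    { intros x. split; [intros y; now apply cont2_snd | apply Hb]. }
    assert (HM : 0 <= M).
    { pose proof (dom_pos _ _ (D 0)). pose proof (om_pos 0). nra. }
    assert (D1 : forall x, dom M (h x)).
    { intros x. apply (dom_le (M * om x)); auto. pose proof (om_le1 x). nra. }
    assert (DI : dom (PI * M) (fun x => intR (h x))).
    { split; [intros; now apply (cont_param_intR h M) |]. intros x.
      rewrite Rmult_assoc. now apply intR_bound. }
    apply (is_lim_seq_ext (fun n => RInt (fun x => intR (h x)) (- INR n) (INR n)
        - RInt (fun x => intR (h x) - RInt (h x) (- INR n) (INR n)) (- INR n) (INR n))).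
    - intros n. pose proof (pos_INR n).
      rewrite (RInt_minus (fun x => intR (h x)) (fun x => RInt (h x) (- INR n) (INR n))).
      + unfold minus, plus, opp; simpl. ring.
      + apply cont_ex_RInt, DI.
      + apply cont_ex_RInt. intros x. apply cont_param_RInt; [auto | lra].
    - replace (Finite (intR (fun x => intR (h x)))) with (Finite (intR (fun x => intR (h x)) - 0))
        by (f_equal; ring).
      apply is_lim_seq_minus'; [eapply intR_lim; eauto |].
      apply (is_lim_seq_le_le (fun n => - (M * PI * tl (INR n))) _ (fun n => M * PI * tl (INR n))).
      + intros n. apply Rabs_le_between.
        (* The truncation error of the inner integral still carries the factor [om x], so its outer
           integral is bounded by [M * PI] times the tail. *)
        assert (D2 : dom (M * tl (INR n)) (fun x => intR (h x) - RInt (h x) (- INR n) (INR n))).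
        { split; intros x.
          - apply (continuous_minus (fun x => intR (h x)) (fun x => RInt (h x) (- INR n) (INR n))).
            + apply DI.
            + apply cont_param_RInt; [auto |]. pose proof (pos_INR n); lra.
          - eapply Rle_trans; [apply intR_close, D |]. lra. }
        eapply Rle_trans; [apply (dom_RInt _ _ _ _ D2); pose proof (pos_INR n); lra |].
        pose proof (atan_bound (INR n)). rewrite atan_opp.
        pose proof (dom_pos _ _ D2). nra.
      + replace (Finite 0) with (Finite (- (M * PI * 0))) by (f_equal; ring).
        apply (is_lim_seq_opp _ (M * PI * 0)).
        apply (is_lim_seq_scal_l _ (M * PI) 0), tl_lim.
      + replace (Finite 0) with (Finite (M * PI * 0)) by (f_equal; ring).
        apply (is_lim_seq_scal_l _ (M * PI) 0), tl_lim. }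
  pose proof (main h H Hb) as L1.
  pose proof (main (fun y x => h x y) (cont2_swap _ H)) as L2.
  specialize (L2 ltac:(intros x y; specialize (Hb y x); lra)).
  apply is_lim_seq_unique in L1.
  assert (L3 : is_lim_seq (fun n => RInt (fun x => RInt (h x) (- INR n) (INR n)) (- INR n) (INR n))
     (intR (fun y => intR (fun x => h x y)))).
  { eapply is_lim_seq_ext; [| exact L2]. intros n. simpl.
    (* [Fubini_rect] asks for [a < b], so the degenerate square [n = 0] is treated apart. *)
    destruct n.
    - simpl. replace (-0) with 0 by ring. now rewrite !RInt_point.
    - symmetry. apply Fubini_rect; auto; pose proof (lt_0_INR (S n) ltac:(lia)); lra. }
  apply is_lim_seq_unique in L3. rewrite L1 in L3. now injection L3.
Qed.

Lemma om_lim : is_lim_seq (fun n => om (INR n)) 0.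
Proof.
  apply is_lim_seq_incr_1.
  apply (is_lim_seq_le_le (fun _ => 0) _ (fun n => / INR (S n))).
  - intros n. split; [left; apply om_pos |].
    apply Rinv_le_contravar.
    + apply lt_0_INR; lia.
    + rewrite S_INR. nra.
  - apply is_lim_seq_const.
  - replace (Finite 0) with (Rbar_inv p_infty) by reflexivity.
    apply is_lim_seq_inv; [| discriminate].
    apply -> (is_lim_seq_incr_1 INR). apply is_lim_seq_INR.
Qed.

(** The boundary terms vanish because [G] itself is dominated. Integrations by parts on the whole
    line go through this lemma. *)
Lemma intR_deriv_zero M N G g : (forall x, is_derive G x (g x)) -> dom M g ->
  (forall x, Rabs (G x) <= N * om x) -> intR g = 0.
Proof.
  intros HG Dg HN. apply intR_unique.
  apply (is_lim_seq_ext (fun n => G (INR n) - G (- INR n))).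
  { intros n. symmetry. apply is_RInt_unique.
    apply (is_RInt_derive G g); intros; [apply HG | apply Dg]. }
  assert (Hom : is_lim_seq (fun n => 2 * N * om (INR n)) 0).
  { replace (Finite 0) with (Finite (2 * N * 0)) by (f_equal; ring).
    apply (is_lim_seq_scal_l _ (2 * N) 0), om_lim. }
  apply (is_lim_seq_le_le (fun n => - (2 * N * om (INR n))) _ (fun n => 2 * N * om (INR n))); auto.
  - intros n. apply Rabs_le_between.
    pose proof (HN (INR n)) as H1. pose proof (HN (- INR n)) as H2. rewrite om_even in H2.
    apply Rabs_le_between in H1, H2. apply Rabs_le. lra.
  - replace (Finite 0) with (Finite (- 0)) by (f_equal; ring).
    now apply (is_lim_seq_opp _ 0).
Qed.

(** One-dimensional Sobolev embedding: [G] vanishes at minus infinity, so [G x] is the integral of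
    [g] up to [x]. It turns energy bounds into pointwise ones. *)
Lemma pointwise_le_intR M N P G g H x : (forall x, is_derive G x (g x)) ->
  (forall x, continuous g x) -> (forall x, Rabs (g x) <= H x) -> dom M H ->
  (forall x, Rabs (G x) <= N * om x) -> P = intR H -> G x <= P.
Proof.
  intros HG Hg HH D HN ->.
  assert (key : forall n : nat, (Rabs x <= INR n) -> G x <= RInt H (- INR n) (INR n) + N * om (INR n)).
  { intros n Hn. pose proof (Rabs_maj2 x). pose proof (Rle_abs x).
    assert (E : RInt g (- INR n) x = G x - G (- INR n)).
    { apply is_RInt_unique. apply (is_RInt_derive G g); intros; auto. }
    assert (E1 : RInt g (- INR n) x <= RInt H (- INR n) x).
    { apply RInt_le; try (apply cont_ex_RInt; auto; apply D); try lra.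
      intros y _. eapply Rle_trans; [apply Rle_abs | apply HH]. }
    assert (E2 : 0 <= RInt H x (INR n)).
    { apply RInt_ge_0; [lra | apply cont_ex_RInt, D |]. intros y _.
      eapply Rle_trans; [apply Rabs_pos | apply HH]. }
    rewrite (RInt_split H (- INR n) x (INR n)) by apply D.
    pose proof (HN (- INR n)) as H2. rewrite om_even in H2. apply Rabs_le_between in H2. lra. }
  destruct (nfloor_ex (Rabs x) (Rabs_pos x)) as [n0 [_ Hn0]].
  change (Rbar_le (G x) (intR H)).
  apply (is_lim_seq_le_loc (fun _ => G x) (fun n => RInt H (- INR n) (INR n) + N * om (INR n))).
  - exists (S n0). intros n Hn. apply key. apply le_INR in Hn. rewrite S_INR in Hn. lra.
  - apply is_lim_seq_const.
  - replace (Finite (intR H)) with (Finite (intR H + 0)) by (f_equal; ring).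
    apply is_lim_seq_plus'; [eapply intR_lim; eauto |].
    replace (Finite 0) with (Finite (N * 0)) by (f_equal; ring).
    apply (is_lim_seq_scal_l _ N 0), om_lim.
Qed.

(** * Complex-valued functions *)
Lemma Cmod_le_comps (z : C) : Cmod z <= Rabs (Re z) + Rabs (Im z).
Proof.
  unfold Cmod. rewrite <- (sqrt_Rsqr (Rabs (Re z) + Rabs (Im z))).
  2:{ pose proof (Rabs_pos (Re z)); pose proof (Rabs_pos (Im z)); lra. }
  apply sqrt_le_1_alt. destruct z as [a b]; simpl. unfold Rsqr.
  pose proof (Rabs_pos a); pose proof (Rabs_pos b).
  pose proof (pow2_abs a) as Ha. pose proof (pow2_abs b) as Hb. simpl in Ha, Hb. nra.
Qed.

Lemma Re_le_Cmod (z : C) : Rabs (Re z) <= Cmod z.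
Proof.
  eapply Rle_trans; [apply Rmax_l | apply Rmax_Cmod].
Qed.

Lemma Im_le_Cmod (z : C) : Rabs (Im z) <= Cmod z.
Proof.
  eapply Rle_trans; [apply Rmax_r | apply Rmax_Cmod].
Qed.

Lemma Cmod_sqr (z : C) : Cmod z ^ 2 = Re z ^ 2 + Im z ^ 2.
Proof.
  unfold Cmod. rewrite <- Rsqr_pow2, Rsqr_sqrt; [destruct z; simpl; ring |].
  destruct z; simpl; nra.
Qed.

Lemma Cmod_minus_sym (a b : C) : Cmod (a - b) = Cmod (b - a).
Proof. rewrite <- (Cmod_opp (a - b)). f_equal. ring. Qed.

Lemma Cmod_triangle3 (a b c : C) : Cmod (a - c) <= Cmod (a - b) + Cmod (b - c).
Proof. replace (a - c)%C with ((a - b) + (b - c))%C by ring. apply Cmod_triangle. Qed.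

Lemma Cmod_minus_le (a b : C) : Cmod (a - b) <= Cmod a + Cmod b.
Proof. eapply Rle_trans; [apply Cmod_triangle |]. rewrite Cmod_opp; lra. Qed.

Definition Ccont (f : R -> C) : Prop :=
  (forall x, continuous (fun y => Re (f y)) x) /\ (forall x, continuous (fun y => Im (f y)) x).

Lemma Ccont_ext f g : (forall x, f x = g x) -> Ccont f -> Ccont g.
Proof.
  intros E [H1 H2]; split; intros x.
  - apply (continuous_ext (fun y => Re (f y))); auto. intros; now rewrite E.
  - apply (continuous_ext (fun y => Im (f y))); auto. intros; now rewrite E.
Qed.

Lemma Ccont_const c : Ccont (fun _ => c).
Proof. split; intros; apply continuous_const. Qed.

Lemma Ccont_RtoC f : (forall x, continuous f x) -> Ccont (fun x => RtoC (f x)).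
Proof. intros H; split; intros x; simpl; [apply H | apply continuous_const]. Qed.

Lemma Ccont_plus f g : Ccont f -> Ccont g -> Ccont (fun x => f x + g x)%C.
Proof.
  intros [H1 H2] [H3 H4]; split; intros x; simpl.
  - apply (continuous_plus (fun y => Re (f y)) (fun y => Re (g y))); auto.
  - apply (continuous_plus (fun y => Im (f y)) (fun y => Im (g y))); auto.
Qed.

Lemma Ccont_opp f : Ccont f -> Ccont (fun x => - f x)%C.
Proof.
  intros [H1 H2]; split; intros x; simpl.
  - apply (continuous_opp (fun y => Re (f y))); auto.
  - apply (continuous_opp (fun y => Im (f y))); auto.
Qed.

Lemma Ccont_minus f g : Ccont f -> Ccont g -> Ccont (fun x => f x - g x)%C.
Proof. intros; apply Ccont_plus; [auto | now apply Ccont_opp]. Qed.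

Lemma Ccont_mult f g : Ccont f -> Ccont g -> Ccont (fun x => f x * g x)%C.
Proof.
  intros [H1 H2] [H3 H4]; split; intros x; simpl.
  - apply (continuous_minus (fun y => Re (f y) * Re (g y)) (fun y => Im (f y) * Im (g y))).
    + apply (continuous_mult (fun y => Re (f y)) (fun y => Re (g y))); auto.
    + apply (continuous_mult (fun y => Im (f y)) (fun y => Im (g y))); auto.
  - apply (continuous_plus (fun y => Re (f y) * Im (g y)) (fun y => Im (f y) * Re (g y))).
    + apply (continuous_mult (fun y => Re (f y)) (fun y => Im (g y))); auto.
    + apply (continuous_mult (fun y => Im (f y)) (fun y => Re (g y))); auto.
Qed.

Lemma Ccont_conj f : Ccont f -> Ccont (fun x => Cconj (f x)).
Proof.
  intros [H1 H2]; split; intros x; simpl; auto.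
  apply (continuous_opp (fun y => Im (f y))); auto.
Qed.

Lemma Ccont_comp f (g : R -> R) : Ccont f -> (forall x, continuous g x) ->
  Ccont (fun x => f (g x)).
Proof.
  intros [H1 H2] Hg; split; intros x.
  - apply (continuous_comp g (fun y => Re (f y))); auto.
  - apply (continuous_comp g (fun y => Im (f y))); auto.
Qed.

Lemma Ccont_comp_minus f s : Ccont f -> Ccont (fun x => f (x - s)).
Proof.
  intros H; apply Ccont_comp; auto. intros x.
  apply (ex_derive_continuous (fun x : R => x - s)); auto_derive; auto.
Qed.

Lemma Ccont_comp_rminus f s : Ccont f -> Ccont (fun x => f (s - x)).
Proof.
  intros H; apply Ccont_comp; auto. intros x.
  apply (ex_derive_continuous (fun x : R => s - x)); auto_derive; auto.
Qed.

Lemma Ccont_comp_opp f : Ccont f -> Ccont (fun x => f (- x)).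
Proof.
  intros H; apply Ccont_comp; auto. intros x.
  apply (ex_derive_continuous (fun x : R => - x)); auto_derive; auto.
Qed.

(** A Lipschitz bound survives pointwise limits with the same constant, so it is carried through the
    iteration as the source of continuity. *)
Definition Lip (L : R) (f : R -> C) : Prop :=
  forall x y, Cmod (f x - f y) <= L * Rabs (x - y).

Lemma continuous_Lip (f : R -> R) L :
  (forall x y, Rabs (f x - f y) <= L * Rabs (x - y)) -> forall x, continuous f x.
Proof.
  intros H x. apply continuity_pt_filterlim. intros e He.
  assert (HL : 0 <= L).
  { specialize (H 1 0). rewrite Rminus_0_r, Rabs_R1 in H.
    pose proof (Rabs_pos (f 1 - f 0)). lra. }
  exists (e / (L + 1)). split; [apply Rdiv_lt_0_compat; lra |].
  intros y [_ Hy]. simpl in *. unfold Rdist in *.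
  eapply Rle_lt_trans; [apply H |].
  apply Rlt_div_r in Hy; [| lra]. nra.
Qed.

Lemma Lip_Ccont L f : Lip L f -> Ccont f.
Proof.
  intros H; split; apply (continuous_Lip _ L); intros x y.
  - eapply Rle_trans; [| apply H]. apply (Re_le_Cmod (f x - f y)).
  - eapply Rle_trans; [| apply H]. apply (Im_le_Cmod (f x - f y)).
Qed.

(** * The phase [exp (i a)] *)

Definition cis (a : R) : C := (cos a, sin a).

Lemma cis_plus a b : cis (a + b) = (cis a * cis b)%C.
Proof.
  unfold cis. rewrite cos_plus, sin_plus. apply injective_projections; simpl; ring.
Qed.

Lemma cis_0 : cis 0 = RtoC 1.
Proof. unfold cis. now rewrite cos_0, sin_0. Qed.

Lemma Cmod_cis a : Cmod (cis a) = 1.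
Proof.
  unfold Cmod, cis; simpl. transitivity (sqrt 1); [f_equal | apply sqrt_1].
  pose proof (sin2_cos2 a) as H. unfold Rsqr in H. lra.
Qed.

Lemma cis_opp a : cis (- a) = Cconj (cis a).
Proof. unfold cis, Cconj. rewrite cos_neg, sin_neg. reflexivity. Qed.

Lemma cis_mul_opp a : (cis a * cis (- a))%C = RtoC 1.
Proof. rewrite <- cis_plus, Rplus_opp_r. apply cis_0. Qed.

Lemma MVT_bound (f f' : R -> R) (a b M : R) :
  (forall c, is_derive f c (f' c)) ->
  (forall c, Rabs (c - a) <= Rabs (b - a) -> Rabs (f' c) <= M) ->
  Rabs (f b - f a) <= M * Rabs (b - a).
Proof.
  intros H Hb.
  destruct (MVT_cor4 f f' a (Rabs (b - a)) (fun c _ => H c) b (Rle_refl _)) as [c [E Hc]].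
  rewrite E, Rabs_mult. apply Rmult_le_compat_r; [apply Rabs_pos | auto].
Qed.

Lemma sin_abs_le h : Rabs (sin h) <= Rabs h.
Proof.
  pose proof (MVT_bound sin cos 0 h 1) as H.
  rewrite sin_0, !Rminus_0_r, Rmult_1_l in H. apply H.
  - intros c. apply is_derive_Reals, derivable_pt_lim_sin.
  - intros c _. apply Rabs_le, COS_bound.
Qed.

Lemma cos_minus_1 h : Rabs (cos h - 1) <= h ^ 2.
Proof.
  pose proof (MVT_bound cos (fun x => - sin x) 0 h (Rabs h)) as H.
  rewrite cos_0, !Rminus_0_r in H.
  replace (h ^ 2) with (Rabs h * Rabs h) by (rewrite <- pow2_abs; ring). apply H.
  - intros c. apply is_derive_Reals, derivable_pt_lim_cos.
  - intros c Hc. rewrite Rminus_0_r in Hc. rewrite Rabs_Ropp. pose proof (sin_abs_le c); lra.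
Qed.

Lemma cos_minus_1' h : Rabs (cos h - 1) <= Rabs h.
Proof.
  pose proof (MVT_bound cos (fun x => - sin x) 0 h 1) as H.
  rewrite cos_0, !Rminus_0_r, Rmult_1_l in H. apply H.
  - intros c. apply is_derive_Reals, derivable_pt_lim_cos.
  - intros c _. rewrite Rabs_Ropp. apply Rabs_le, SIN_bound.
Qed.

Lemma sin_minus_id h : Rabs (sin h - h) <= h ^ 2.
Proof.
  pose proof (MVT_bound (fun x => sin x - x) (fun x => cos x - 1) 0 h (Rabs h)) as H.
  cbv beta in H. rewrite sin_0, !Rminus_0_r in H.
  replace (h ^ 2) with (Rabs h * Rabs h) by (rewrite <- pow2_abs; ring). apply H.
  - intros c. auto_derive; auto. ring.
  - intros c Hc. rewrite Rminus_0_r in Hc. pose proof (cos_minus_1' c); lra.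
Qed.

Lemma cis_Lip a b : Cmod (cis a - cis b) <= 2 * Rabs (a - b).
Proof.
  replace (cis a) with (cis b * cis (a - b))%C by (rewrite <- cis_plus; f_equal; ring).
  replace (cis b * cis (a - b) - cis b)%C with (cis b * (cis (a - b) - RtoC 1))%C by ring.
  rewrite Cmod_mult, Cmod_cis, Rmult_1_l.
  eapply Rle_trans; [apply Cmod_le_comps |]. simpl.
  pose proof (cos_minus_1' (a - b)). pose proof (sin_abs_le (a - b)).
  replace (sin (a - b) + - 0) with (sin (a - b)) by ring. unfold Rminus in *. lra.
Qed.

(** Derivatives are obtained from remainders quadratic in the increment, here and below, because
    such bounds can be integrated over the frequency. *)
Lemma cis_taylor a h : Cmod (cis (a + h) - cis a - Ci * RtoC h * cis a) <= 2 * h ^ 2.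
Proof.
  rewrite cis_plus.
  replace (cis a * cis h - cis a - Ci * RtoC h * cis a)%C
    with (cis a * (cis h - RtoC 1 - Ci * RtoC h))%C by ring.
  rewrite Cmod_mult, Cmod_cis, Rmult_1_l.
  eapply Rle_trans; [apply Cmod_le_comps |]. simpl.
  pose proof (cos_minus_1 h). pose proof (sin_minus_id h).
  replace (cos h + - (1) + - (0 * h - 1 * 0)) with (cos h - 1) by ring.
  replace (sin h + - 0 + - (0 * 0 + 1 * h)) with (sin h - h) by ring. lra.
Qed.

Lemma Ccont_cis (g : R -> R) : (forall x, continuous g x) -> Ccont (fun x => cis (g x)).
Proof.
  intros H. apply (Ccont_comp cis); auto.
  apply (Lip_Ccont 2). intros x y; apply cis_Lip.
Qed.

(** * Integrals of complex-valued functions *)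

Definition Cdom (M : R) (f : R -> C) : Prop :=
  Ccont f /\ forall x, Cmod (f x) <= M * om x.

Definition CI (f : R -> C) : C := (intR (fun x => Re (f x)), intR (fun x => Im (f x))).

Lemma Cdom_Re M f : Cdom M f -> dom M (fun x => Re (f x)).
Proof.
  intros [[H1 _] H]; split; auto. intros x.
  eapply Rle_trans; [apply Re_le_Cmod | apply H].
Qed.

Lemma Cdom_Im M f : Cdom M f -> dom M (fun x => Im (f x)).
Proof.
  intros [[_ H1] H]; split; auto. intros x.
  eapply Rle_trans; [apply Im_le_Cmod | apply H].
Qed.

Lemma Cdom_plus M N f g : Cdom M f -> Cdom N g -> Cdom (M + N) (fun x => f x + g x)%C.
Proof.
  intros [H1 H2] [H3 H4]; split; [now apply Ccont_plus |]. intros x.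
  eapply Rle_trans; [apply Cmod_triangle |]. specialize (H2 x); specialize (H4 x); nra.
Qed.

Lemma Cdom_minus M N f g : Cdom M f -> Cdom N g -> Cdom (M + N) (fun x => f x - g x)%C.
Proof.
  intros [H1 H2] [H3 H4]; split; [now apply Ccont_minus |]. intros x.
  eapply Rle_trans; [apply Cmod_minus_le |]. specialize (H2 x); specialize (H4 x); nra.
Qed.

Lemma Cdom_mult_bounded M N f g : Ccont g -> (forall x, Cmod (g x) <= N) -> Cdom M f ->
  Cdom (N * M) (fun x => g x * f x)%C.
Proof.
  intros Hg HN [H1 H2]; split; [now apply Ccont_mult |]. intros x.
  rewrite Cmod_mult. specialize (H2 x); specialize (HN x). rewrite Rmult_assoc.
  apply Rmult_le_compat; auto using Cmod_ge_0.
Qed.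

Lemma Cdom_scal M f c : Cdom M f -> Cdom (Cmod c * M) (fun x => c * f x)%C.
Proof. intros; apply Cdom_mult_bounded; auto; [apply Ccont_const | intros; lra]. Qed.

Lemma CI_ext f g : (forall x, f x = g x) -> CI f = CI g.
Proof. intros E; unfold CI; f_equal; apply intR_ext; intros; now rewrite E. Qed.

Lemma CI_plus M N f g : Cdom M f -> Cdom N g ->
  CI (fun x => f x + g x)%C = (CI f + CI g)%C.
Proof.
  intros Hf Hg. apply injective_projections; simpl.
  - eapply (intR_plus M N (fun x => Re (f x)) (fun x => Re (g x))); now apply Cdom_Re.
  - eapply (intR_plus M N (fun x => Im (f x)) (fun x => Im (g x))); now apply Cdom_Im.
Qed.

Lemma CI_minus M N f g : Cdom M f -> Cdom N g ->
  CI (fun x => f x - g x)%C = (CI f - CI g)%C.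
Proof.
  intros Hf Hg. apply injective_projections; simpl.
  - eapply (intR_minus M N (fun x => Re (f x)) (fun x => Re (g x))); now apply Cdom_Re.
  - eapply (intR_minus M N (fun x => Im (f x)) (fun x => Im (g x))); now apply Cdom_Im.
Qed.

Lemma CI_scal M f c : Cdom M f -> CI (fun x => c * f x)%C = (c * CI f)%C.
Proof.
  intros Hf. pose proof (Cdom_Re _ _ Hf) as H1. pose proof (Cdom_Im _ _ Hf) as H2.
  destruct c as [a b]. apply injective_projections; simpl.
  - rewrite <- (intR_scal M) by auto. rewrite <- (intR_scal M _ b) by auto.
    eapply intR_minus; eauto using dom_scal.
  - rewrite <- (intR_scal M _ a) by auto. rewrite <- (intR_scal M _ b) by auto.
    eapply intR_plus; eauto using dom_scal.
Qed.

Lemma CI_scal_r M f c : Cdom M f -> CI (fun x => f x * c)%C = (CI f * c)%C.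
Proof.
  intros H. rewrite (CI_ext _ (fun x => c * f x)%C) by (intros; ring).
  rewrite (CI_scal M) by auto. ring.
Qed.

(** The factor [2] comes from bounding real and imaginary parts separately; it reappears in [c1], in
    [int_rho] and in [sol_close]. *)
Lemma CI_le M N f g : Cdom M f -> dom N g -> (forall x, Cmod (f x) <= g x) ->
  Cmod (CI f) <= 2 * intR g.
Proof.
  intros Hf Hg H. eapply Rle_trans; [apply Cmod_le_comps |]. simpl.
  assert (Rabs (intR (fun x => Re (f x))) <= intR g).
  { eapply intR_abs_le; [eapply Cdom_Re; eauto | eauto |].
    intros x; eapply Rle_trans; [apply Re_le_Cmod | apply H]. }
  assert (Rabs (intR (fun x => Im (f x))) <= intR g).
  { eapply intR_abs_le; [eapply Cdom_Im; eauto | eauto |].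
    intros x; eapply Rle_trans; [apply Im_le_Cmod | apply H]. }
  lra.
Qed.

Lemma CI_bound M f : Cdom M f -> Cmod (CI f) <= 2 * PI * M.
Proof.
  intros Hf. eapply Rle_trans; [apply Cmod_le_comps |]. simpl.
  pose proof (intR_bound _ _ (Cdom_Re _ _ Hf)). pose proof (intR_bound _ _ (Cdom_Im _ _ Hf)). lra.
Qed.

Lemma CI_shift M f s : Cdom M f -> CI (fun x => f (x - s)) = CI f.
Proof.
  intros H. unfold CI. f_equal.
  - apply (intR_shift M (fun x => Re (f x))). now apply Cdom_Re.
  - apply (intR_shift M (fun x => Im (f x))). now apply Cdom_Im.
Qed.

Lemma CI_reflect M f : Cdom M f -> CI (fun x => f (- x)) = CI f.
Proof.
  intros H. unfold CI. f_equal.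
  - apply (intR_reflect M (fun x => Re (f x))). now apply Cdom_Re.
  - apply (intR_reflect M (fun x => Im (f x))). now apply Cdom_Im.
Qed.

Lemma CI_conj M f : Cdom M f -> CI (fun x => Cconj (f x)) = Cconj (CI f).
Proof.
  intros H. unfold CI, Cconj; simpl. f_equal.
  rewrite (intR_ext _ (fun x => -1 * Im (f x))) by (intros; simpl; unfold Im; ring).
  rewrite (intR_scal M) by now apply Cdom_Im. ring.
Qed.

Definition Ccont2 (h : R -> R -> C) : Prop :=
  cont2 (fun x y => Re (h x y)) /\ cont2 (fun x y => Im (h x y)).

Lemma Ccont2_mult f g : Ccont2 f -> Ccont2 g -> Ccont2 (fun x y => f x y * g x y)%C.
Proof.
  intros [H1 H2] [H3 H4]; split; intros x y; simpl.
  - apply (continuity_2d_pt_minus (fun x y => Re (f x y) * Re (g x y)) (fun x y => Im (f x y) * Im (g x y)));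
    now apply continuity_2d_pt_mult.
  - apply (continuity_2d_pt_plus (fun x y => Re (f x y) * Im (g x y)) (fun x y => Im (f x y) * Re (g x y)));
    now apply continuity_2d_pt_mult.
Qed.

Lemma Ccont2_comp f (g : R -> R -> R) : Ccont f -> cont2 g -> Ccont2 (fun x y => f (g x y)).
Proof.
  intros [H1 H2] Hg; split; intros x y.
  - apply (continuity_1d_2d_pt_comp (fun x => Re (f x))); [| apply Hg].
    apply continuity_pt_filterlim, H1.
  - apply (continuity_1d_2d_pt_comp (fun x => Im (f x))); [| apply Hg].
    apply continuity_pt_filterlim, H2.
Qed.

Lemma Fubini_CI h M : Ccont2 h -> (forall x y, Cmod (h x y) <= M * om x * om y) ->
  CI (fun x => CI (h x)) = CI (fun y => CI (fun x => h x y)).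
Proof.
  intros [H1 H2] Hb. unfold CI; simpl. f_equal.
  - apply (Fubini_intR (fun x y => Re (h x y)) M); auto.
    intros; eapply Rle_trans; [apply Re_le_Cmod | apply Hb].
  - apply (Fubini_intR (fun x y => Im (h x y)) M); auto.
    intros; eapply Rle_trans; [apply Im_le_Cmod | apply Hb].
Qed.

(** * Weights, convolution and the Fourier integral *)
Definition qq (x : R) : R := 1 + Rabs x.
(** The exponential encodes analyticity in a strip of half-width [r]; [om] makes the weight
    integrable and stable under convolution. With [1 + |x|] in place of [|x|], differentiation in
    [r] produces exactly the factor [qq x], which dominates [|x|]. *)
Definition W (r x : R) : R := exp (- (r * qq x)) * om x.

Lemma qq_ge1 x : 1 <= qq x.
Proof. unfold qq; pose proof (Rabs_pos x); lra. Qed.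

Lemma qq_opp x : qq (- x) = qq x.
Proof. unfold qq; now rewrite Rabs_Ropp. Qed.

Lemma abs_le_qq x : Rabs x <= qq x.
Proof. unfold qq; lra. Qed.

Lemma W_pos r x : 0 < W r x.
Proof. apply Rmult_lt_0_compat; [apply exp_pos | apply om_pos]. Qed.

Lemma W_even r x : W r (- x) = W r x.
Proof. unfold W. now rewrite qq_opp, om_even. Qed.

Lemma exp_le a b : a <= b -> exp a <= exp b.
Proof. intros [H | ->]; [left; now apply exp_increasing | lra]. Qed.

Lemma exp_ge_1plus x : 1 + x <= exp x.
Proof.
  destruct (Req_dec x 0) as [-> | H]; [rewrite exp_0; lra |].
  left; now apply exp_ineq1.
Qed.

Lemma W_decr r s x : r <= s -> W s x <= W r x.
Proof.
  intros H. apply Rmult_le_compat_r; [left; apply om_pos |].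
  apply exp_le. pose proof (qq_ge1 x). nra.
Qed.

Lemma W_le_om r x : 0 <= r -> W r x <= om x.
Proof.
  intros H. unfold W. pose proof (om_pos x). pose proof (qq_ge1 x).
  assert (exp (- (r * qq x)) <= 1) by (rewrite <- exp_0; apply exp_le; nra).
  nra.
Qed.

Lemma qW_le_om r x : 1 / 2 <= r -> qq x * W r x <= 2 * om x.
Proof.
  intros H. unfold W. pose proof (om_pos x).
  assert (qq x * exp (- (r * qq x)) <= 2); [| nra].
  pose proof (exp_ge_1plus (r * qq x)). pose proof (exp_pos (- (r * qq x))).
  assert (exp (- (r * qq x)) * exp (r * qq x) = 1)
    by (rewrite <- exp_plus, Rplus_opp_l; apply exp_0).
  nra.
Qed.

(** Each of the [n] copies of [exp (- s x)] absorbs one factor [x], since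
    [x exp (- s x) <= 1 / s]. *)
Lemma pow_exp_bound n s x : 0 < s -> 0 <= x ->
  x ^ n * exp (- (INR n * s * x)) <= (/ s) ^ n.
Proof.
  intros Hs Hx. induction n as [| n IH].
  - simpl. rewrite !Rmult_0_l, Ropp_0, exp_0. lra.
  - replace (- (INR (S n) * s * x)) with (- (INR n * s * x) + - (s * x))
      by (rewrite S_INR; ring).
    rewrite exp_plus. simpl.
    replace (x * x ^ n * (exp (- (INR n * s * x)) * exp (- (s * x))))
      with ((x * exp (- (s * x))) * (x ^ n * exp (- (INR n * s * x)))) by ring.
    apply Rmult_le_compat; auto.
    + pose proof (exp_pos (- (s * x))); nra.
    + pose proof (exp_pos (- (INR n * s * x))). pose proof (pow_le x n Hx). nra.
    + pose proof (exp_ge_1plus (s * x)). pose proof (exp_pos (- (s * x))).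
      assert (exp (- (s * x)) * exp (s * x) = 1)
        by (rewrite <- exp_plus, Rplus_opp_l; apply exp_0).
      apply Rmult_le_reg_l with s; auto. rewrite Rinv_r by lra. nra.
Qed.

Lemma polyexp n r : 0 < r ->
  exists K, 0 < K /\ forall x, qq x ^ n * exp (- (r * qq x)) <= K.
Proof.
  (* Dividing by [n + 1] keeps [n s <= r] and also covers [n = 0]. *)
  intros Hr. set (s := r / (INR n + 1)). pose proof (pos_INR n).
  assert (Hs : 0 < s) by (apply Rdiv_lt_0_compat; lra).
  exists ((/ s) ^ n). split; [apply pow_lt, Rinv_0_lt_compat; lra |].
  intros x. pose proof (qq_ge1 x).
  eapply Rle_trans; [| apply (pow_exp_bound n s (qq x)); lra].
  apply Rmult_le_compat_l; [apply pow_le; lra |].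
  apply exp_le. assert (INR n * s <= r); [| nra].
  assert (s * (INR n + 1) = r) by (unfold s; field; lra). nra.
Qed.

(** A Cauchy estimate seen from the Fourier side: any power of the frequency is paid for by a loss
    of radius. *)
Lemma poly_W n r s : s < r ->
  exists K, 0 < K /\ forall x, qq x ^ n * W r x <= K * W s x.
Proof.
  intros H. destruct (polyexp n (r - s) ltac:(lra)) as [K [HK1 HK2]].
  exists K. split; auto. intros x. unfold W.
  replace (- (r * qq x)) with (- ((r - s) * qq x) + - (s * qq x)) by ring.
  rewrite exp_plus. specialize (HK2 x).
  pose proof (exp_pos (- (s * qq x))). pose proof (om_pos x).
  replace (qq x ^ n * (exp (- ((r - s) * qq x)) * exp (- (s * qq x)) * om x))
    with ((qq x ^ n * exp (- ((r - s) * qq x))) * (exp (- (s * qq x)) * om x)) by ring.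
  apply Rmult_le_compat_r; auto. nra.
Qed.

Lemma qW_le_om2 r : 1 / 2 <= r -> exists K, 0 < K /\
  forall x, (1 + x ^ 2) * (qq x * W r x) <= K * om x.
Proof.
  intros H. destruct (poly_W 3 r 0 ltac:(lra)) as [K [HK1 HK2]].
  exists K. split; auto. intros x. specialize (HK2 x).
  pose proof (W_le_om 0 x (Rle_refl 0)). pose proof (W_pos r x). pose proof (qq_ge1 x).
  apply Rle_trans with (qq x ^ 3 * W r x); [| nra].
  replace (qq x ^ 3 * W r x) with (qq x ^ 2 * (qq x * W r x)) by ring.
  apply Rmult_le_compat_r; [nra |]. unfold qq. pose proof (Rabs_pos x).
  rewrite <- (pow2_abs x). nra.
Qed.

(** At least one of [a], [b] has size at least half that of the sum; algebraically, [1 + (a + b)^2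
    <= 2 (1 + a^2) + 2 (1 + b^2)]. *)
Lemma om_prod a b : om a * om b <= 2 * om (a + b) * (om a + om b).
Proof.
  pose proof (om_pos a). pose proof (om_pos b). pose proof (om_pos (a + b)).
  pose proof (om_inv a). pose proof (om_inv b). pose proof (om_inv (a + b)).
  apply Rmult_le_reg_r with (1 + (a + b) ^ 2); [nra |].
  replace (2 * om (a + b) * (om a + om b) * (1 + (a + b) ^ 2))
    with (2 * (om (a + b) * (1 + (a + b) ^ 2)) * (om a + om b)) by ring.
  rewrite H4.
  replace (2 * 1 * (om a + om b)) with
    (om a * om b * (2 * (1 + a ^ 2) + 2 * (1 + b ^ 2))).
  2:{ replace (om a * om b * (2 * (1 + a ^ 2) + 2 * (1 + b ^ 2)))
       with (2 * (om a * (1 + a ^ 2)) * om b + 2 * (om b * (1 + b ^ 2)) * om a) by ring.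
      rewrite H2, H3. ring. }
  apply Rmult_le_compat_l; [nra |]. pose proof (pow2_ge_0 (a - b)). nra.
Qed.

(* The frequency |s| of one factor may be much larger than the output frequency |x|,
   but then the surplus |x-s|+|s|-|x| in the exponents pays for it. *)
Lemma conv_weight r x s : 1 / 2 <= r ->
  W r (x - s) * (qq s * W r s) <= 2 * (qq x * W r x) * (om s + om (x - s)).
Proof.
  intros Hr.
  pose proof (om_prod (x - s) s) as Ho. replace (x - s + s) with x in Ho by ring.
  assert (He : exp (- (r * qq (x - s))) * exp (- (r * qq s)) * qq s
     <= qq x * exp (- (r * qq x))).
  { set (e := Rabs (x - s) + Rabs s - Rabs x).
    assert (He1 : 0 <= e).
    { unfold e. pose proof (Rabs_triang (x - s) s) as T. replace (x - s + s) with x in T by ring. lra. }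
    (* The surplus is at least twice the overshoot [|s| - |x|], so for [r >= 1/2] the factor
       [exp (r (1 + e))] exceeds [1 + |s| - |x|]. *)
    assert (He2 : 2 * (Rabs s - Rabs x) <= e).
    { unfold e. pose proof (Rabs_triang_inv s x) as T. rewrite (Rabs_minus_sym s x) in T. lra. }
    assert (HE : qq s <= qq x * exp (r * (1 + e))).
    { pose proof (exp_ge_1plus (r * (1 + e))). unfold qq in *.
      pose proof (Rabs_pos x).
      assert (1 <= exp (r * (1 + e))) by nra.
      destruct (Rle_lt_dec (Rabs s) (Rabs x)); nra. }
    replace (exp (- (r * qq (x - s))) * exp (- (r * qq s)))
      with (exp (- (r * qq x)) * exp (- (r * (1 + e)))).
    2:{ rewrite <- !exp_plus. f_equal. unfold e, qq. ring. }
    assert (E1 : exp (- (r * (1 + e))) * exp (r * (1 + e)) = 1)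
      by (rewrite <- exp_plus, Rplus_opp_l; apply exp_0).
    pose proof (exp_pos (- (r * (1 + e)))). pose proof (exp_pos (- (r * qq x))).
    assert (exp (- (r * (1 + e))) * qq s <= qq x); [| nra].
    apply Rle_trans with (exp (- (r * (1 + e))) * (qq x * exp (r * (1 + e)))); [nra |].
    replace (exp (- (r * (1 + e))) * (qq x * exp (r * (1 + e))))
      with (qq x * (exp (- (r * (1 + e))) * exp (r * (1 + e)))) by ring. rewrite E1. lra. }
  unfold W.
  replace (exp (- (r * qq (x - s))) * om (x - s) * (qq s * (exp (- (r * qq s)) * om s)))
    with ((exp (- (r * qq (x - s))) * exp (- (r * qq s)) * qq s) * (om (x - s) * om s)) by ring.
  replace (2 * (qq x * (exp (- (r * qq x)) * om x)) * (om s + om (x - s)))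
    with ((qq x * exp (- (r * qq x))) * (2 * om x * (om (x - s) + om s))) by ring.
  pose proof (om_pos s). pose proof (om_pos (x - s)). pose proof (qq_ge1 s).
  pose proof (exp_pos (- (r * qq (x - s)))). pose proof (exp_pos (- (r * qq s))).
  apply Rmult_le_compat; auto.
  - apply Rmult_le_pos; [| lra]. nra.
  - nra.
Qed.

(* Multiplication by the frequency turns an [Sw] bound into an [Ew] bound; a convolution of the
   two kinds is again of kind [Ew]. *)
Definition Sw (r a : R) (f : R -> C) : Prop :=
  Ccont f /\ forall x, Cmod (f x) <= a * W r x.
Definition Ew (r b : R) (g : R -> C) : Prop :=
  Ccont g /\ forall x, Cmod (g x) <= b * (qq x * W r x).

(** The translation falls on [f], so the regularity of the convolution comes from [f] alone and [g]
    may be any function of the weaker class [Ew]. *)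
Definition conv (f g : R -> C) (x : R) : C := CI (fun s => f (x - s)%R * g s)%C.

Lemma Sw_nonneg r a f : Sw r a f -> 0 <= a.
Proof.
  intros [_ H]. specialize (H 0). pose proof (W_pos r 0). pose proof (Cmod_ge_0 (f 0)). nra.
Qed.

Lemma Ew_nonneg r a f : Ew r a f -> 0 <= a.
Proof.
  intros [_ H]. specialize (H 0). pose proof (W_pos r 0). pose proof (Cmod_ge_0 (f 0)).
  pose proof (qq_ge1 0). assert (0 < qq 0 * W r 0) by nra. nra.
Qed.

Lemma Sw_Ew r a f : Sw r a f -> Ew r a f.
Proof.
  intros H. pose proof (Sw_nonneg _ _ _ H) as Ha. destruct H as [H1 H2].
  split; auto. intros x. specialize (H2 x). pose proof (qq_ge1 x). pose proof (W_pos r x).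
  assert (W r x <= qq x * W r x) by nra. nra.
Qed.

Lemma Ew_dom r b g : 1 / 2 <= r -> Ew r b g -> Cdom (2 * b) g.
Proof.
  intros Hr H. pose proof (Ew_nonneg _ _ _ H) as Hb. destruct H as [H1 H2].
  split; auto. intros x. specialize (H2 x). pose proof (qW_le_om r x Hr). nra.
Qed.

Lemma Sw_bounded r a f : 0 <= r -> Sw r a f -> forall x, Cmod (f x) <= a.
Proof.
  intros Hr H x. pose proof (Sw_nonneg _ _ _ H) as Ha. destruct H as [_ H2].
  specialize (H2 x). pose proof (W_le_om r x Hr). pose proof (om_le1 x). nra.
Qed.

Lemma conv_dom r a b f g x : 1 / 2 <= r -> Sw r a f -> Ew r b g ->
  Cdom (a * (2 * b)) (fun s => f (x - s)%R * g s)%C.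
Proof.
  intros Hr Hf Hg. apply Cdom_mult_bounded.
  - apply Ccont_comp_rminus, Hf.
  - intros s; apply (Sw_bounded r a f); auto; lra.
  - now apply (Ew_dom r).
Qed.

(** [conv_weight] moves the whole weight to the output frequency; what is left, [om s + om (x - s)],
    has mass [2 PI] for every [x]. *)
Lemma conv_bound r a b f g x : 1 / 2 <= r -> Sw r a f -> Ew r b g ->
  Cmod (conv f g x) <= 8 * PI * (a * b) * (qq x * W r x).
Proof.
  intros Hr Hf Hg.
  pose proof (Sw_nonneg _ _ _ Hf) as Ha. pose proof (Ew_nonneg _ _ _ Hg) as Hb.
  set (c := 2 * (a * b) * (qq x * W r x)).
  assert (D1 : dom 1 om) by apply dom_om.
  assert (D2 : dom (1 * (2 * (1 + (- x) ^ 2))) (fun s => om (s - x))).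
  { replace ((- x) ^ 2) with (x ^ 2) by ring. now apply dom_shift. }
  assert (E : intR (fun s => c * (om s + om (s - x))) = c * (2 * PI)).
  { erewrite intR_scal by (eapply dom_plus; eauto). f_equal.
    erewrite intR_plus by eauto. rewrite (intR_shift 1) by auto. rewrite intR_om. ring. }
  replace (8 * PI * (a * b) * (qq x * W r x)) with (2 * (c * (2 * PI))) by (unfold c; ring).
  rewrite <- E. eapply CI_le.
  - eapply conv_dom; eauto.
  - eapply dom_scal, dom_plus; eauto.
  - intros s. rewrite Cmod_mult.
    pose proof (proj2 Hf (x - s)) as F1. pose proof (proj2 Hg s) as G1.
    pose proof (conv_weight r x s Hr) as Hw.
    replace (om (s - x)) with (om (x - s)) by (rewrite <- om_even; f_equal; ring).
    unfold c.
    apply Rle_trans with ((a * W r (x - s)) * (b * (qq s * W r s))).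
    + apply Rmult_le_compat; auto using Cmod_ge_0.
    + replace (a * W r (x - s) * (b * (qq s * W r s)))
        with ((a * b) * (W r (x - s) * (qq s * W r s))) by ring.
      replace (2 * (a * b) * (qq x * W r x) * (om s + om (x - s)))
        with ((a * b) * (2 * (qq x * W r x) * (om s + om (x - s)))) by ring.
      apply Rmult_le_compat_l; nra.
Qed.

Lemma conv_Lip r a b L f g : 1 / 2 <= r -> Sw r a f -> Lip L f -> Ew r b g ->
  Lip (4 * PI * b * L) (conv f g).
Proof.
  intros Hr Hf HL Hg x y. unfold conv.
  rewrite <- (CI_minus (a * (2 * b)) (a * (2 * b))) by (eapply conv_dom; eauto).
  replace (4 * PI * b * L * Rabs (x - y)) with (2 * PI * (L * Rabs (x - y) * (2 * b))) by ring.
  apply CI_bound. split.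
  - apply Ccont_minus; (apply Ccont_mult; [apply Ccont_comp_rminus, Hf | apply Hg]).
  - intros s. replace (f (x - s)%R * g s - f (y - s)%R * g s)%C with ((f (x - s)%R - f (y - s)%R) * g s)%C by ring.
    rewrite Cmod_mult. specialize (HL (x - s) (y - s)).
    replace (x - s - (y - s)) with (x - y) in HL by ring.
    pose proof (proj2 (Ew_dom r b g Hr Hg) s).
    rewrite Rmult_assoc. apply Rmult_le_compat; auto using Cmod_ge_0.
Qed.

Lemma conv_Ew r a b L f g : 1 / 2 <= r -> Sw r a f -> Lip L f -> Ew r b g ->
  Ew r (8 * PI * (a * b)) (conv f g).
Proof.
  intros Hr Hf HL Hg. split.
  - eapply Lip_Ccont, conv_Lip; eauto.
  - intros x. now apply conv_bound.
Qed.

Lemma conv_minus_l r a a' b f f' g x : 1 / 2 <= r -> Sw r a f -> Sw r a' f' -> Ew r b g ->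
  conv (fun y => f y - f' y)%C g x = (conv f g x - conv f' g x)%C.
Proof.
  intros Hr Hf Hf' Hg. unfold conv.
  rewrite <- (CI_minus (a * (2 * b)) (a' * (2 * b))) by (eapply conv_dom; eauto).
  apply CI_ext. intros; ring.
Qed.

Lemma conv_minus_r r a b b' f g g' x : 1 / 2 <= r -> Sw r a f -> Ew r b g -> Ew r b' g' ->
  conv f (fun y => g y - g' y)%C x = (conv f g x - conv f g' x)%C.
Proof.
  intros Hr Hf Hg Hg'. unfold conv.
  rewrite <- (CI_minus (a * (2 * b)) (a * (2 * b'))) by (eapply conv_dom; eauto).
  apply CI_ext. intros; ring.
Qed.

(** The transform side of complex conjugation, as [ixi] is that of the derivative in [x]. *)
Definition tld (f : R -> C) (x : R) : C := Cconj (f (- x)).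
Definition ixi (f : R -> C) (x : R) : C := (Ci * RtoC x * f x)%C.

Lemma Sw_tld r a f : Sw r a f -> Sw r a (tld f).
Proof.
  intros [H1 H2]. split.
  - now apply Ccont_conj, Ccont_comp_opp.
  - intros x. unfold tld. rewrite Cmod_conj, <- W_even. apply H2.
Qed.

Lemma Lip_tld L f : Lip L f -> Lip L (tld f).
Proof.
  intros H x y. unfold tld. rewrite <- Cminus_conj, Cmod_conj.
  eapply Rle_trans; [apply H |]. replace (- x - - y) with (- (x - y)) by ring.
  rewrite Rabs_Ropp. lra.
Qed.

Lemma Ccont_ixi f : Ccont f -> Ccont (ixi f).
Proof.
  intros H. apply Ccont_mult; auto. apply Ccont_mult; [apply Ccont_const |].
  apply Ccont_RtoC. intros; apply continuous_id.
Qed.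

Lemma Cmod_Ci : Cmod Ci = 1.
Proof. unfold Cmod, Ci; simpl. replace (0 * (0 * 1) + 1 * (1 * 1)) with 1 by ring. apply sqrt_1. Qed.

Lemma Cmod_ixi f x : Cmod (ixi f x) = Rabs x * Cmod (f x).
Proof. unfold ixi. rewrite !Cmod_mult, Cmod_Ci, Cmod_R. ring. Qed.

Lemma Ew_ixi r a f : Sw r a f -> Ew r a (ixi f).
Proof.
  intros H. destruct H as [H1 H2].
  split; [now apply Ccont_ixi |]. intros x. rewrite Cmod_ixi.
  specialize (H2 x). pose proof (abs_le_qq x). pose proof (Rabs_pos x).
  replace (a * (qq x * W r x)) with (qq x * (a * W r x)) by ring.
  apply Rmult_le_compat; auto. apply Cmod_ge_0.
Qed.

(** The inverse Fourier transform without its constant, so that convolutions go to products with no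
    factor. *)
Definition F (f : R -> C) (x : R) : C := CI (fun s => cis (x * s) * f s)%C.

Lemma F_dom M f x : Cdom M f -> Cdom M (fun s => cis (x * s) * f s)%C.
Proof.
  intros H. rewrite <- (Rmult_1_l M). apply Cdom_mult_bounded; auto.
  - apply Ccont_cis. intros s. apply (continuous_scal_r x (fun s : R => s)), continuous_id.
  - intros s. rewrite Cmod_cis. lra.
Qed.

Lemma F_ext f g x : (forall s, f s = g s) -> F f x = F g x.
Proof. intros E; apply CI_ext; intros; now rewrite E. Qed.

Lemma F_bound M f x : Cdom M f -> Cmod (F f x) <= 2 * PI * M.
Proof. intros H. now apply CI_bound, F_dom. Qed.

Lemma F_plus M N f g x : Cdom M f -> Cdom N g ->
  F (fun s => f s + g s)%C x = (F f x + F g x)%C.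
Proof.
  intros Hf Hg. unfold F. rewrite <- (CI_plus M N) by now apply F_dom.
  apply CI_ext; intros; ring.
Qed.

Lemma F_minus M N f g x : Cdom M f -> Cdom N g ->
  F (fun s => f s - g s)%C x = (F f x - F g x)%C.
Proof.
  intros Hf Hg. unfold F. rewrite <- (CI_minus M N) by now apply F_dom.
  apply CI_ext; intros; ring.
Qed.

Lemma F_scal M f c x : Cdom M f -> F (fun s => c * f s)%C x = (c * F f x)%C.
Proof.
  intros Hf. unfold F. rewrite <- (CI_scal M) by now apply F_dom.
  apply CI_ext; intros; ring.
Qed.

Lemma F_tld M f x : Cdom M f -> F (tld f) x = Cconj (F f x).
Proof.
  intros H. unfold F. rewrite <- (CI_conj M) by now apply F_dom.
  rewrite <- (CI_reflect M (fun s => Cconj (cis (x * s) * f s))).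
  - apply CI_ext. intros s. unfold tld. rewrite Cmult_conj, <- cis_opp. f_equal. f_equal. ring.
  - pose proof (F_dom M f x H) as [D1 D2]. split; [now apply Ccont_conj |].
    intros s. rewrite Cmod_conj. apply D2.
Qed.

(** Fubini needs a majorant in product form: Peetre's inequality turns the decay of [f] in [y - s]
    into decay in [y], at the price of [1 + s^2], which the exponential weight of [g] absorbs. *)
Lemma F_conv r a b f g x : 1 / 2 <= r -> Sw r a f -> Ew r b g ->
  F (conv f g) x = (F f x * F g x)%C.
Proof.
  intros Hr Hf Hg.
  pose proof (Sw_nonneg _ _ _ Hf) as Ha. pose proof (Ew_nonneg _ _ _ Hg) as Hb.
  destruct (qW_le_om2 r Hr) as [K [HK1 HK2]].
  pose proof (Ew_dom _ _ _ Hr Hg) as Dg.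
  pose proof (Ew_dom _ _ _ Hr (Sw_Ew _ _ _ Hf)) as Df.
  set (h := fun s y => (cis (x * y) * (f (y - s)%R * g s))%C).
  assert (Hh : forall s y, Cmod (h s y) <= (a * b * (2 * K)) * om s * om y).
  { intros s y. unfold h. rewrite !Cmod_mult, Cmod_cis, Rmult_1_l.
    pose proof (proj2 Hf (y - s)) as F1. pose proof (proj2 Hg s) as G1.
    apply Rle_trans with ((a * om (y - s)) * (b * (qq s * W r s))).
    - apply Rmult_le_compat; auto using Cmod_ge_0.
      eapply Rle_trans; [apply F1 |]. apply Rmult_le_compat_l; auto. apply W_le_om; lra.
    - pose proof (om_shift s y) as Hs. specialize (HK2 s).
      pose proof (om_pos y). pose proof (W_pos r s). pose proof (qq_ge1 s).
      replace (a * om (y - s) * (b * (qq s * W r s)))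
        with (a * b * (om (y - s) * (qq s * W r s))) by ring.
      replace (a * b * (2 * K) * om s * om y) with (a * b * (2 * om y * (K * om s))) by ring.
      apply Rmult_le_compat_l; [nra |].
      apply Rle_trans with (2 * (1 + s ^ 2) * om y * (qq s * W r s)).
      + apply Rmult_le_compat_r; [nra | auto].
      + replace (2 * (1 + s ^ 2) * om y * (qq s * W r s))
          with (2 * om y * ((1 + s ^ 2) * (qq s * W r s))) by ring.
        apply Rmult_le_compat_l; [lra | auto]. }
  symmetry. transitivity (CI (fun s => CI (h s))).
  - rewrite Cmult_comm. unfold F at 1.
    rewrite <- (CI_scal_r (2 * b)) by now apply F_dom.
    apply CI_ext. intros s. unfold F.
    rewrite <- (CI_shift (2 * a) (fun s => cis (x * s) * f s)%C s) by now apply F_dom.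
    rewrite <- (CI_scal (2 * a * (2 * (1 + s ^ 2)))).
    + apply CI_ext. intros y. unfold h.
      replace (x * y) with (x * s + x * (y - s)) by ring. rewrite cis_plus. ring.
    + pose proof (F_dom (2 * a) f x Df) as [D1 D2]. split.
      * now apply (Ccont_comp_minus (fun y => cis (x * y) * f y)%C).
      * intros y. eapply Rle_trans; [apply D2 |].
        replace (2 * a * (2 * (1 + s ^ 2)) * om y) with (2 * a * (2 * (1 + s ^ 2) * om y)) by ring.
        apply Rmult_le_compat_l; [lra | apply om_shift].
  - rewrite (Fubini_CI h (a * b * (2 * K))); auto.
    + apply CI_ext. intros y. unfold conv, h.
      rewrite (CI_scal (a * (2 * b))); [reflexivity |]. eapply conv_dom; eauto.
    + unfold h. apply Ccont2_mult; [| apply Ccont2_mult].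
      * apply (Ccont2_comp cis (fun s y => x * y)).
        -- apply (Lip_Ccont 2). intros u v; apply cis_Lip.
        -- intros u v. apply (continuity_2d_pt_mult (fun _ _ => x) (fun _ y => y));
           [apply continuity_2d_pt_const | apply continuity_2d_pt_id2].
      * apply (Ccont2_comp f (fun s y => y - s)); [apply Hf |].
        intros u v. apply (continuity_2d_pt_minus (fun _ y => y) (fun s _ => s));
           [apply continuity_2d_pt_id2 | apply continuity_2d_pt_id1].
      * apply (Ccont2_comp g (fun s y => s)); [apply Hg |].
        intros u v. apply continuity_2d_pt_id1.
Qed.

Lemma is_derive_quad (f : R -> R) x l K :
  (forall h, Rabs (f (x + h) - f x - h * l) <= K * h ^ 2) -> is_derive f x l.
Proof.
  intros H. apply is_derive_Reals. intros e He.
  assert (HK : 0 <= K) by (specialize (H 1); pose proof (Rabs_pos (f (x + 1) - f x - 1 * l)); lra).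
  assert (Hd : 0 < e / (K + 1)) by (apply Rdiv_lt_0_compat; lra).
  exists (mkposreal _ Hd). intros h Hh0 Hh. simpl in Hh.
  replace ((f (x + h) - f x) / h - l) with ((f (x + h) - f x - h * l) / h) by (field; auto).
  unfold Rdiv. rewrite Rabs_mult, Rabs_inv. pose proof (Rabs_pos_lt h Hh0).
  apply Rmult_lt_reg_r with (Rabs h); auto.
  rewrite Rmult_assoc, Rinv_l by lra. rewrite Rmult_1_r.
  eapply Rle_lt_trans; [apply H |]. rewrite <- pow2_abs.
  apply Rlt_div_r in Hh; [| lra]. nra.
Qed.

Definition is_Cderive (f : R -> C) (x : R) (l : C) : Prop :=
  is_derive (fun y => Re (f y)) x (Re l) /\ is_derive (fun y => Im (f y)) x (Im l).

Lemma is_Cderive_quad (f : R -> C) x l K :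
  (forall h, Cmod (f (x + h)%R - f x - RtoC h * l) <= K * h ^ 2) -> is_Cderive f x l.
Proof.
  intros H; split; apply (is_derive_quad _ _ _ K); intros h.
  - eapply Rle_trans; [| apply H]. eapply Rle_trans; [| apply Re_le_Cmod].
    right. f_equal. unfold Re. simpl. ring.
  - eapply Rle_trans; [| apply H]. eapply Rle_trans; [| apply Im_le_Cmod].
    right. f_equal. unfold Im. simpl. ring.
Qed.

(** By [cis_taylor] the remainder has size [h^2 s^2 |f s|], which the weight [1 + s^2] makes
    integrable. *)
Lemma F_derive M f x : Ccont f -> (forall s, (1 + s ^ 2) * Cmod (f s) <= M * om s) ->
  is_Cderive (F f) x (F (ixi f) x).
Proof.
  intros Hc Hb.
  assert (D0 : Cdom M f).
  { split; auto. intros s. eapply Rle_trans; [| apply Hb].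
    pose proof (Cmod_ge_0 (f s)). nra. }
  assert (D1 : Cdom M (ixi f)).
  { split; [now apply Ccont_ixi |]. intros s. rewrite Cmod_ixi.
    eapply Rle_trans; [| apply Hb]. apply Rmult_le_compat_r; [apply Cmod_ge_0 |].
    rewrite <- (pow2_abs s). nra. }
  apply (is_Cderive_quad _ _ _ (2 * PI * (2 * M))). intros h.
  unfold F. rewrite <- (CI_scal M) by now apply F_dom.
  rewrite <- (CI_minus M M) by now apply F_dom.
  rewrite <- (CI_minus (M + M) (Cmod (RtoC h) * M)).
  2:{ apply Cdom_minus; now apply F_dom. }
  2:{ now apply Cdom_scal, F_dom. }
  replace (2 * PI * (2 * M) * h ^ 2) with (2 * PI * (2 * M * h ^ 2)) by ring. apply CI_bound. split.
  - apply Ccont_minus; [apply Ccont_minus |].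
    + now apply (F_dom M).
    + now apply (F_dom M).
    + apply Ccont_mult; [apply Ccont_const |]. now apply (F_dom M).
  - intros s.
    replace (cis ((x + h) * s) * f s - cis (x * s) * f s - RtoC h * (cis (x * s) * ixi f s))%C
      with ((cis (x * s + h * s)%R - cis (x * s)%R - Ci * RtoC (h * s)%R * cis (x * s)%R) * f s)%C.
    2:{ replace ((x + h) * s) with (x * s + h * s) by ring. unfold ixi. rewrite RtoC_mult. ring. }
    rewrite Cmod_mult. pose proof (cis_taylor (x * s) (h * s)) as T.
    eapply Rle_trans; [apply Rmult_le_compat_r; [apply Cmod_ge_0 | apply T] |].
    specialize (Hb s). pose proof (Cmod_ge_0 (f s)).
    replace (2 * (h * s) ^ 2 * Cmod (f s)) with (2 * h ^ 2 * (s ^ 2 * Cmod (f s))) by ring.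
    replace (2 * M * h ^ 2 * om s) with (2 * h ^ 2 * (M * om s)) by ring.
    apply Rmult_le_compat_l; nra.
Qed.

(** * The cubic nonlinearity on the Fourier side *)
Section Nonlinearity.
Context (gamma delta epsilon : C).

(* [Kop A A] and [Tri A A A] are the transforms of [V] and [u V] when [u] is the transform of [A];
   only [B] and [D] carry a frequency factor, so that [A] never loses a derivative. *)
Definition Kop (B D : R -> C) (x : R) : C :=
  (- (Ci * gamma * conv (tld B) D x + delta * conv (tld B) (ixi D) x
      + epsilon * conv D (ixi (tld B)) x))%C.

Definition Tri (A B D : R -> C) : R -> C := conv A (Kop B D).

Definition c0 : R := Cmod gamma + Cmod delta + Cmod epsilon.

Lemma c0_nonneg : 0 <= c0.
Proof.
  unfold c0. pose proof (Cmod_ge_0 gamma). pose proof (Cmod_ge_0 delta).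
  pose proof (Cmod_ge_0 epsilon). lra.
Qed.

Lemma Kop_Ew r b d LB LD B D : 1 / 2 <= r -> Sw r b B -> Lip LB B -> Sw r d D -> Lip LD D ->
  Ew r (8 * PI * c0 * (b * d)) (Kop B D).
Proof.
  intros Hr HB HLB HD HLD.
  pose proof (conv_Ew r b d LB (tld B) D Hr (Sw_tld _ _ _ HB) (Lip_tld _ _ HLB) (Sw_Ew _ _ _ HD)) as [C1 B1].
  pose proof (conv_Ew r b d LB (tld B) (ixi D) Hr (Sw_tld _ _ _ HB) (Lip_tld _ _ HLB) (Ew_ixi _ _ _ HD)) as [C2 B2].
  pose proof (conv_Ew r d b LD D (ixi (tld B)) Hr HD HLD (Ew_ixi _ _ _ (Sw_tld _ _ _ HB))) as [C3 B3].
  split.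
  - apply Ccont_opp, Ccont_plus; [apply Ccont_plus |]; apply Ccont_mult; auto using Ccont_const.
  - intros x. unfold Kop. rewrite Cmod_opp.
    eapply Rle_trans; [apply Cmod_triangle |].
    eapply Rle_trans; [apply Rplus_le_compat_r, Cmod_triangle |].
    rewrite !Cmod_mult, Cmod_Ci, Rmult_1_l.
    specialize (B1 x); specialize (B2 x); specialize (B3 x).
    pose proof (Rmult_le_compat_l _ _ _ (Cmod_ge_0 gamma) B1).
    pose proof (Rmult_le_compat_l _ _ _ (Cmod_ge_0 delta) B2).
    pose proof (Rmult_le_compat_l _ _ _ (Cmod_ge_0 epsilon) B3).
    unfold c0. rewrite (Rmult_comm d b) in *. lra.
Qed.

(** One factor [8 * PI] from [conv_bound] for each of the two nested convolutions. *)
Definition c1 : R := 64 * PI ^ 2 * c0.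

Lemma c1_nonneg : 0 <= c1.
Proof. unfold c1. pose proof c0_nonneg. nra. Qed.

Lemma Tri_Ew r a b d LA LB LD A B D : 1 / 2 <= r ->
  Sw r a A -> Lip LA A -> Sw r b B -> Lip LB B -> Sw r d D -> Lip LD D ->
  Ew r (c1 * (a * b * d)) (Tri A B D).
Proof.
  intros Hr HA HLA HB HLB HD HLD.
  replace (c1 * (a * b * d)) with (8 * PI * (a * (8 * PI * c0 * (b * d)))) by (unfold c1; ring).
  eapply conv_Ew; eauto. eapply Kop_Ew; eauto.
Qed.

(** Only the Lipschitz constant of the outermost factor enters, and linearly: over a short time the
    Lipschitz bound of the iterates therefore reproduces itself. *)
Lemma Tri_Lip r a b d LA LB LD A B D : 1 / 2 <= r ->
  Sw r a A -> Lip LA A -> Sw r b B -> Lip LB B -> Sw r d D -> Lip LD D ->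
  Lip (c1 * (b * d) * LA) (Tri A B D).
Proof.
  intros Hr HA HLA HB HLB HD HLD x y.
  pose proof (conv_Lip r a _ LA A _ Hr HA HLA (Kop_Ew r b d LB LD B D Hr HB HLB HD HLD) x y) as H.
  eapply Rle_trans; [apply H |].
  apply Rmult_le_compat_r; [apply Rabs_pos |]. unfold c1.
  pose proof c0_nonneg. pose proof (Sw_nonneg _ _ _ HB). pose proof (Sw_nonneg _ _ _ HD).
  assert (0 <= LA).
  { specialize (HLA 1 0). rewrite Rminus_0_r, Rabs_R1 in HLA. pose proof (Cmod_ge_0 (A 1 - A 0)). lra. }
  assert (0 <= PI ^ 2 * c0 * (b * d) * LA).
  { apply Rmult_le_pos; auto. apply Rmult_le_pos; [| now apply Rmult_le_pos].
    apply Rmult_le_pos; auto. apply pow2_ge_0. }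
  nra.
Qed.

Lemma Lip_minus a b f g : Lip a f -> Lip b g -> Lip (a + b) (fun x => f x - g x)%C.
Proof.
  intros H1 H2 x y. replace (f x - g x - (f y - g y))%C with ((f x - f y) - (g x - g y))%C by ring.
  eapply Rle_trans; [apply Cmod_minus_le |]. specialize (H1 x y). specialize (H2 x y). lra.
Qed.

Lemma conv_ext f g f' g' x : (forall y, f y = f' y) -> (forall y, g y = g' y) ->
  conv f g x = conv f' g' x.
Proof. intros E1 E2. apply CI_ext. intros; now rewrite E1, E2. Qed.

Lemma Kop_minus_l r b b' d LB LB' LD B B' D x : 1 / 2 <= r -> Sw r b B -> Lip LB B ->
  Sw r b' B' -> Lip LB' B' -> Sw r d D -> Lip LD D ->
  Kop (fun y => B y - B' y)%C D x = (Kop B D x - Kop B' D x)%C.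
Proof.
  intros Hr HB HLB HB' HLB' HD HLD. unfold Kop.
  rewrite (conv_ext (tld (fun y => B y - B' y)%C) D (fun y => tld B y - tld B' y)%C D)
    by (intros; unfold tld; rewrite ?Cminus_conj; auto).
  rewrite (conv_ext (tld (fun y => B y - B' y)%C) (ixi D) (fun y => tld B y - tld B' y)%C (ixi D))
    by (intros; unfold tld; rewrite ?Cminus_conj; auto).
  rewrite (conv_ext D (ixi (tld (fun y => B y - B' y)%C)) D (fun y => ixi (tld B) y - ixi (tld B') y)%C)
    by (intros; unfold ixi, tld; rewrite ?Cminus_conj; auto; ring).
  rewrite (conv_minus_l r b b' d) by auto using Sw_tld, Sw_Ew.
  rewrite (conv_minus_l r b b' d) by auto using Sw_tld, Ew_ixi.
  rewrite (conv_minus_r r d b b') by auto using Sw_tld, Ew_ixi.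
  ring.
Qed.

Lemma Kop_minus_r r b d d' LB LD LD' B D D' x : 1 / 2 <= r -> Sw r b B -> Lip LB B ->
  Sw r d D -> Lip LD D -> Sw r d' D' -> Lip LD' D' ->
  Kop B (fun y => D y - D' y)%C x = (Kop B D x - Kop B D' x)%C.
Proof.
  intros Hr HB HLB HD HLD HD' HLD'. unfold Kop.
  rewrite (conv_ext (tld B) (ixi (fun y => D y - D' y)%C) (tld B) (fun y => ixi D y - ixi D' y)%C)
    by (intros; unfold ixi; auto; ring).
  rewrite (conv_minus_r r b d d') by auto using Sw_tld, Sw_Ew.
  rewrite (conv_minus_r r b d d') by auto using Sw_tld, Ew_ixi.
  rewrite (conv_minus_l r d d' b) by auto using Sw_tld, Ew_ixi.
  ring.
Qed.

(** Replacing one argument at a time telescopes the difference into three terms, each with the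
    factor [A - A'] once. *)
Lemma Tri_diff r M d L L' A A' x : 1 / 2 <= r ->
  Sw r M A -> Lip L A -> Sw r M A' -> Lip L' A' -> Sw r d (fun y => A y - A' y)%C ->
  Cmod (Tri A A A x - Tri A' A' A' x) <= 3 * c1 * M ^ 2 * d * (qq x * W r x).
Proof.
  intros Hr HA HLA HA' HLA' Hd.
  pose proof (Lip_minus _ _ _ _ HLA HLA') as HLd.
  set (E := fun y => (A y - A' y)%C) in *.
  assert (Eq : (Tri A A A x - Tri A' A' A' x = Tri E A A x + Tri A' E A x + Tri A' A' E x)%C).
  { assert (E1 : Tri E A A x = (Tri A A A x - Tri A' A A x)%C).
    { unfold Tri, E. eapply conv_minus_l; eauto. eapply Kop_Ew; eauto. }
    assert (E2 : Tri A' E A x = (Tri A' A A x - Tri A' A' A x)%C).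
    { unfold Tri. rewrite <- (conv_minus_r r M (8 * PI * c0 * (M * M)) (8 * PI * c0 * (M * M)));
        eauto; try (eapply Kop_Ew; eauto).
      apply conv_ext; auto. intros y. unfold E. eapply Kop_minus_l; eauto. }
    assert (E3 : Tri A' A' E x = (Tri A' A' A x - Tri A' A' A' x)%C).
    { unfold Tri. rewrite <- (conv_minus_r r M (8 * PI * c0 * (M * M)) (8 * PI * c0 * (M * M)));
        eauto; try (eapply Kop_Ew; eauto).
      apply conv_ext; auto. intros y. unfold E. eapply Kop_minus_r; eauto. }
    rewrite E1, E2, E3. ring. }
  rewrite Eq.
  pose proof (proj2 (Tri_Ew r d M M _ _ _ E A A Hr Hd HLd HA HLA HA HLA) x) as B1.
  pose proof (proj2 (Tri_Ew r M d M _ _ _ A' E A Hr HA' HLA' Hd HLd HA HLA) x) as B2.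
  pose proof (proj2 (Tri_Ew r M M d _ _ _ A' A' E Hr HA' HLA' HA' HLA' Hd HLd) x) as B3.
  eapply Rle_trans; [apply Cmod_triangle |].
  eapply Rle_trans; [apply Rplus_le_compat_r, Cmod_triangle |].
  lra.
Qed.

End Nonlinearity.

(** * Integrals in time and limits at a geometric rate *)

Definition CIt (a b : R) (f : R -> C) : C :=
  (RInt (fun s => Re (f s)) a b, RInt (fun s => Im (f s)) a b).

Lemma CIt_le a b f g : a <= b -> Ccont f -> (forall x, continuous g x) ->
  (forall s, a <= s <= b -> Cmod (f s) <= g s) -> Cmod (CIt a b f) <= 2 * RInt g a b.
Proof.
  intros Hab [H1 H2] Hg H.
  assert (key : forall h : R -> R, (forall x, continuous h x) ->
    (forall s, a <= s <= b -> Rabs (h s) <= g s) -> Rabs (RInt h a b) <= RInt g a b).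
  { intros h Hh Hle. eapply Rle_trans; [apply abs_RInt_le; [auto | now apply cont_ex_RInt] |].
    apply RInt_le; auto.
    - apply cont_ex_RInt; intros x. apply (continuous_comp h Rabs); [apply Hh | apply continuous_Rabs].
    - now apply cont_ex_RInt.
    - intros s Hs. apply Hle; lra. }
  eapply Rle_trans; [apply Cmod_le_comps |]. simpl.
  pose proof (key _ H1 (fun s Hs => Rle_trans _ _ _ (Re_le_Cmod _) (H s Hs))).
  pose proof (key _ H2 (fun s Hs => Rle_trans _ _ _ (Im_le_Cmod _) (H s Hs))).
  apply Rle_trans with (RInt g a b + RInt g a b); [now apply Rplus_le_compat | lra].
Qed.

Lemma CIt_const_le a b f m : a <= b -> Ccont f ->
  (forall s, a <= s <= b -> Cmod (f s) <= m) -> Cmod (CIt a b f) <= 2 * (b - a) * m.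
Proof.
  intros Hab Hf H. eapply Rle_trans.
  - apply (CIt_le a b f (fun _ => m)); auto. intros; apply continuous_const.
  - rewrite RInt_const. unfold scal; simpl; unfold mult; simpl. lra.
Qed.

Lemma CIt_minus a b f g : Ccont f -> Ccont g ->
  CIt a b (fun s => f s - g s)%C = (CIt a b f - CIt a b g)%C.
Proof.
  intros [H1 H2] [H3 H4]. apply injective_projections; simpl.
  - apply (RInt_minus (fun s => Re (f s)) (fun s => Re (g s))); now apply cont_ex_RInt.
  - apply (RInt_minus (fun s => Im (f s)) (fun s => Im (g s))); now apply cont_ex_RInt.
Qed.

Lemma CIt_Chasles a b c f : Ccont f -> CIt a c f = (CIt a b f + CIt b c f)%C.
Proof.
  intros [H1 H2]. apply injective_projections; simpl; now apply RInt_split.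
Qed.

(** The integrand is the exact time derivative of [W (2 - kappa s) x / kappa]: the factor [qq x]
    lost in a convolution disappears, and a factor [1 / kappa] is gained. *)
Lemma int_W kappa t x : 0 < kappa -> 0 <= t ->
  RInt (fun s => qq x * W (2 - kappa * s) x) 0 t <= / kappa * W (2 - kappa * t) x.
Proof.
  intros Hk Ht.
  assert (E : is_RInt (fun s => qq x * W (2 - kappa * s) x) 0 t
     (minus (/ kappa * W (2 - kappa * t) x) (/ kappa * W (2 - kappa * 0) x))).
  { apply (is_RInt_derive (fun s => / kappa * W (2 - kappa * s) x)).
    - intros s _. unfold W. auto_derive; auto. unfold Rminus. field. lra.
    - intros s _. apply (ex_derive_continuous (fun s => qq x * W (2 - kappa * s) x)).
      unfold W. auto_derive; auto. }
  rewrite (is_RInt_unique _ _ _ _ E). unfold minus, plus, opp; simpl.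
  pose proof (W_pos (2 - kappa * 0) x). pose proof (Rinv_0_lt_compat _ Hk). nra.
Qed.

Lemma geom_limit (x : nat -> R) b : (forall n, Rabs (x (S n) - x n) <= b * (/ 2) ^ n) ->
  forall n, Rabs (real (Lim_seq x) - x n) <= 2 * b * (/ 2) ^ n.
Proof.
  intros H.
  assert (H2 : forall n k, Rabs (x (n + k)%nat - x n) <= 2 * b * (/ 2) ^ n - 2 * b * (/ 2) ^ (n + k)).
  { intros n k. induction k.
    - rewrite Nat.add_0_r, Rminus_diag, Rabs_R0. lra.
    - rewrite Nat.add_succ_r. specialize (H (n + k)%nat).
      replace (x (S (n + k)) - x n) with ((x (S (n + k)) - x (n + k)%nat) + (x (n + k)%nat - x n)) by ring.
      eapply Rle_trans; [apply Rabs_triang |]. simpl. lra. }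
  assert (Hb : 0 <= b) by (specialize (H 0%nat); simpl in H; pose proof (Rabs_pos (x 1%nat - x 0%nat)); lra).
  assert (H3 : forall n m, (n <= m)%nat -> Rabs (x m - x n) <= 2 * b * (/ 2) ^ n).
  { intros n m Hnm. replace m with (n + (m - n))%nat by lia.
    eapply Rle_trans; [apply H2 |]. pose proof (pow_le (/ 2) (n + (m - n)) ltac:(lra)). nra. }
  assert (Hex : ex_finite_lim_seq x).
  { apply ex_lim_seq_cauchy_corr. intros eps.
    destruct (pow_lt_1_zero (/ 2) ltac:(rewrite Rabs_pos_eq; lra) (eps / (2 * b + 1))) as [N HN].
    { apply Rdiv_lt_0_compat; [apply cond_pos | lra]. }
    assert (K : forall n m, (N <= n)%nat -> (n <= m)%nat -> Rabs (x m - x n) < eps).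
    { intros n m Hn Hm. eapply Rle_lt_trans; [apply H3; auto |].
      specialize (HN n Hn). rewrite Rabs_pos_eq in HN by (apply pow_le; lra).
      apply Rlt_div_r in HN; [| lra]. pose proof (pow_le (/ 2) n ltac:(lra)). nra. }
    exists N. intros n m Hn Hm. destruct (Nat.le_ge_cases n m).
    - rewrite Rabs_minus_sym; auto.
    - auto. }
  apply Lim_seq_correct' in Hex.
  intros n.
  assert (L : is_lim_seq (fun m => Rabs (x m - x n)) (Rabs (real (Lim_seq x) - x n))).
  { apply (is_lim_seq_abs _ (real (Lim_seq x) - x n)).
    apply is_lim_seq_minus'; [exact Hex | apply is_lim_seq_const]. }
  change (Rbar_le (Rabs (real (Lim_seq x) - x n)) (2 * b * (/ 2) ^ n)).
  eapply is_lim_seq_le_loc; [| exact L | apply is_lim_seq_const].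
  exists n. intros m Hm. now apply H3.
Qed.

(** Closed conditions on the iterates pass to their limit by this lemma, without loss in the
    constant. *)
Lemma le_of_geom x c k : (forall n, x <= c + k * (/ 2) ^ n) -> x <= c.
Proof.
  intros H. change (Rbar_le x c).
  apply (is_lim_seq_le (fun _ => x) (fun n => c + k * (/ 2) ^ n) x c).
  - apply H.
  - apply is_lim_seq_const.
  - replace (Finite c) with (Finite (c + k * 0)) by (f_equal; ring).
    apply is_lim_seq_plus'; [apply is_lim_seq_const |].
    apply (is_lim_seq_scal_l _ k 0). apply is_lim_seq_geom. rewrite Rabs_pos_eq; lra.
Qed.

(** * The Duhamel fixed point *)
Section Duhamel.
Context (alpha beta : R) (gamma delta epsilon : C) (a0 : R -> C).
Context (T kappa M L L' : R).

(** The dispersion relation: [- i alpha (i x)^2 - beta (i x)^3 = i phi x]. *)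
Definition phi (x : R) : R := alpha * x ^ 2 + beta * x ^ 3.
Definition cphi : R := 2 * Rabs alpha + 3 * Rabs beta.

Lemma cphi_nonneg : 0 <= cphi.
Proof. unfold cphi. pose proof (Rabs_pos alpha). pose proof (Rabs_pos beta). lra. Qed.

Lemma phi_bound x : Rabs (phi x) <= cphi * qq x ^ 3.
Proof.
  unfold phi, cphi. eapply Rle_trans; [apply Rabs_triang |].
  rewrite !Rabs_mult, <- !RPow_abs. unfold qq.
  pose proof (Rabs_pos alpha). pose proof (Rabs_pos beta). pose proof (Rabs_pos x).
  assert (0 <= Rabs x ^ 3) by (simpl; nra).
  nra.
Qed.

Lemma phi_diff x y : Rabs (x - y) <= 1 ->
  Rabs (phi x - phi y) <= cphi * qq x ^ 2 * Rabs (x - y).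
Proof.
  intros H. unfold phi, cphi.
  replace (alpha * x ^ 2 + beta * x ^ 3 - (alpha * y ^ 2 + beta * y ^ 3))
    with ((alpha * (x + y) + beta * (x ^ 2 + x * y + y ^ 2)) * (x - y)) by ring.
  rewrite Rabs_mult. apply Rmult_le_compat_r; [apply Rabs_pos |].
  eapply Rle_trans; [apply Rabs_triang |]. rewrite !Rabs_mult.
  pose proof (Rabs_pos alpha). pose proof (Rabs_pos beta).
  assert (Hx : - Rabs x <= x <= Rabs x) by (pose proof (Rabs_maj2 x); pose proof (Rle_abs x); lra).
  apply Rabs_le_between in H. unfold qq in *.
  assert (A1 : Rabs (x + y) <= 2 * (1 + Rabs x) ^ 2) by (apply Rabs_le; nra).
  assert (A2 : Rabs (x ^ 2 + x * y + y ^ 2) <= 3 * (1 + Rabs x) ^ 2).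
  { assert (Rabs y <= 1 + Rabs x) by (apply Rabs_le; lra).
    eapply Rle_trans; [apply Rabs_triang |].
    eapply Rle_trans; [apply Rplus_le_compat_r, Rabs_triang |].
    rewrite Rabs_mult, <- !RPow_abs. pose proof (Rabs_pos y). nra. }
  nra.
Qed.

(* Clamping times to [[0,T]] makes all bounds below global in time. *)
Definition cl (t : R) : R := Rmax 0 (Rmin t T).
Definition rho (t : R) : R := 2 - kappa * cl t.

Context (HT0 : 0 < T) (HT1 : T <= 1) (Hk : 0 < kappa) (HkT : kappa * T <= 1).

Lemma cl_bounds t : 0 <= cl t <= T.
Proof.
  unfold cl. split; [apply Rmax_l |]. apply Rmax_lub; [lra | apply Rmin_r].
Qed.

Lemma cl_id t : 0 <= t <= T -> cl t = t.
Proof. intros H. unfold cl. rewrite Rmin_left, Rmax_right; lra. Qed.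

Lemma cl_Lip s t : Rabs (cl s - cl t) <= Rabs (s - t).
Proof.
  unfold cl, Rmax, Rmin.
  repeat destruct Rle_dec; unfold Rabs; repeat destruct Rcase_abs; lra.
Qed.

Lemma rho_bounds t : 1 <= rho t <= 2.
Proof. unfold rho. pose proof (cl_bounds t). split; nra. Qed.

Notation Tri3 A := (Tri gamma delta epsilon A A A).
Notation C1 := (c1 gamma delta epsilon).

(** Only the first condition is contracted. The Lipschitz bound in the frequency makes each [A t]
    continuous, the one in time makes the Duhamel integrand continuous; there the radius drops to
    [1/2] because a time derivative costs three powers of the frequency. *)
Definition Inv (A : R -> R -> C) : Prop :=
  (forall t, Sw (rho t) M (A t)) /\ (forall t, Lip L (A t)) /\
  (forall s t x, Cmod (A s x - A t x) <= L' * Rabs (s - t) * W (1 / 2) x).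

Lemma Sw_weaken r s a f : s <= r -> Sw r a f -> Sw s a f.
Proof.
  intros H Hf. pose proof (Sw_nonneg _ _ _ Hf). destruct Hf as [H1 H2]. split; auto.
  intros x. eapply Rle_trans; [apply H2 |]. apply Rmult_le_compat_l; auto. now apply W_decr.
Qed.

Lemma Tri_time A s t x : Inv A ->
  Cmod (Tri3 (A s) x - Tri3 (A t) x)
    <= 3 * C1 * M ^ 2 * (L' * Rabs (s - t)) * (qq x * W (1 / 2) x).
Proof.
  intros [H1 [H2 H3]]. pose proof (rho_bounds s). pose proof (rho_bounds t).
  apply (Tri_diff _ _ _ _ _ _ L L); auto; try lra.
  - apply (Sw_weaken (rho s)); auto; lra.
  - apply (Sw_weaken (rho t)); auto; lra.
  - split.
    + apply Ccont_minus; [apply H1 | apply H1].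
    + intros y. apply H3.
Qed.

Lemma Tri_bound A t x : Inv A -> Cmod (Tri3 (A t) x) <= C1 * M ^ 3 * (qq x * W (rho t) x).
Proof.
  intros [H1 [H2 H3]]. pose proof (rho_bounds t).
  replace (C1 * M ^ 3) with (C1 * (M * M * M)) by ring.
  eapply (Tri_Ew gamma delta epsilon (rho t) M M M L L L); auto; lra.
Qed.

Lemma Tri_time_Ccont A x : Inv A -> Ccont (fun s => Tri3 (A s) x).
Proof.
  intros H. apply (Lip_Ccont (3 * C1 * M ^ 2 * L' * (qq x * W (1 / 2) x))). intros s t.
  pose proof (Tri_time A s t x H). lra.
Qed.

(** The Duhamel integrand in the interaction picture. The phase at the final time is restored in
    [Phi], so the integrand is the same for all [t] and an increment in [t] is an integral over a
    short interval. *)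
Definition Gd (A : R -> R -> C) (x s : R) : C := (cis (- (s * phi x)) * Tri3 (A s) x)%C.

Lemma Gd_Ccont A x : Inv A -> Ccont (Gd A x).
Proof.
  intros H. apply Ccont_mult; [| now apply Tri_time_Ccont].
  apply Ccont_cis. intros s.
  apply (ex_derive_continuous (fun s => - (s * phi x))). auto_derive; auto.
Qed.

Lemma Gd_Cmod A x s : Cmod (Gd A x s) = Cmod (Tri3 (A s) x).
Proof. unfold Gd. now rewrite Cmod_mult, Cmod_cis, Rmult_1_l. Qed.

Definition Bd (A : R -> R -> C) (t x : R) : C := (a0 x + CIt 0 (cl t) (Gd A x))%C.
Definition Phi (A : R -> R -> C) (t x : R) : C := (cis (cl t * phi x) * Bd A t x)%C.

Lemma Cmod_Phi A t x : Cmod (Phi A t x) = Cmod (Bd A t x).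
Proof. unfold Phi. now rewrite Cmod_mult, Cmod_cis, Rmult_1_l. Qed.

Lemma int_rho (f : R -> C) c t x : 0 <= c -> Ccont f ->
  (forall s, Cmod (f s) <= c * (qq x * W (rho s) x)) ->
  Cmod (CIt 0 (cl t) f) <= 2 * c / kappa * W (rho t) x.
Proof.
  intros Hc Hf H. pose proof (cl_bounds t) as Hcl.
  assert (Hg : forall s : R, continuous (fun s => qq x * W (2 - kappa * s) x) s).
  { intros s. apply (ex_derive_continuous (fun s => qq x * W (2 - kappa * s) x)).
    unfold W. auto_derive; auto. }
  eapply Rle_trans.
  - apply (CIt_le 0 (cl t) f (fun s => c * (qq x * W (2 - kappa * s) x))); auto; try lra.
    + intros s. apply (continuous_scal_r c (fun s => qq x * W (2 - kappa * s) x)), Hg.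
    + intros s Hs. eapply Rle_trans; [apply H |]. unfold rho. rewrite cl_id by lra. lra.
  - rewrite (RInt_scal (fun s => qq x * W (2 - kappa * s) x)) by now apply cont_ex_RInt.
    pose proof (int_W kappa (cl t) x Hk (proj1 Hcl)) as HI.
    unfold scal; simpl; unfold mult; simpl. unfold rho, Rdiv.
    pose proof (Rmult_le_compat_l c _ _ Hc HI). lra.
Qed.

Context (La : R) (Ha0 : forall x, Cmod (a0 x) <= M / 2 * W 2 x) (HLa : Lip La a0).
Context (HM : 0 < M) (HkM : 12 * C1 * M ^ 2 <= kappa).

(** The datum takes half of [M]; the Duhamel term takes the other half, as
    [2 C1 M^3 / kappa <= M / 2]. *)
Lemma Phi_bound A t x : Inv A -> Cmod (Phi A t x) <= M * W (rho t) x.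
Proof.
  intros H. rewrite Cmod_Phi. unfold Bd. pose proof (rho_bounds t).
  pose proof (c1_nonneg gamma delta epsilon) as HC1.
  eapply Rle_trans; [apply Cmod_triangle |].
  assert (B : Cmod (CIt 0 (cl t) (Gd A x)) <= 2 * (C1 * M ^ 3) / kappa * W (rho t) x).
  { apply int_rho; [| now apply Gd_Ccont |].
    - apply Rmult_le_pos; auto. apply pow_le; lra.
    - intros s. rewrite Gd_Cmod. now apply Tri_bound. }
  pose proof (Ha0 x). pose proof (W_decr (rho t) 2 x ltac:(lra)). pose proof (W_pos (rho t) x).
  assert (2 * (C1 * M ^ 3) / kappa <= M / 2).
  { apply Rmult_le_reg_r with kappa; auto. unfold Rdiv.
    rewrite (Rmult_assoc (2 * (C1 * M ^ 3))), Rinv_l by lra.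
    replace (M ^ 3) with (M ^ 2 * M) by ring. nra. }
  nra.
Qed.

(** The three terms of [Tri_diff] and the factor [2] of [int_rho] give the constant
    [6 C1 M^2 / kappa], at most [1/2] by [HkM]. *)
Lemma Phi_contract A A' d : Inv A -> Inv A' ->
  (forall t, Sw (rho t) d (fun x => A t x - A' t x)%C) ->
  forall t x, Cmod (Phi A t x - Phi A' t x) <= d / 2 * W (rho t) x.
Proof.
  intros H H' Hd t x.
  pose proof (c1_nonneg gamma delta epsilon) as HC1.
  pose proof (Sw_nonneg _ _ _ (Hd 0)) as Hd0.
  unfold Phi.
  replace (cis (cl t * phi x) * Bd A t x - cis (cl t * phi x) * Bd A' t x)%C
    with (cis (cl t * phi x) * (Bd A t x - Bd A' t x))%C by ring.
  rewrite Cmod_mult, Cmod_cis, Rmult_1_l. unfold Bd.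
  replace (a0 x + CIt 0 (cl t) (Gd A x) - (a0 x + CIt 0 (cl t) (Gd A' x)))%C
    with (CIt 0 (cl t) (Gd A x) - CIt 0 (cl t) (Gd A' x))%C by ring.
  rewrite <- CIt_minus by now apply Gd_Ccont.
  eapply Rle_trans.
  - apply (int_rho _ (3 * C1 * M ^ 2 * d)).
    + apply Rmult_le_pos; auto. apply Rmult_le_pos; [lra | apply pow2_ge_0].
    + apply Ccont_minus; now apply Gd_Ccont.
    + intros s. unfold Gd.
      replace (cis (- (s * phi x)) * Tri3 (A s) x - cis (- (s * phi x)) * Tri3 (A' s) x)%C
        with (cis (- (s * phi x)) * (Tri3 (A s) x - Tri3 (A' s) x))%C by ring.
      rewrite Cmod_mult, Cmod_cis, Rmult_1_l. pose proof (rho_bounds s).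
      apply (Tri_diff gamma delta epsilon (rho s) M d L L);
        [lra | apply H | apply H | apply H' | apply H' | apply Hd].
  - apply Rmult_le_compat_r; [left; apply W_pos |].
    apply Rmult_le_reg_r with kappa; auto. unfold Rdiv.
    rewrite (Rmult_assoc (2 * (3 * C1 * M ^ 2 * d))), Rinv_l by lra. nra.
Qed.

Context (K3 : R) (HK3 : forall x, qq x ^ 3 * W 1 x <= K3 * W (1 / 2) x).

Lemma K3_pos : 0 < K3.
Proof.
  specialize (HK3 0). pose proof (W_pos 1 0). pose proof (W_pos (1 / 2) 0). pose proof (qq_ge1 0).
  assert (0 < qq 0 ^ 3) by (apply pow_lt; lra).
  nra.
Qed.

Definition Cosc : R := 2 * K3 * (cphi + 1).

(** The phase varies at a rate of order [qq x ^ 2], so the Lipschitz constant of the product also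
    involves the size of [f], whose exponential decay pays for the two powers. *)
Lemma osc_Lip tau b l f : 0 <= tau <= T -> 0 <= b ->
  (forall x, Cmod (f x) <= b * (qq x * W 1 x)) -> Lip l f ->
  Lip (l + b * Cosc) (fun x => cis (tau * phi x) * f x)%C.
Proof.
  intros Ht Hb0 Hb Hl x y.
  replace (cis (tau * phi x) * f x - cis (tau * phi y) * f y)%C
    with (cis (tau * phi y) * (f x - f y) + (cis (tau * phi x) - cis (tau * phi y)) * f x)%C by ring.
  eapply Rle_trans; [apply Cmod_triangle |]. rewrite !Cmod_mult, Cmod_cis, Rmult_1_l.
  rewrite Rmult_plus_distr_r. apply Rplus_le_compat; [apply Hl |].
  pose proof K3_pos as HK. pose proof cphi_nonneg as Hp.
  pose proof (W_le_om (1 / 2) x ltac:(lra)). pose proof (om_le1 x).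
  assert (H3 : qq x ^ 3 * W 1 x <= K3) by (specialize (HK3 x); nra).
  pose proof (qq_ge1 x) as Hq. pose proof (W_pos 1 x) as HW. pose proof (Rabs_pos (x - y)) as Hr.
  specialize (Hb x). unfold Cosc.
  (* Nearby points use [phi_diff]; for [|x - y| > 1] the trivial bound [2] on the phase difference
     is at most [2 |x - y|]. *)
  destruct (Rle_lt_dec (Rabs (x - y)) 1) as [Hd | Hd].
  - pose proof (cis_Lip (tau * phi x) (tau * phi y)) as Hc.
    rewrite <- Rmult_minus_distr_l, Rabs_mult, (Rabs_pos_eq tau) in Hc by lra.
    pose proof (phi_diff x y Hd) as Hpd.
    assert (Hc2 : Cmod (cis (tau * phi x) - cis (tau * phi y)) <= 2 * (cphi * qq x ^ 2 * Rabs (x - y))).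
    { pose proof (Rabs_pos (phi x - phi y)). nra. }
    eapply Rle_trans.
    { apply Rmult_le_compat; [apply Cmod_ge_0 | apply Cmod_ge_0 | apply Hc2 | apply Hb]. }
    replace (2 * (cphi * qq x ^ 2 * Rabs (x - y)) * (b * (qq x * W 1 x)))
      with (2 * cphi * b * Rabs (x - y) * (qq x ^ 3 * W 1 x)) by ring.
    apply Rle_trans with (2 * cphi * b * Rabs (x - y) * K3).
    + apply Rmult_le_compat_l; auto. repeat apply Rmult_le_pos; auto; lra.
    + assert (0 <= b * Rabs (x - y) * K3) by (repeat apply Rmult_le_pos; auto; lra). nra.
  - assert (Hc2 : Cmod (cis (tau * phi x) - cis (tau * phi y)) <= 2).
    { eapply Rle_trans; [apply Cmod_minus_le |]. rewrite !Cmod_cis. lra. }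
    assert (qq x * W 1 x <= K3).
    { eapply Rle_trans; [| apply H3]. apply Rmult_le_compat_r; [lra |].
      simpl. rewrite Rmult_1_r. nra. }
    eapply Rle_trans.
    { apply Rmult_le_compat; [apply Cmod_ge_0 | apply Cmod_ge_0 | apply Hc2 | apply Hb]. }
    assert (0 <= b * K3) by (apply Rmult_le_pos; lra).
    assert (b * K3 <= b * K3 * Rabs (x - y)) by nra.
    nra.
Qed.

Context (HLT : 4 * T * C1 * M ^ 2 <= 1).
Context (HL : 2 * (La + 2 * C1 * M ^ 3 * Cosc + M * Cosc) <= L).
Context (HL' : (2 * cphi * M + 2 * C1 * M ^ 3) * K3 <= L').

Lemma Cosc_nonneg : 0 <= Cosc.
Proof. unfold Cosc. pose proof K3_pos. pose proof cphi_nonneg. nra. Qed.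

Lemma qW_1_rho t x : qq x * W (rho t) x <= qq x * W 1 x.
Proof.
  apply Rmult_le_compat_l; [pose proof (qq_ge1 x); lra |]. apply W_decr, rho_bounds.
Qed.

(** Complex conjugation exchanges the two signs of the phase and preserves moduli. *)
Lemma Lip_opp_phase tau b l f : 0 <= tau <= T -> 0 <= b ->
  (forall x, Cmod (f x) <= b * (qq x * W 1 x)) -> Lip l f ->
  Lip (l + b * Cosc) (fun x => cis (- (tau * phi x)) * f x)%C.
Proof.
  intros Ht Hb0 Hb Hl x y.
  pose proof (osc_Lip tau b l (fun x => Cconj (f x)) Ht Hb0) as H.
  specialize (H ltac:(intros z; cbv beta; rewrite Cmod_conj; apply Hb)).
  specialize (H ltac:(intros u v; cbv beta; rewrite <- Cminus_conj, Cmod_conj; apply Hl) x y).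
  eapply Rle_trans; [| apply H]. right.
  rewrite <- (Cmod_conj (cis (tau * phi x) * Cconj (f x) - _)).
  rewrite Cminus_conj, !Cmult_conj, !Cconj_conj, <- !cis_opp. reflexivity.
Qed.

(** [L] recurs in the bound through [Tri_Lip] with the factor [2 T C1 M^2], at most [1/2] by [HLT];
    hence [L] is taken as twice the remaining constants. *)
Lemma Phi_Lip A t : Inv A -> Lip L (Phi A t).
Proof.
  intros H. pose proof (c1_nonneg gamma delta epsilon) as HC1. pose proof (cl_bounds t) as Hcl.
  pose proof Cosc_nonneg as HCo.
  assert (HCM : 0 <= C1 * M ^ 3) by (apply Rmult_le_pos; [auto | apply pow_le; lra]).
  assert (HCM2 : 0 <= C1 * M ^ 2) by (apply Rmult_le_pos; [auto | apply pow_le; lra]).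
  assert (HLa0 : 0 <= La).
  { specialize (HLa 1 0). rewrite Rminus_0_r, Rabs_R1 in HLa. pose proof (Cmod_ge_0 (a0 1 - a0 0)). lra. }
  assert (HL0 : 0 <= L) by nra.
  set (X := C1 * M ^ 2 * L + C1 * M ^ 3 * Cosc).
  assert (HG : forall s, 0 <= s <= T -> Lip X (fun x => Gd A x s)).
  { intros s Hs. apply Lip_opp_phase; auto.
    - intros x. eapply Rle_trans; [now apply Tri_bound |].
      apply Rmult_le_compat_l; auto. apply qW_1_rho.
    - replace (C1 * M ^ 2 * L) with (C1 * (M * M) * L) by ring.
      pose proof (rho_bounds s). destruct H as [H1 [H2 H3]].
      eapply (Tri_Lip gamma delta epsilon (rho s) M M M L L L); auto; lra. }
  assert (HB : Lip (La + 2 * T * X) (Bd A t)).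
  { intros x y. unfold Bd.
    replace (a0 x + CIt 0 (cl t) (Gd A x) - (a0 y + CIt 0 (cl t) (Gd A y)))%C
      with ((a0 x - a0 y) + (CIt 0 (cl t) (Gd A x) - CIt 0 (cl t) (Gd A y)))%C by ring.
    rewrite <- CIt_minus by now apply Gd_Ccont.
    eapply Rle_trans; [apply Cmod_triangle |]. rewrite Rmult_plus_distr_r.
    apply Rplus_le_compat; [apply HLa |].
    eapply Rle_trans.
    - apply (CIt_const_le 0 (cl t) _ (X * Rabs (x - y))); [lra | |].
      + apply Ccont_minus; now apply Gd_Ccont.
      + intros s Hs. apply HG. lra.
    - assert (0 <= X * Rabs (x - y)).
      { apply Rmult_le_pos; [| apply Rabs_pos]. unfold X.
        apply Rplus_le_le_0_compat; apply Rmult_le_pos; auto. }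
      nra. }
  intros x y.
  eapply Rle_trans.
  - apply (osc_Lip (cl t) M (La + 2 * T * X) (Bd A t) Hcl ltac:(lra)); auto.
    intros z. rewrite <- Cmod_Phi. eapply Rle_trans; [now apply Phi_bound |].
    apply Rmult_le_compat_l; [lra |]. eapply Rle_trans; [| apply (qW_1_rho t)].
    pose proof (qq_ge1 z). pose proof (W_pos (rho t) z). nra.
  - apply Rmult_le_compat_r; [apply Rabs_pos |].
    unfold X.
    assert (4 * T * C1 * M ^ 2 * L <= 1 * L) by (apply Rmult_le_compat_r; auto).
    assert (0 <= C1 * M ^ 3 * Cosc) by now apply Rmult_le_pos.
    assert (T * (C1 * M ^ 3 * Cosc) <= C1 * M ^ 3 * Cosc) by nra.
    lra.
Qed.

Lemma Bd_time A s t x : Inv A -> cl t <= cl s ->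
  (Bd A s x - Bd A t x)%C = CIt (cl t) (cl s) (Gd A x).
Proof.
  intros H Hst. unfold Bd. rewrite (CIt_Chasles 0 (cl t) (cl s)) by now apply Gd_Ccont. ring.
Qed.

(** The increment of the phase costs [qq x ^ 3], the increment of the profile is an integral over
    [[t, s]]. Both are estimated by the size of [A], so [L'] is explicit. *)
Lemma Phi_time A s t x : Inv A ->
  Cmod (Phi A s x - Phi A t x) <= L' * Rabs (s - t) * W (1 / 2) x.
Proof.
  intros H.
  assert (key : forall s t, cl t <= cl s ->
    Cmod (Phi A s x - Phi A t x) <= L' * Rabs (s - t) * W (1 / 2) x).
  { clear s t. intros s t Hst.
    pose proof (c1_nonneg gamma delta epsilon) as HC1. pose proof cphi_nonneg as Hp.
    assert (HCM : 0 <= C1 * M ^ 3) by (apply Rmult_le_pos; [auto | apply pow_le; lra]).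
    unfold Phi.
    replace (cis (cl s * phi x) * Bd A s x - cis (cl t * phi x) * Bd A t x)%C
      with ((cis (cl s * phi x) - cis (cl t * phi x)) * Bd A s x
          + cis (cl t * phi x) * (Bd A s x - Bd A t x))%C by ring.
    rewrite Bd_time by auto.
    eapply Rle_trans; [apply Cmod_triangle |]. rewrite !Cmod_mult, Cmod_cis, Rmult_1_l.
    rewrite <- Cmod_Phi.
    pose proof (Phi_bound A s x H) as HB. pose proof (cis_Lip (cl s * phi x) (cl t * phi x)) as Hc.
    rewrite <- Rmult_minus_distr_r, Rabs_mult in Hc. pose proof (phi_bound x) as Hph.
    pose proof (cl_Lip s t) as Hcl. set (h := Rabs (cl s - cl t)) in *.
    assert (Hh : 0 <= h) by apply Rabs_pos. pose proof (qq_ge1 x) as Hq.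
    pose proof (W_pos 1 x) as HW.
    assert (Hq3 : qq x <= qq x ^ 3) by (simpl; rewrite Rmult_1_r; nra).
    assert (Z1 : Cmod (Phi A s x) <= M * W 1 x).
    { eapply Rle_trans; [apply HB |]. apply Rmult_le_compat_l; [lra |]. apply W_decr, rho_bounds. }
    assert (X1 : Cmod (cis (cl s * phi x) - cis (cl t * phi x)) * Cmod (Phi A s x)
        <= 2 * cphi * M * (qq x ^ 3 * W 1 x) * h).
    { replace (2 * cphi * M * (qq x ^ 3 * W 1 x) * h)
        with ((2 * (h * (cphi * qq x ^ 3))) * (M * W 1 x)) by ring.
      apply Rmult_le_compat; auto using Cmod_ge_0.
      eapply Rle_trans; [apply Hc |]. apply Rmult_le_compat_l; [lra |].
      now apply Rmult_le_compat_l. }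
    assert (X2 : Cmod (CIt (cl t) (cl s) (Gd A x)) <= 2 * (C1 * M ^ 3) * (qq x ^ 3 * W 1 x) * h).
    { eapply Rle_trans.
      - apply (CIt_const_le (cl t) (cl s) _ (C1 * M ^ 3 * (qq x ^ 3 * W 1 x))); auto.
        + now apply Gd_Ccont.
        + intros u _. rewrite Gd_Cmod. eapply Rle_trans; [now apply Tri_bound |].
          apply Rmult_le_compat_l; auto. eapply Rle_trans; [apply qW_1_rho |].
          apply Rmult_le_compat_r; lra.
      - unfold h. rewrite Rabs_pos_eq by lra. lra. }
    apply Rle_trans with ((2 * cphi * M + 2 * C1 * M ^ 3) * (qq x ^ 3 * W 1 x) * h); [lra |].
    assert (Y : 0 <= 2 * cphi * M + 2 * C1 * M ^ 3) by nra.
    pose proof (W_pos (1 / 2) x) as HW2. pose proof K3_pos.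
    apply Rle_trans with ((2 * cphi * M + 2 * C1 * M ^ 3) * (K3 * W (1 / 2) x) * h).
    { apply Rmult_le_compat_r; auto. now apply Rmult_le_compat_l. }
    replace ((2 * cphi * M + 2 * C1 * M ^ 3) * (K3 * W (1 / 2) x) * h)
      with ((2 * cphi * M + 2 * C1 * M ^ 3) * K3 * h * W (1 / 2) x) by ring.
    apply Rmult_le_compat_r; [lra |]. apply Rmult_le_compat; auto.
    apply Rmult_le_pos; lra. }
  destruct (Rle_lt_dec (cl t) (cl s)).
  - now apply key.
  - rewrite Cmod_minus_sym, Rabs_minus_sym. apply key. lra.
Qed.

Lemma Phi_Inv A : Inv A -> Inv (Phi A).
Proof.
  intros H. split; [| split].
  - intros t. split; [eapply Lip_Ccont, Phi_Lip; auto | intros; now apply Phi_bound].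
  - intros t. now apply Phi_Lip.
  - intros s t x. now apply Phi_time.
Qed.

(** * The Picard iteration and its limit *)

Fixpoint iter_A (n : nat) : R -> R -> C :=
  match n with O => fun _ _ => RtoC 0 | S n => Phi (iter_A n) end.

Lemma L_nonneg : 0 <= L.
Proof.
  pose proof (c1_nonneg gamma delta epsilon) as HC1. pose proof Cosc_nonneg.
  assert (0 <= C1 * M ^ 3) by (apply Rmult_le_pos; [auto | apply pow_le; lra]).
  specialize (HLa 1 0). rewrite Rminus_0_r, Rabs_R1 in HLa. pose proof (Cmod_ge_0 (a0 1 - a0 0)).
  nra.
Qed.

Lemma L'_nonneg : 0 <= L'.
Proof.
  pose proof (c1_nonneg gamma delta epsilon) as HC1. pose proof cphi_nonneg. pose proof K3_pos.
  assert (0 <= C1 * M ^ 3) by (apply Rmult_le_pos; [auto | apply pow_le; lra]).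
  eapply Rle_trans; [| apply HL']. apply Rmult_le_pos; nra.
Qed.

Lemma iter_Inv n : Inv (iter_A n).
Proof.
  induction n as [| n IH]; [| now apply Phi_Inv].
  split; [| split].
  - intros t. split; [apply Ccont_const |]. intros x. simpl. rewrite Cmod_0.
    pose proof (W_pos (rho t) x). nra.
  - intros t x y. simpl. replace (RtoC 0 - RtoC 0)%C with (RtoC 0) by ring. rewrite Cmod_0.
    apply Rmult_le_pos; [apply L_nonneg | apply Rabs_pos].
  - intros s t x. simpl. replace (RtoC 0 - RtoC 0)%C with (RtoC 0) by ring. rewrite Cmod_0.
    apply Rmult_le_pos; [apply Rmult_le_pos; [apply L'_nonneg | apply Rabs_pos] | left; apply W_pos].
Qed.

Lemma iter_diff n : forall t, Sw (rho t) (M * (/ 2) ^ n) (fun x => iter_A (S n) t x - iter_A n t x)%C.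
Proof.
  induction n as [| n IH]; intros t.
  - destruct (iter_Inv 1) as [H _]. specialize (H t). split.
    + apply Ccont_minus; [apply H | apply Ccont_const].
    + intros x. destruct H as [_ H]. specialize (H x).
      change (Cmod (iter_A 1 t x - RtoC 0) <= M * (/ 2) ^ 0 * W (rho t) x).
      replace (iter_A 1 t x - RtoC 0)%C with (iter_A 1 t x) by ring. simpl pow. lra.
  - split.
    + apply Ccont_minus; [apply (iter_Inv (S (S n))) | apply (iter_Inv (S n))].
    + intros x. replace (M * (/ 2) ^ S n) with (M * (/ 2) ^ n / 2) by (simpl; field).
      apply (Phi_contract (iter_A (S n)) (iter_A n)); auto using iter_Inv.
Qed.

Definition sol (t x : R) : C :=
  (real (Lim_seq (fun n => Re (iter_A n t x))), real (Lim_seq (fun n => Im (iter_A n t x)))).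

Lemma sol_close n t x : Cmod (sol t x - iter_A n t x) <= 4 * M * (/ 2) ^ n * W (rho t) x.
Proof.
  assert (Hre : forall n, Rabs (Re (iter_A (S n) t x) - Re (iter_A n t x)) <= M * W (rho t) x * (/ 2) ^ n).
  { intros k. pose proof (proj2 (iter_diff k t) x) as H.
    pose proof (Re_le_Cmod (iter_A (S k) t x - iter_A k t x)) as H2.
    eapply Rle_trans; [exact H2 |]. eapply Rle_trans; [exact H | right; ring]. }
  assert (Him : forall n, Rabs (Im (iter_A (S n) t x) - Im (iter_A n t x)) <= M * W (rho t) x * (/ 2) ^ n).
  { intros k. pose proof (proj2 (iter_diff k t) x) as H.
    pose proof (Im_le_Cmod (iter_A (S k) t x - iter_A k t x)) as H2.
    eapply Rle_trans; [exact H2 |]. eapply Rle_trans; [exact H | right; ring]. }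
  pose proof (geom_limit _ _ Hre n) as G1. pose proof (geom_limit _ _ Him n) as G2.
  eapply Rle_trans; [apply Cmod_le_comps |].
  eapply Rle_trans; [apply Rplus_le_compat; [exact G1 | exact G2] |]. right; ring.
Qed.

Lemma sol_Inv : Inv sol.
Proof.
  assert (HLip : forall t, Lip L (sol t)).
  { intros t x y. apply (le_of_geom _ _ (4 * M * W (rho t) x + 4 * M * W (rho t) y)). intros n.
    replace (sol t x - sol t y)%C with ((sol t x - iter_A n t x) - (sol t y - iter_A n t y)
      + (iter_A n t x - iter_A n t y))%C by ring.
    eapply Rle_trans; [apply Cmod_triangle |].
    eapply Rle_trans; [apply Rplus_le_compat_r, Cmod_minus_le |].
    pose proof (sol_close n t x). pose proof (sol_close n t y).
    pose proof (proj1 (proj2 (iter_Inv n)) t x y). lra. }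
  split; [| split]; auto.
  - intros t. split; [eapply Lip_Ccont; eauto |]. intros x.
    apply (le_of_geom _ _ (4 * M * W (rho t) x)). intros n.
    replace (sol t x) with ((sol t x - iter_A n t x) + iter_A n t x)%C by ring.
    eapply Rle_trans; [apply Cmod_triangle |].
    pose proof (sol_close n t x). pose proof (proj2 (proj1 (iter_Inv n) t) x). lra.
  - intros s t x. apply (le_of_geom _ _ (4 * M * W (rho s) x + 4 * M * W (rho t) x)). intros n.
    replace (sol s x - sol t x)%C with ((sol s x - iter_A n s x) - (sol t x - iter_A n t x)
      + (iter_A n s x - iter_A n t x))%C by ring.
    eapply Rle_trans; [apply Cmod_triangle |].
    eapply Rle_trans; [apply Rplus_le_compat_r, Cmod_minus_le |].
    pose proof (sol_close n s x). pose proof (sol_close n t x).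
    pose proof (proj2 (proj2 (iter_Inv n)) s t x). lra.
Qed.

(** [Phi_contract] is applied to an iterate and the limit, at the distance given by [sol_close];
    both satisfy [Inv]. *)
Lemma sol_fixed t x : sol t x = Phi sol t x.
Proof.
  assert (H : Cmod (sol t x - Phi sol t x) <= 0).
  { apply (le_of_geom _ _ (4 * M * W (rho t) x)). intros n. rewrite Rplus_0_l.
    eapply Rle_trans; [apply (Cmod_triangle3 _ (iter_A (S n) t x)) |].
    pose proof (sol_close (S n) t x) as H1.
    assert (H2 : Cmod (iter_A (S n) t x - Phi sol t x) <= 4 * M * (/ 2) ^ n / 2 * W (rho t) x).
    { apply (Phi_contract (iter_A n) sol); auto using iter_Inv, sol_Inv.
      intros u. split.
      - apply Ccont_minus; [apply (iter_Inv n) | apply sol_Inv].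
      - intros y. rewrite Cmod_minus_sym. apply sol_close. }
    simpl pow in H1. lra. }
  assert (E : (sol t x - Phi sol t x)%C = RtoC 0).
  { apply Cmod_eq_0. pose proof (Cmod_ge_0 (sol t x - Phi sol t x)). lra. }
  replace (sol t x) with ((sol t x - Phi sol t x) + Phi sol t x)%C by ring. rewrite E. ring.
Qed.

Lemma CIt_const a b c : CIt a b (fun _ => c) = (RtoC (b - a) * c)%C.
Proof.
  unfold CIt. rewrite !RInt_const. destruct c as [c d].
  apply injective_projections; simpl; unfold scal; simpl; unfold mult; simpl; ring.
Qed.

Context (K6 : R) (HK6 : forall x, qq x ^ 6 * W (1 / 2) x <= K6 * W (1 / 4) x).

Definition Ctime : R := (4 * cphi ^ 2 * M + 10 * cphi * C1 * M ^ 3 + 6 * C1 * M ^ 2 * L') * K6.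

Lemma Gd_time A x s t : Inv A ->
  Cmod (Gd A x s - Gd A x t)
    <= Rabs (s - t) * ((2 * cphi * C1 * M ^ 3 + 3 * C1 * M ^ 2 * L') * (qq x ^ 6 * W (1 / 2) x)).
Proof.
  intros H. unfold Gd.
  replace (cis (- (s * phi x)) * Tri3 (A s) x - cis (- (t * phi x)) * Tri3 (A t) x)%C
    with ((cis (- (s * phi x)) - cis (- (t * phi x))) * Tri3 (A s) x
          + cis (- (t * phi x)) * (Tri3 (A s) x - Tri3 (A t) x))%C by ring.
  eapply Rle_trans; [apply Cmod_triangle |]. rewrite !Cmod_mult, Cmod_cis, Rmult_1_l.
  pose proof (c1_nonneg gamma delta epsilon) as HC1. pose proof cphi_nonneg as Hp.
  assert (HCM : 0 <= C1 * M ^ 3) by (apply Rmult_le_pos; [auto | apply pow_le; lra]).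
  assert (HCM2 : 0 <= C1 * M ^ 2) by (apply Rmult_le_pos; [auto | apply pow_le; lra]).
  pose proof L'_nonneg as HL0.
  pose proof (Tri_bound A s x H) as B. pose proof (Tri_time A s t x H) as B2.
  pose proof (cis_Lip (- (s * phi x)) (- (t * phi x))) as Hc.
  replace (- (s * phi x) - - (t * phi x)) with (- ((s - t) * phi x)) in Hc by ring.
  rewrite Rabs_Ropp, Rabs_mult in Hc. pose proof (phi_bound x) as Hph.
  set (h := Rabs (s - t)) in *. assert (Hh : 0 <= h) by apply Rabs_pos.
  pose proof (qq_ge1 x) as Hq. pose proof (W_pos (1 / 2) x) as HW.
  assert (Hw : W (rho s) x <= W (1 / 2) x) by (apply W_decr; pose proof (rho_bounds s); lra).
  assert (Q4 : qq x ^ 4 <= qq x ^ 6) by (apply Rle_pow; [lra | lia]).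
  assert (Q1 : qq x <= qq x ^ 6).
  { replace (qq x) with (qq x ^ 1) at 1 by ring. apply Rle_pow; [lra | lia]. }
  assert (Y1 : Cmod (cis (- (s * phi x)) - cis (- (t * phi x))) * Cmod (Tri3 (A s) x)
     <= h * (2 * cphi * C1 * M ^ 3 * (qq x ^ 6 * W (1 / 2) x))).
  { apply Rle_trans with ((2 * (h * (cphi * qq x ^ 3))) * (C1 * M ^ 3 * (qq x * W (1 / 2) x))).
    - apply Rmult_le_compat; auto using Cmod_ge_0.
      + eapply Rle_trans; [apply Hc |]. apply Rmult_le_compat_l; [lra |].
        now apply Rmult_le_compat_l.
      + eapply Rle_trans; [apply B |]. apply Rmult_le_compat_l; auto.
        apply Rmult_le_compat_l; lra.
    - replace (2 * (h * (cphi * qq x ^ 3)) * (C1 * M ^ 3 * (qq x * W (1 / 2) x)))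
        with (h * cphi * (C1 * M ^ 3) * 2 * (qq x ^ 4 * W (1 / 2) x)) by ring.
      replace (h * (2 * cphi * C1 * M ^ 3 * (qq x ^ 6 * W (1 / 2) x)))
        with (h * cphi * (C1 * M ^ 3) * 2 * (qq x ^ 6 * W (1 / 2) x)) by ring.
      apply Rmult_le_compat_l.
      + apply Rmult_le_pos; [| lra]. apply Rmult_le_pos; auto. now apply Rmult_le_pos.
      + apply Rmult_le_compat_r; lra. }
  assert (Y2 : 3 * C1 * M ^ 2 * (L' * h) * (qq x * W (1 / 2) x)
     <= h * (3 * C1 * M ^ 2 * L' * (qq x ^ 6 * W (1 / 2) x))).
  { replace (3 * C1 * M ^ 2 * (L' * h) * (qq x * W (1 / 2) x))
      with (h * (C1 * M ^ 2) * L' * 3 * (qq x * W (1 / 2) x)) by ring.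
    replace (h * (3 * C1 * M ^ 2 * L' * (qq x ^ 6 * W (1 / 2) x)))
      with (h * (C1 * M ^ 2) * L' * 3 * (qq x ^ 6 * W (1 / 2) x)) by ring.
    apply Rmult_le_compat_l.
    - apply Rmult_le_pos; [| lra]. apply Rmult_le_pos; auto. now apply Rmult_le_pos.
    - apply Rmult_le_compat_r; lra. }
  lra.
Qed.

(** The integrand is Lipschitz in time by [Gd_time], so freezing it at [t] leaves a quadratic
    error. *)
Lemma Bd_time_quad A s t x : Inv A -> 0 <= s <= T -> 0 <= t <= T ->
  Cmod (Bd A s x - Bd A t x - RtoC (s - t) * Gd A x t)
    <= 2 * (s - t) ^ 2 * ((2 * cphi * C1 * M ^ 3 + 3 * C1 * M ^ 2 * L') * (qq x ^ 6 * W (1 / 2) x)).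
Proof.
  intros H Hs Ht.
  set (c := (2 * cphi * C1 * M ^ 3 + 3 * C1 * M ^ 2 * L') * (qq x ^ 6 * W (1 / 2) x)).
  assert (Hc : forall r, Cmod (Gd A x r - Gd A x t) <= Rabs (r - t) * c)
    by (intros r; now apply Gd_time).
  assert (Hc0 : 0 <= c).
  { specialize (Hc (t + 1)). replace (t + 1 - t) with 1 in Hc by ring. rewrite Rabs_R1 in Hc.
    pose proof (Cmod_ge_0 (Gd A x (t + 1) - Gd A x t)). lra. }
  assert (key : forall a b, a <= b -> (a = t \/ b = t) ->
     Cmod (CIt a b (Gd A x) - RtoC (b - a) * Gd A x t) <= 2 * (b - a) ^ 2 * c).
  { intros a b Hab Hor. rewrite <- CIt_const.
    rewrite <- CIt_minus by (auto using Ccont_const; now apply Gd_Ccont).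
    eapply Rle_trans.
    - apply (CIt_const_le a b _ ((b - a) * c)); auto.
      + apply Ccont_minus; [now apply Gd_Ccont | apply Ccont_const].
      + intros r Hr. eapply Rle_trans; [apply Hc |]. apply Rmult_le_compat_r; auto.
        apply Rabs_le. destruct Hor; lra.
    - right; ring. }
  destruct (Rle_lt_dec t s) as [Hts | Hts].
  - rewrite Bd_time by (auto; rewrite !cl_id; lra). rewrite !cl_id by lra. apply key; auto.
  - replace (Bd A s x - Bd A t x - RtoC (s - t) * Gd A x t)%C
      with (- ((Bd A t x - Bd A s x) - RtoC (t - s) * Gd A x t))%C
      by (rewrite !RtoC_minus; ring).
    rewrite Cmod_opp, Bd_time by (auto; rewrite !cl_id; lra). rewrite !cl_id by lra.
    replace ((s - t) ^ 2) with ((t - s) ^ 2) by ring. apply key; auto; lra.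
Qed.

(** The fixed-point equation in differential form. The remainder is quadratic in time and still
    decays exponentially in the frequency, so it can be multiplied by any power of the frequency:
    this gives the equation for all [x]-derivatives at once. *)
Lemma time_derivative A : Inv A -> (forall t x, A t x = Phi A t x) ->
  forall s t x, 0 <= s <= T -> 0 <= t <= T ->
  Cmod (A s x - A t x - RtoC (s - t) * (Ci * RtoC (phi x) * A t x + Tri3 (A t) x))
    <= Ctime * (s - t) ^ 2 * W (1 / 4) x.
Proof.
  intros H Hfix s t x Hs Ht.
  assert (EA : forall r, 0 <= r <= T -> A r x = (cis (r * phi x) * Bd A r x)%C).
  { intros r Hr. rewrite Hfix. unfold Phi. now rewrite cl_id. }
  assert (ET : Tri3 (A t) x = (cis (t * phi x) * Gd A x t)%C).
  { unfold Gd. replace (Tri3 (A t) x) with (RtoC 1 * Tri3 (A t) x)%C at 1 by ring.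
    rewrite <- (cis_mul_opp (t * phi x)). ring. }
  set (e := ((s - t) * phi x)%R).
  (* Product rule for phase times profile: the Taylor remainder of the phase, that of the profile,
     and a mixed term of second order. *)
  assert (Eq : (A s x - A t x - RtoC (s - t) * (Ci * RtoC (phi x) * A t x + Tri3 (A t) x)
     = (cis (t * phi x + e)%R - cis (t * phi x)%R - Ci * RtoC e * cis (t * phi x)%R) * Bd A t x
       + cis (s * phi x)%R * (Bd A s x - Bd A t x - RtoC (s - t) * Gd A x t)
       + RtoC (s - t) * ((cis (s * phi x)%R - cis (t * phi x)%R) * Gd A x t))%C).
  { rewrite (EA s Hs), (EA t Ht), ET.
    replace (t * phi x + e)%R with (s * phi x)%R by (unfold e; ring).
    unfold e. rewrite RtoC_mult. ring. }
  rewrite Eq. clear Eq.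
  pose proof (cis_taylor (t * phi x) e) as Ht1.
  pose proof (Bd_time_quad A s t x H Hs Ht) as Ht2.
  pose proof (cis_Lip (s * phi x) (t * phi x)) as Ht3.
  rewrite <- Rmult_minus_distr_r, Rabs_mult in Ht3.
  pose proof (Phi_bound A t x H) as HB. rewrite Cmod_Phi in HB.
  pose proof (Tri_bound A t x H) as HT. rewrite <- (Gd_Cmod A x t) in HT.
  eapply Rle_trans; [apply Cmod_triangle |].
  eapply Rle_trans; [apply Rplus_le_compat_r, Cmod_triangle |].
  rewrite !Cmod_mult, Cmod_cis, Rmult_1_l, Cmod_R.
  pose proof (c1_nonneg gamma delta epsilon) as HC1. pose proof cphi_nonneg as Hp.
  assert (HCM : 0 <= C1 * M ^ 3) by (apply Rmult_le_pos; [auto | apply pow_le; lra]).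
  assert (HCM2 : 0 <= C1 * M ^ 2) by (apply Rmult_le_pos; [auto | apply pow_le; lra]).
  pose proof L'_nonneg as HL0. pose proof (phi_bound x) as Hph.
  pose proof (qq_ge1 x) as Hq. pose proof (W_pos (1 / 2) x) as HW.
  assert (Hw : W (rho t) x <= W (1 / 2) x) by (apply W_decr; pose proof (rho_bounds t); lra).
  assert (Q4 : qq x ^ 4 <= qq x ^ 6) by (apply Rle_pow; [lra | lia]).
  set (Z := qq x ^ 6 * W (1 / 2) x) in *.
  assert (Hh2 : (s - t) ^ 2 = Rabs (s - t) * Rabs (s - t)) by (rewrite <- pow2_abs; ring).
  assert (Hh : 0 <= (s - t) ^ 2) by apply pow2_ge_0.
  assert (Y1 : Cmod (cis (t * phi x + e)%R - cis (t * phi x)%R - Ci * RtoC e * cis (t * phi x)%R)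
      * Cmod (Bd A t x) <= 2 * cphi ^ 2 * M * Z * (s - t) ^ 2).
  { apply Rle_trans with ((2 * ((s - t) ^ 2 * (cphi ^ 2 * qq x ^ 6))) * (M * W (1 / 2) x)).
    - apply Rmult_le_compat; auto using Cmod_ge_0.
      + eapply Rle_trans; [apply Ht1 |]. apply Rmult_le_compat_l; [lra |].
        unfold e. rewrite Rpow_mult_distr. apply Rmult_le_compat_l; auto.
        replace (cphi ^ 2 * qq x ^ 6) with ((cphi * qq x ^ 3) ^ 2) by ring.
        rewrite <- (pow2_abs (phi x)). apply pow_incr. split; [apply Rabs_pos | auto].
      + eapply Rle_trans; [apply HB |]. apply Rmult_le_compat_l; lra.
    - unfold Z. right; ring. }
  assert (Y3 : Rabs (s - t) * (Cmod (cis (s * phi x) - cis (t * phi x)) * Cmod (Gd A x t))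
      <= 2 * cphi * C1 * M ^ 3 * Z * (s - t) ^ 2).
  { apply Rle_trans with (Rabs (s - t) * ((2 * (Rabs (s - t) * (cphi * qq x ^ 3)))
        * (C1 * M ^ 3 * (qq x * W (1 / 2) x)))).
    - apply Rmult_le_compat_l; [apply Rabs_pos |].
      apply Rmult_le_compat; auto using Cmod_ge_0.
      + eapply Rle_trans; [apply Ht3 |]. apply Rmult_le_compat_l; [lra |].
        apply Rmult_le_compat_l; auto using Rabs_pos.
      + eapply Rle_trans; [apply HT |]. apply Rmult_le_compat_l; auto.
        apply Rmult_le_compat_l; lra.
    - rewrite Hh2. unfold Z.
      replace (Rabs (s - t) * (2 * (Rabs (s - t) * (cphi * qq x ^ 3)) * (C1 * M ^ 3 * (qq x * W (1 / 2) x))))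
        with ((Rabs (s - t) * Rabs (s - t)) * cphi * (C1 * M ^ 3) * 2 * (qq x ^ 4 * W (1 / 2) x)) by ring.
      replace (2 * cphi * C1 * M ^ 3 * (qq x ^ 6 * W (1 / 2) x) * (Rabs (s - t) * Rabs (s - t)))
        with ((Rabs (s - t) * Rabs (s - t)) * cphi * (C1 * M ^ 3) * 2 * (qq x ^ 6 * W (1 / 2) x)) by ring.
      rewrite <- Hh2. apply Rmult_le_compat_l.
      + apply Rmult_le_pos; [| lra]. apply Rmult_le_pos; auto. now apply Rmult_le_pos.
      + apply Rmult_le_compat_r; lra. }
  assert (HZ : Z <= K6 * W (1 / 4) x) by apply HK6.
  assert (HZ0 : 0 <= Z) by (apply Rmult_le_pos; [apply pow_le |]; lra).
  set (c := 4 * cphi ^ 2 * M + 10 * cphi * C1 * M ^ 3 + 6 * C1 * M ^ 2 * L').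
  assert (Hc2 : 0 <= cphi ^ 2 * M) by (apply Rmult_le_pos; [apply pow2_ge_0 | lra]).
  assert (Hc3 : 0 <= cphi * C1 * M ^ 3) by (rewrite Rmult_assoc; now apply Rmult_le_pos).
  assert (Hc4 : 0 <= C1 * M ^ 2 * L') by now apply Rmult_le_pos.
  apply Rle_trans with (c * (s - t) ^ 2 * Z).
  - assert (P1 : 0 <= cphi ^ 2 * M * Z * (s - t) ^ 2) by (apply Rmult_le_pos; auto; apply Rmult_le_pos; auto).
    assert (P2 : 0 <= cphi * C1 * M ^ 3 * Z * (s - t) ^ 2) by (apply Rmult_le_pos; auto; apply Rmult_le_pos; auto).
    unfold c. lra.
  - unfold Ctime. fold c.
    replace (c * K6 * (s - t) ^ 2 * W (1 / 4) x) with (c * (s - t) ^ 2 * (K6 * W (1 / 4) x)) by ring.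
    apply Rmult_le_compat_l; auto. apply Rmult_le_pos; auto. unfold c. lra.
Qed.

End Duhamel.

(** The bounds hold for all real [t] because times are clamped; only the equation is confined to
    [[0, T]]. *)
Theorem fourier_solution alpha beta gamma delta epsilon a0 La M :
  0 < M -> (forall x, Cmod (a0 x) <= M / 2 * W 2 x) -> Lip La a0 ->
  exists T L L' Ct (A : R -> R -> C), 0 < T /\
    (forall t, Sw 1 M (A t)) /\ (forall t, Lip L (A t)) /\
    (forall s t x, Cmod (A s x - A t x) <= L' * Rabs (s - t) * W (1 / 2) x) /\
    (forall x, A 0 x = a0 x) /\
    forall s t x, 0 <= s <= T -> 0 <= t <= T ->
      Cmod (A s x - A t x - RtoC (s - t) * (Ci * RtoC (phi alpha beta x) * A t x
              + Tri gamma delta epsilon (A t) (A t) (A t) x))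
        <= Ct * (s - t) ^ 2 * W (1 / 4) x.
Proof.
  intros HM Ha0 HLa.
  set (C1 := c1 gamma delta epsilon).
  pose proof (c1_nonneg gamma delta epsilon : 0 <= C1) as HC1.
  assert (HCM2 : 0 <= C1 * M ^ 2) by (apply Rmult_le_pos; [auto | apply pow_le; lra]).
  (* Radii: at least [1] for the solution, [1/2] after one time increment (three powers of the
     frequency), [1/4] after the quadratic remainder (six powers). *)
  destruct (poly_W 3 1 (1 / 2) ltac:(lra)) as [K3 [_ HK3]].
  destruct (poly_W 6 (1 / 2) (1 / 4) ltac:(lra)) as [K6 [_ HK6]].
  (* [12 C1 M^2] is what contraction by [1/2] requires. The [+ 1] makes [T = 1 / kappa] at most [1],
     and [kappa T = 1] keeps the radius between [1] and [2]. *)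
  set (kappa := 12 * C1 * M ^ 2 + 1).
  set (T := / kappa).
  assert (Hk : 1 <= kappa) by (unfold kappa; lra).
  assert (HkT : kappa * T = 1) by (unfold T; field; lra).
  assert (HT0 : 0 < T) by (apply Rinv_0_lt_compat; lra).
  assert (HT1 : T <= 1) by nra.
  set (L := 2 * (La + 2 * C1 * M ^ 3 * Cosc alpha beta K3 + M * Cosc alpha beta K3)).
  set (L' := (2 * cphi alpha beta * M + 2 * C1 * M ^ 3) * K3).
  assert (HLT : 4 * T * C1 * M ^ 2 <= 1).
  { apply Rle_trans with (kappa * T); [| lra].
    assert (0 <= T * (C1 * M ^ 2)) by (apply Rmult_le_pos; lra). unfold kappa. lra. }
  set (A := sol alpha beta gamma delta epsilon a0 T).
  assert (Hk0 : 0 < kappa) by lra.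
  assert (HkT' : kappa * T <= 1) by lra.
  assert (HkM : 12 * C1 * M ^ 2 <= kappa) by (unfold kappa; lra).
  assert (HI : Inv T kappa M L L' A)
    by exact (sol_Inv alpha beta _ _ _ a0 T kappa M L L' HT0 HT1 Hk0 HkT' La Ha0 HLa HM HkM
                K3 HK3 HLT (Rle_refl _) (Rle_refl _)).
  assert (Hfix : forall t x, A t x = Phi alpha beta gamma delta epsilon a0 T A t x)
    by exact (sol_fixed alpha beta _ _ _ a0 T kappa M L L' HT0 HT1 Hk0 HkT' La Ha0 HLa HM HkM
                K3 HK3 HLT (Rle_refl _) (Rle_refl _)).
  exists T, L, L', (Ctime alpha beta gamma delta epsilon M L' K6), A.
  split; [auto |]. split; [| split; [| split; [| split]]].
  - intros t. destruct HI as [H _]. eapply Sw_weaken; [| apply H].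
    exact (proj1 (rho_bounds T kappa HT0 HT1 Hk0 HkT' t)).
  - apply HI.
  - apply HI.
  - intros x. rewrite Hfix. unfold Phi, Bd. rewrite cl_id by lra.
    rewrite Rmult_0_l, cis_0.
    assert (E : forall f, CIt 0 0 f = RtoC 0).
    { intros f. unfold CIt. now rewrite !RInt_point. }
    rewrite E. ring.
  - exact (time_derivative alpha beta _ _ _ a0 T kappa M L L' HT0 HT1 Hk0 HkT' Ha0 HM HkM
             K3 HK3 (Rle_refl _) K6 HK6 A HI Hfix).
Qed.

(** * From the Fourier side to the physical side *)
Lemma is_Cderive_unique f x l l' : is_Cderive f x l -> is_Cderive f x l' -> l = l'.
Proof.
  intros [H1 H2] [H3 H4]. apply is_derive_unique in H1, H2, H3, H4.
  destruct l, l'. simpl in *. f_equal; congruence.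
Qed.

Lemma is_Cderive_ext f g x l : (forall y, f y = g y) -> is_Cderive f x l -> is_Cderive g x l.
Proof.
  intros E [H1 H2]; split; (eapply is_derive_ext; [| eassumption]); intros; cbv beta; now rewrite E.
Qed.

Lemma is_Cderive_plus f g x l l' : is_Cderive f x l -> is_Cderive g x l' ->
  is_Cderive (fun y => f y + g y)%C x (l + l')%C.
Proof.
  intros [H1 H2] [H3 H4]; split.
  - apply (is_derive_plus (fun y => Re (f y)) (fun y => Re (g y))); auto.
  - apply (is_derive_plus (fun y => Im (f y)) (fun y => Im (g y))); auto.
Qed.

Lemma is_Cderive_mult f g x l l' : is_Cderive f x l -> is_Cderive g x l' ->
  is_Cderive (fun y => f y * g y)%C x (l * g x + f x * l')%C.
Proof.
  intros [H1 H2] [H3 H4]. split.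
  - assert (K : is_derive (fun y => Re (f y) * Re (g y) - Im (f y) * Im (g y)) x
      ((Re l * Re (g x) + Re (f x) * Re l') - (Im l * Im (g x) + Im (f x) * Im l'))).
    { apply (is_derive_minus (fun y => Re (f y) * Re (g y)) (fun y => Im (f y) * Im (g y)));
      [apply (is_derive_mult (fun y => Re (f y)) (fun y => Re (g y)))
      | apply (is_derive_mult (fun y => Im (f y)) (fun y => Im (g y)))]; auto;
      intros; apply Rmult_comm. }
    replace (Re (l * g x + f x * l')%C) with
      ((Re l * Re (g x) + Re (f x) * Re l') - (Im l * Im (g x) + Im (f x) * Im l'))
      by (unfold Re, Im; simpl; ring).
    exact K.
  - assert (K : is_derive (fun y => Re (f y) * Im (g y) + Im (f y) * Re (g y)) x
      ((Re l * Im (g x) + Re (f x) * Im l') + (Im l * Re (g x) + Im (f x) * Re l'))).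
    { apply (is_derive_plus (fun y => Re (f y) * Im (g y)) (fun y => Im (f y) * Re (g y)));
      [apply (is_derive_mult (fun y => Re (f y)) (fun y => Im (g y)))
      | apply (is_derive_mult (fun y => Im (f y)) (fun y => Re (g y)))]; auto;
      intros; apply Rmult_comm. }
    replace (Im (l * g x + f x * l')%C) with
      ((Re l * Im (g x) + Re (f x) * Im l') + (Im l * Re (g x) + Im (f x) * Re l'))
      by (unfold Re, Im; simpl; ring).
    exact K.
Qed.

Lemma is_Cderive_RtoC f x l : is_derive f x l -> is_Cderive (fun y => RtoC (f y)) x (RtoC l).
Proof. intros H; split; simpl; auto. apply (is_derive_const 0). Qed.

Definition ixin (j : nat) (f : R -> C) (s : R) : C := ((Ci * RtoC s) ^ j * f s)%C.

Lemma Cmod_Cpow (z : C) j : Cmod (z ^ j) = Cmod z ^ j.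
Proof.
  induction j as [| j IH]; simpl; [apply Cmod_1 | now rewrite Cmod_mult, IH].
Qed.

Lemma Cmod_ixin j f s : Cmod (ixin j f s) = Rabs s ^ j * Cmod (f s).
Proof.
  unfold ixin. now rewrite Cmod_mult, Cmod_Cpow, Cmod_mult, Cmod_Ci, Cmod_R, Rmult_1_l.
Qed.

Lemma ixi_ixin j f s : ixi (ixin j f) s = ixin (S j) f s.
Proof. unfold ixi, ixin. simpl. ring. Qed.

Lemma Ccont_ixin j f : Ccont f -> Ccont (ixin j f).
Proof.
  intros H. induction j as [| j IH].
  - apply (Ccont_ext f); auto. intros; unfold ixin; simpl; ring.
  - apply (Ccont_ext (ixi (ixin j f))); [apply ixi_ixin | now apply Ccont_ixi].
Qed.

Lemma ixin_weight j r : 0 < r -> exists K, 0 < K /\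
  forall x, (1 + x ^ 2) * (Rabs x ^ j * (qq x * W r x)) <= K * om x.
Proof.
  intros Hr. destruct (poly_W (j + 3) r 0 Hr) as [K [HK1 HK2]].
  exists K. split; auto. intros x. specialize (HK2 x).
  pose proof (W_le_om 0 x (Rle_refl 0)). pose proof (W_pos r x) as HW. pose proof (qq_ge1 x) as Hq.
  apply Rle_trans with (qq x ^ (j + 3) * W r x); [| nra].
  replace (qq x ^ (j + 3) * W r x) with (qq x ^ 2 * (qq x ^ j * (qq x * W r x)))
    by (rewrite pow_add; ring).
  assert (0 <= Rabs x ^ j) by apply pow_le, Rabs_pos.
  assert (0 <= qq x * W r x) by nra.
  apply Rmult_le_compat.
  - nra.
  - now apply Rmult_le_pos.
  - unfold qq. pose proof (Rabs_pos x). rewrite <- (pow2_abs x). nra.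
  - apply Rmult_le_compat_r; auto. apply pow_incr. split; [apply Rabs_pos | apply abs_le_qq].
Qed.

(** [K] is chosen before [f], so that one constant serves the transforms at all times. *)
Lemma ixin_bound j r b : 0 < r -> 0 <= b -> exists K, 0 <= K /\ forall f,
  (forall x, Cmod (f x) <= b * (qq x * W r x)) ->
  forall x, (1 + x ^ 2) * Cmod (ixin j f x) <= K * om x.
Proof.
  intros Hr Hb. destruct (ixin_weight j r Hr) as [K [HK1 HK2]].
  exists (b * K). split; [nra |]. intros f Hf x. rewrite Cmod_ixin.
  specialize (HK2 x). specialize (Hf x).
  apply Rle_trans with (b * ((1 + x ^ 2) * (Rabs x ^ j * (qq x * W r x)))).
  - replace (b * ((1 + x ^ 2) * (Rabs x ^ j * (qq x * W r x))))
      with ((1 + x ^ 2) * (Rabs x ^ j * (b * (qq x * W r x)))) by ring.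
    apply Rmult_le_compat_l; [nra |]. apply Rmult_le_compat_l; auto. apply pow_le, Rabs_pos.
  - rewrite Rmult_assoc. now apply Rmult_le_compat_l.
Qed.

Lemma Cdom_of_weighted K f : Ccont f -> (forall x, (1 + x ^ 2) * Cmod (f x) <= K * om x) -> Cdom K f.
Proof.
  intros Hc H. split; auto. intros x. specialize (H x). pose proof (Cmod_ge_0 (f x)). nra.
Qed.

Lemma F_tower_derive K j f x : Ccont f -> (forall x, (1 + x ^ 2) * Cmod (ixin j f x) <= K * om x) ->
  is_Cderive (F (ixin j f)) x (F (ixin (S j) f) x).
Proof.
  intros Hc H.
  rewrite <- (F_ext (ixi (ixin j f))) by apply ixi_ixin.
  apply (F_derive K); auto. now apply Ccont_ixin.
Qed.

(* [Pr u V j a b] is the [j]-th derivative of [u a * V b], by the Leibniz rule in recursive form. *)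
Fixpoint Pr (u V : nat -> R -> R -> C) (j a b : nat) (x t : R) : C :=
  match j with
  | O => (u a x t * V b x t)%C
  | S j => (Pr u V j (S a) b x t + Pr u V j a (S b) x t)%C
  end.

(** [u j] plays the role of the [j]-th [x]-derivative; each is bounded uniformly in position and
    time. *)
Definition tower (u : nat -> R -> R -> C) : Prop :=
  (forall j, exists K, 0 <= K /\ forall x t, Cmod (u j x t) <= K) /\
  (forall j x t, is_Cderive (fun y => u j y t) x (u (S j) x t)).

Lemma Pr_derive u V j : tower u -> tower V -> forall a b x t,
  is_Cderive (fun y => Pr u V j a b y t) x (Pr u V (S j) a b x t).
Proof.
  intros [_ Hu] [_ HV]. induction j as [| j IH]; intros a b x t.
  - apply (is_Cderive_mult (fun y => u a y t) (fun y => V b y t)); auto.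
  - apply (is_Cderive_plus (fun y => Pr u V j (S a) b y t) (fun y => Pr u V j a (S b) y t)); apply IH.
Qed.

Lemma F_tower (f : R -> R -> C) r b : 0 < r -> 0 <= b ->
  (forall t, Ccont (f t)) -> (forall t x, Cmod (f t x) <= b * (qq x * W r x)) ->
  tower (fun j x t => F (ixin j (f t)) x).
Proof.
  intros Hr Hb Hc Hf. split.
  - intros j. destruct (ixin_bound j r b Hr Hb) as [K [HK1 HK2]].
    exists (2 * PI * K). split; [pose proof PI_RGT_0; nra |]. intros x t.
    apply F_bound, Cdom_of_weighted; [now apply Ccont_ixin | now apply HK2].
  - intros j x t. destruct (ixin_bound j r b Hr Hb) as [K [HK1 HK2]].
    apply (F_tower_derive K); auto.
Qed.

(** * The Gaussian and its transform *)

Definition gauss (x : R) : C := RtoC (exp (- x ^ 2)).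

Lemma gauss_Lip : Lip 2 gauss.
Proof.
  intros x y. unfold gauss. rewrite <- RtoC_minus, Cmod_R.
  apply (MVT_bound (fun x => exp (- x ^ 2)) (fun x => - (2 * x) * exp (- x ^ 2)) y x 2).
  - intros c. auto_derive; auto. simpl. ring.
  - intros c _. rewrite Rabs_mult, Rabs_Ropp, Rabs_mult, (Rabs_pos_eq 2), (Rabs_pos_eq (exp _))
      by (try lra; left; apply exp_pos).
    pose proof (exp_ge_1plus (c ^ 2)) as H.
    assert (E : exp (- c ^ 2) * exp (c ^ 2) = 1) by (rewrite <- exp_plus, Rplus_opp_l; apply exp_0).
    assert (Rabs c <= 1 + c ^ 2) by (rewrite <- pow2_abs; nra).
    assert (Rabs c * exp (- c ^ 2) <= 1); [| lra]. rewrite <- E. nra.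
Qed.

(** Completing the square, [- x^2 = 3 - 2 (1 + |x|) - (|x| - 1)^2] yields [exp 3], and the leftover
    Gaussian pays for [om] with a factor [5]. The constant is written as [M / 2] for the [M] of
    [physical_solution]. *)
Lemma gauss_W x : Cmod (gauss x) <= 10 * exp 3 / 2 * W 2 x.
Proof.
  unfold gauss. rewrite Cmod_R, Rabs_pos_eq by (left; apply exp_pos).
  unfold W. apply Rmult_le_reg_r with (1 + x ^ 2); [nra |].
  replace (10 * exp 3 / 2 * (exp (- (2 * qq x)) * om x) * (1 + x ^ 2))
    with (10 * exp 3 / 2 * exp (- (2 * qq x)) * (om x * (1 + x ^ 2))) by ring.
  rewrite om_inv, Rmult_1_r.
  set (z := (Rabs x - 1) ^ 2).
  replace (- x ^ 2) with (3 + - (2 * qq x) + - z)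
    by (unfold z, qq; rewrite <- (pow2_abs x); ring).
  rewrite !exp_plus.
  assert (Hz : 0 <= z) by apply pow2_ge_0.
  assert (Hx : 1 + x ^ 2 <= 3 + 2 * z).
  { unfold z. rewrite <- (pow2_abs x). pose proof (pow2_ge_0 (Rabs x - 2)). nra. }
  pose proof (exp_ge_1plus z).
  assert (E : exp (- z) * exp z = 1) by (rewrite <- exp_plus, Rplus_opp_l; apply exp_0).
  assert (exp (- z) * (1 + x ^ 2) <= 5).
  { replace 5 with (5 * (exp (- z) * exp z)) by (rewrite E; ring). nra. }
  pose proof (exp_pos 3). pose proof (exp_pos (- (2 * qq x))).
  assert (0 < exp 3 * exp (- (2 * qq x))) by now apply Rmult_lt_0_compat. nra.
Qed.

Lemma gauss_Sw : Sw 2 (10 * exp 3 / 2) gauss.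
Proof. split; [eapply Lip_Ccont, gauss_Lip | apply gauss_W]. Qed.

(** The integral over [s] of the derivative of [exp (i x s - s^2)] in [s] is zero. *)
Lemma F_gauss_ode x : F (ixi gauss) x = (RtoC (- x / 2) * F gauss x)%C.
Proof.
  pose proof gauss_Sw as HS.
  pose proof (F_dom _ _ x (Ew_dom 2 _ _ ltac:(lra) (Sw_Ew _ _ _ HS))) as D1.
  pose proof (F_dom _ _ x (Ew_dom 2 _ _ ltac:(lra) (Ew_ixi _ _ _ HS))) as D2.
  set (M := 2 * (10 * exp 3 / 2)) in *.
  assert (D := Cdom_plus _ _ _ _ (Cdom_scal _ _ (Ci * RtoC x)%C D1) (Cdom_scal _ _ (RtoC 2 * Ci)%C D2)).
  assert (E : CI (fun s => (Ci * RtoC x) * (cis (x * s) * gauss s)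
                  + (RtoC 2 * Ci) * (cis (x * s) * ixi gauss s))%C = RtoC 0).
  { match goal with |- _ = RtoC 0 => change (RtoC 0) with (0, 0) end.
    unfold CI. f_equal.
    - eapply (intR_deriv_zero _ M (fun s => Re (cis (x * s) * gauss s)%C)); [| eapply Cdom_Re, D |].
      + intros s. unfold cis, gauss, ixi, Re; simpl. auto_derive; auto. simpl. ring.
      + intros s. eapply Rle_trans; [apply Re_le_Cmod | apply D1].
    - eapply (intR_deriv_zero _ M (fun s => Im (cis (x * s) * gauss s)%C)); [| eapply Cdom_Im, D |].
      + intros s. unfold cis, gauss, ixi, Im; simpl. auto_derive; auto. simpl. ring.
      + intros s. eapply Rle_trans; [apply Im_le_Cmod | apply D1]. }
  erewrite CI_plus in E by (eapply Cdom_scal; eassumption).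
  rewrite (CI_scal M) in E by exact D1. rewrite (CI_scal M) in E by exact D2.
  fold (F gauss x) (F (ixi gauss) x) in E.
  destruct (F gauss x) as [f1 f2]. destruct (F (ixi gauss) x) as [y1 y2].
  pose proof (f_equal fst E) as E1. pose proof (f_equal snd E) as E2. simpl in E1, E2.
  apply injective_projections; simpl; lra.
Qed.

Lemma RInt_le_intR M f a : dom M f -> (forall x, 0 <= f x) -> 0 <= a -> RInt f (- a) a <= intR f.
Proof.
  intros D H Ha.
  destruct (nfloor_ex a Ha) as [N [_ HN]].
  change (Rbar_le (RInt f (- a) a) (intR f)).
  eapply is_lim_seq_le_loc; [| apply is_lim_seq_const | eapply intR_lim; eauto].
  exists (S N). intros n Hn. apply le_INR in Hn. rewrite S_INR in Hn.
  pose proof D as [Hc _].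
  rewrite (RInt_split f (- INR n) (- a) (INR n)), (RInt_split f (- a) a (INR n)) by auto.
  assert (0 <= RInt f (- INR n) (- a)).
  { apply RInt_ge_0; [lra | now apply cont_ex_RInt | auto]. }
  assert (0 <= RInt f a (INR n)).
  { apply RInt_ge_0; [lra | now apply cont_ex_RInt | auto]. }
  lra.
Qed.

Lemma intR_gauss_pos : 0 < intR (fun x => exp (- x ^ 2)).
Proof.
  pose proof (Cdom_Re _ _ (Ew_dom 2 _ _ ltac:(lra) (Sw_Ew _ _ _ gauss_Sw))) as D.
  change (fun x => Re (gauss x)) with (fun x : R => exp (- x ^ 2)) in D.
  eapply Rlt_le_trans; [| eapply (RInt_le_intR _ _ 1 D); [intros; left; apply exp_pos | lra]].
  apply RInt_gt_0; [lra | intros; apply exp_pos |].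
  intros x _. apply (ex_derive_continuous (fun x => exp (- x ^ 2))). auto_derive; auto.
Qed.

Lemma linear_ode (f : R -> R) : (forall x, is_derive f x (- x / 2 * f x)) ->
  forall x, f x = f 0 * exp (- x ^ 2 / 4).
Proof.
  intros H x.
  assert (K : forall y, is_derive (fun y => f y * exp (y ^ 2 / 4)) y 0).
  { intros y. replace 0 with ((- y / 2 * f y) * exp (y ^ 2 / 4) + f y * (y / 2 * exp (y ^ 2 / 4))) by field.
    apply (is_derive_mult f (fun y => exp (y ^ 2 / 4))); auto.
    - auto_derive; auto. simpl. unfold Rdiv. ring_simplify.
      replace (2 * y * / 4) with (y * / 2) by field. ring.
    - intros; apply Rmult_comm. }
  assert (E : f x * exp (x ^ 2 / 4) = f 0 * exp (0 ^ 2 / 4)).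
  { destruct (MVT_cor4 (fun y => f y * exp (y ^ 2 / 4)) (fun _ => 0) 0 (Rabs (x - 0)) (fun c _ => K c) x (Rle_refl _))
      as [c [Ec _]]. simpl in *. lra. }
  replace (0 ^ 2 / 4) with 0 in E by field. rewrite exp_0, Rmult_1_r in E.
  rewrite <- E, Rmult_assoc, <- exp_plus. replace (x ^ 2 / 4 + - x ^ 2 / 4) with 0 by field.
  rewrite exp_0. ring.
Qed.

(** The transform solves [f' = - (x / 2) f], and [c] is its value at zero, the integral of the
    Gaussian. *)
Lemma F_gauss : exists c, 0 < c /\ forall x, F gauss x = RtoC (c * exp (- x ^ 2 / 4)).
Proof.
  set (c := intR (fun x => exp (- x ^ 2))).
  exists c. split; [apply intR_gauss_pos |].
  assert (H0 : F gauss 0 = RtoC c).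
  { unfold F, CI, RtoC, c. f_equal.
    - apply intR_ext. intros x. rewrite Rmult_0_l, cis_0. unfold gauss, Re. simpl. ring.
    - rewrite (intR_ext _ (fun x => 0 * om x)).
      + rewrite (intR_scal 1) by apply dom_om. ring.
      + intros x. rewrite Rmult_0_l, cis_0. unfold gauss, Im. simpl. ring. }
  assert (HD : forall x, is_Cderive (F gauss) x (RtoC (- x / 2) * F gauss x)%C).
  { intros x. rewrite <- F_gauss_ode.
    destruct (qW_le_om2 2 ltac:(lra)) as [K [HK1 HK2]].
    apply (F_derive (10 * exp 3 / 2 * K)); [apply gauss_Sw |].
    intros s. pose proof (gauss_W s) as G. specialize (HK2 s).
    pose proof (exp_pos 3). pose proof (qq_ge1 s). pose proof (W_pos 2 s).
    assert (W 2 s <= qq s * W 2 s) by nra.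
    apply Rle_trans with (10 * exp 3 / 2 * ((1 + s ^ 2) * (qq s * W 2 s))); [| nra].
    apply Rle_trans with ((1 + s ^ 2) * (10 * exp 3 / 2 * (qq s * W 2 s))); [| lra].
    apply Rmult_le_compat_l; [nra |]. eapply Rle_trans; [apply G |]. nra. }
  assert (HR : forall x, is_derive (fun x => Re (F gauss x)) x (- x / 2 * Re (F gauss x))).
  { intros y. destruct (HD y) as [H _].
    replace (- y / 2 * Re (F gauss y)) with (Re (RtoC (- y / 2) * F gauss y)%C)
      by (unfold Re; simpl; ring). exact H. }
  assert (HI : forall x, is_derive (fun x => Im (F gauss x)) x (- x / 2 * Im (F gauss x))).
  { intros y. destruct (HD y) as [_ H].
    replace (- y / 2 * Im (F gauss y)) with (Im (RtoC (- y / 2) * F gauss y)%C)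
      by (unfold Im; simpl; ring). exact H. }
  intros x. apply injective_projections.
  - pose proof (linear_ode _ HR x) as E. cbv beta in E. rewrite H0 in E. exact E.
  - pose proof (linear_ode _ HI x) as E. cbv beta in E. rewrite H0 in E.
    eapply eq_trans; [exact E | simpl; ring].
Qed.

Definition potential (gamma delta epsilon : C) (a a1 : C) : C :=
  (- (Ci * gamma * (Cconj a * a) + delta * (Cconj a * a1) + epsilon * (a * Cconj a1)))%C.

(** [V] is kept as a tower of its own: the decay estimates use only its bounds, and its formula
    returns when the equation is read off. The time remainder is given for every [j] because moments
    of all derivatives are estimated. *)
Theorem physical_solution alpha beta gamma delta epsilon :
  exists T c (u V : nat -> R -> R -> C), 0 < T /\ 0 < c /\ tower u /\ tower V /\
    (forall j, exists K, 0 <= K /\ forall x s t, 0 <= s <= T -> 0 <= t <= T ->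
      Cmod (u j x s - u j x t - RtoC (s - t) *
        (- (Ci * RtoC alpha * u (S (S j)) x t) - RtoC beta * u (S (S (S j))) x t
         + Pr u V j 0 0 x t)) <= K * (s - t) ^ 2) /\
    (forall x, u 0%nat x 0 = RtoC (c * exp (- x ^ 2 / 4))) /\
    (forall x t, V 0%nat x t = potential gamma delta epsilon (u 0%nat x t) (u 1%nat x t)).
Proof.
  set (M := 10 * exp 3).
  assert (HM : 0 < M) by (pose proof (exp_pos 3); unfold M; lra).
  destruct (fourier_solution alpha beta gamma delta epsilon gauss 2 M HM gauss_W gauss_Lip)
    as (T & L & L' & Ct & A & HT & HS & HL & _ & HA0 & Htime).
  destruct F_gauss as [c [Hc Hg]].
  pose proof (fun t => Sw_Ew _ _ _ (HS t)) as HE.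
  assert (H12 : 1 / 2 <= 1) by lra.
  set (Kt := fun t => Kop gamma delta epsilon (A t) (A t)).
  assert (HK : forall t, Ew 1 (8 * PI * c0 gamma delta epsilon * (M * M)) (Kt t))
    by exact (fun t => Kop_Ew gamma delta epsilon 1 M M L L _ _ H12 (HS t) (HL t) (HS t) (HL t)).
  pose proof (Ew_nonneg _ _ _ (HK 0)) as HKM.
  set (Nt := fun t => Tri gamma delta epsilon (A t) (A t) (A t)).
  assert (HN : forall t, Ew 1 (c1 gamma delta epsilon * (M * M * M)) (Nt t))
    by exact (fun t => Tri_Ew gamma delta epsilon 1 M M M L L L _ _ _ H12 (HS t) (HL t) (HS t) (HL t) (HS t) (HL t)).
  pose proof (Ew_nonneg _ _ _ (HN 0)) as HNM.
  set (u := fun j x t => F (ixin j (A t)) x).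
  set (V := fun j x t => F (ixin j (Kt t)) x).
  assert (Hu : tower u).
  { apply (F_tower A 1 M); try lra; intros; apply HE. }
  assert (HV : tower V).
  { apply (F_tower Kt 1 (8 * PI * c0 gamma delta epsilon * (M * M))); try lra; intros; apply HK. }
  assert (HtN : tower (fun j x t => F (ixin j (Nt t)) x)).
  { apply (F_tower Nt 1 (c1 gamma delta epsilon * (M * M * M))); try lra; intros; apply HN. }
  assert (Hix0 : forall f x, F (ixin 0 f) x = F f x).
  { intros f x. apply F_ext. intros s. unfold ixin. simpl. ring. }
  assert (Hix1 : forall f x, F (ixin 1 f) x = F (ixi f) x).
  { intros f x. apply F_ext. intros s. unfold ixin, ixi. simpl. ring. }
  (* Both sides are the successive derivatives of the transform of [Nt t]; uniqueness of the
     derivative replaces a Leibniz formula for convolutions. *)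
  assert (HPr : forall j x t, F (ixin j (Nt t)) x = Pr u V j 0 0 x t).
  { induction j as [| j IH]; intros x t.
    - rewrite Hix0. unfold Nt, Tri. rewrite (F_conv 1 M _ _ _ _ H12 (HS t) (HK t)). simpl. unfold u, V. now rewrite !Hix0.
    - eapply is_Cderive_unique; [apply HtN |].
      apply (is_Cderive_ext (fun y => Pr u V j 0 0 y t)); [| now apply Pr_derive].
      intros y. symmetry. apply IH. }
  exists T, c, u, V. split; [exact HT |]. split; [exact Hc |]. split; [exact Hu |]. split; [exact HV |].
  split; [| split].
  - intros j.
    destruct (ixin_weight j (1 / 4) ltac:(lra)) as [Kw [HKw1 HKw2]].
    assert (HCt : 0 <= Ct).
    { specialize (Htime T 0 0 ltac:(lra) ltac:(lra)).
      pose proof (Cmod_ge_0 (A T 0 - A 0 0 - RtoC (T - 0) *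
          (Ci * RtoC (phi alpha beta 0) * A 0 0 + Tri gamma delta epsilon (A 0) (A 0) (A 0) 0))).
      pose proof (W_pos (1 / 4) 0). assert (0 < (T - 0) ^ 2) by nra.
      assert (0 < (T - 0) ^ 2 * W (1 / 4) 0) by now apply Rmult_lt_0_compat. nra. }
    exists (2 * PI * (Ct * Kw)). split.
    { pose proof PI_RGT_0. assert (0 <= Ct * Kw) by nra. nra. }
    intros x s t Hs Ht. rewrite <- HPr. unfold u.
    assert (Dj : forall k r, exists D, Cdom D (ixin k (A r))).
    { intros k r. destruct (ixin_bound k 1 M ltac:(lra) ltac:(lra)) as [D [_ HD]].
      exists D. apply Cdom_of_weighted; [apply Ccont_ixin, HE | apply HD, HE]. }
    assert (DN : exists D, Cdom D (ixin j (Nt t))).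
    { destruct (ixin_bound j 1 (c1 gamma delta epsilon * (M * M * M)) ltac:(lra) HNM) as [D [_ HD]].
      exists D. apply Cdom_of_weighted; [apply Ccont_ixin, HN | apply HD, HN]. }
    destruct (Dj j s) as [D1 HD1]. destruct (Dj j t) as [D2 HD2].
    destruct (Dj (S (S j)) t) as [D3 HD3]. destruct (Dj (S (S (S j))) t) as [D4 HD4].
    destruct DN as [D5 HD5].
    (* The time remainder on the Fourier side times [(i y)^j]; its transform is the remainder for
       the [j]-th derivative. *)
    set (e := fun y => ixin j (fun y => A s y - A t y - RtoC (s - t) *
       (Ci * RtoC (phi alpha beta y) * A t y + Nt t y))%C y).
    assert (HF : F e x = (F (ixin j (A s)) x - F (ixin j (A t)) x - RtoC (s - t) *
        (- (Ci * RtoC alpha * F (ixin (S (S j)) (A t)) x)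
          - RtoC beta * F (ixin (S (S (S j))) (A t)) x + F (ixin j (Nt t)) x))%C).
    { rewrite (F_ext e (fun y => (ixin j (A s) y - ixin j (A t) y)
         - RtoC (s - t) * (((- (Ci * RtoC alpha)) * ixin (S (S j)) (A t) y
               - RtoC beta * ixin (S (S (S j))) (A t) y) + ixin j (Nt t) y))%C).
      - erewrite F_minus; [| apply Cdom_minus; eassumption
          | apply Cdom_scal, Cdom_plus;
            [apply Cdom_minus; apply Cdom_scal; eassumption | eassumption]].
        erewrite F_minus by eassumption.
        erewrite F_scal; [| apply Cdom_plus;
            [apply Cdom_minus; apply Cdom_scal; eassumption | eassumption]].
        erewrite F_plus; [| apply Cdom_minus; apply Cdom_scal; eassumption | eassumption].
        erewrite F_minus by (apply Cdom_scal; eassumption).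
        erewrite F_scal by eassumption. erewrite F_scal by eassumption. ring.
      - intros y. unfold e, ixin. simpl. unfold phi.
        (* [- i^2 = 1] is inserted into [y^2] and [y^3] so that the powers of [i y] hidden in [phi]
           become visible to [ring], which treats [Ci] as a variable. *)
        assert (Hi : (Ci * Ci = - RtoC 1)%C) by (apply injective_projections; simpl; ring).
        rewrite RtoC_plus, !RtoC_mult, !RtoC_pow.
        replace (RtoC y ^ 2)%C with (- (Ci * Ci) * (RtoC y * RtoC y))%C
          by (rewrite Hi; ring).
        replace (RtoC y ^ 3)%C with (- (Ci * Ci) * (RtoC y * RtoC y * RtoC y))%C
          by (rewrite Hi; ring).
        replace (Ci * (RtoC alpha * (- (Ci * Ci) * (RtoC y * RtoC y)) +
                 RtoC beta * (- (Ci * Ci) * (RtoC y * RtoC y * RtoC y))) * A t y)%C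
          with (Ci * (RtoC alpha * (- (Ci * Ci) * (RtoC y * RtoC y))) * A t y
             - (Ci * Ci * Ci) * (RtoC beta * (RtoC y * RtoC y * RtoC y)) * A t y)%C by ring.
        ring. }
    rewrite <- HF.
    replace (2 * PI * (Ct * Kw) * (s - t) ^ 2) with (2 * PI * (Ct * (s - t) ^ 2 * Kw)) by ring.
    apply F_bound. apply Cdom_of_weighted.
    + apply Ccont_ixin. apply Ccont_minus; [apply Ccont_minus; apply HE |].
      apply Ccont_mult; [apply Ccont_const |]. apply Ccont_plus; [| apply HN].
      apply Ccont_mult; [| apply HE]. apply Ccont_mult; [apply Ccont_const |].
      apply Ccont_RtoC. intros y. apply (ex_derive_continuous (phi alpha beta)).
      unfold phi. auto_derive; auto.
    + intros y. unfold e. rewrite Cmod_ixin. specialize (HKw2 y).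
      specialize (Htime s t y Hs Ht). fold (Nt t) in Htime.
      assert (Hh : 0 <= Ct * (s - t) ^ 2) by (apply Rmult_le_pos; [auto | apply pow2_ge_0]).
      pose proof (W_pos (1 / 4) y). pose proof (qq_ge1 y).
      assert (0 <= Rabs y ^ j) by apply pow_le, Rabs_pos.
      apply Rle_trans with ((Ct * (s - t) ^ 2) * ((1 + y ^ 2) * (Rabs y ^ j * (qq y * W (1 / 4) y)))).
      * replace (Ct * (s - t) ^ 2 * ((1 + y ^ 2) * (Rabs y ^ j * (qq y * W (1 / 4) y))))
          with ((1 + y ^ 2) * (Rabs y ^ j * (Ct * (s - t) ^ 2 * (qq y * W (1 / 4) y)))) by ring.
        apply Rmult_le_compat_l; [nra |]. apply Rmult_le_compat_l; auto.
        eapply Rle_trans; [apply Htime |]. apply Rmult_le_compat_l; auto. nra.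
      * rewrite (Rmult_assoc _ Kw). now apply Rmult_le_compat_l.
  - intros x. unfold u. rewrite Hix0, <- Hg. apply F_ext, HA0.
  - intros x t. unfold V, u, potential. rewrite Hix0, Hix0, Hix1.
    assert (E1 : F (conv (tld (A t)) (A t)) x = (Cconj (F (A t) x) * F (A t) x)%C).
    { rewrite (F_conv 1 M M _ _ _ H12 (Sw_tld _ _ _ (HS t)) (HE t)).
      erewrite F_tld; [reflexivity |]. eapply Ew_dom; [exact H12 | apply HE]. }
    assert (E2 : F (conv (tld (A t)) (ixi (A t))) x = (Cconj (F (A t) x) * F (ixi (A t)) x)%C).
    { rewrite (F_conv 1 M M _ _ _ H12 (Sw_tld _ _ _ (HS t)) (Ew_ixi _ _ _ (HS t))).
      erewrite F_tld; [reflexivity |]. eapply Ew_dom; [exact H12 | apply HE]. }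
    assert (E3 : F (conv (A t) (ixi (tld (A t)))) x = (F (A t) x * Cconj (F (ixi (A t)) x))%C).
    { rewrite (F_conv 1 M M _ _ _ H12 (HS t) (Ew_ixi _ _ _ (Sw_tld _ _ _ (HS t)))).
      f_equal. rewrite <- (F_tld (2 * M)).
      - apply F_ext. intros s. unfold ixi, tld. rewrite !Cmult_conj.
        replace (Cconj Ci) with (- Ci)%C by (apply injective_projections; simpl; ring).
        replace (Cconj (RtoC (- s))) with (- RtoC s)%C by (apply injective_projections; simpl; ring).
        ring.
      - eapply Ew_dom; [exact H12 | apply Ew_ixi, HS]. }
    rewrite <- E1, <- E2, <- E3.
    assert (W1 : Ew 1 (8 * PI * (M * M)) (conv (tld (A t)) (A t)))
      by exact (conv_Ew 1 M M L _ _ H12 (Sw_tld _ _ _ (HS t)) (Lip_tld _ _ (HL t)) (HE t)).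
    assert (W2 : Ew 1 (8 * PI * (M * M)) (conv (tld (A t)) (ixi (A t))))
      by exact (conv_Ew 1 M M L _ _ H12 (Sw_tld _ _ _ (HS t)) (Lip_tld _ _ (HL t)) (Ew_ixi _ _ _ (HS t))).
    assert (W3 : Ew 1 (8 * PI * (M * M)) (conv (A t) (ixi (tld (A t)))))
      by exact (conv_Ew 1 M M L _ _ H12 (HS t) (HL t) (Ew_ixi _ _ _ (Sw_tld _ _ _ (HS t)))).
    apply (Ew_dom _ _ _ H12) in W1, W2, W3.
    unfold Kt. rewrite (F_ext _ (fun y => (- RtoC 1) * ((Ci * gamma) * conv (tld (A t)) (A t) y
       + delta * conv (tld (A t)) (ixi (A t)) y + epsilon * conv (A t) (ixi (tld (A t))) y))%C).
    + erewrite F_scal; [| apply Cdom_plus; [apply Cdom_plus |]; apply Cdom_scal; eassumption].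
      erewrite F_plus; [| apply Cdom_plus; apply Cdom_scal; eassumption | apply Cdom_scal; eassumption].
      erewrite F_plus; [| apply Cdom_scal; eassumption | apply Cdom_scal; eassumption].
      erewrite !F_scal by eassumption. ring.
    + intros y. unfold Kop. ring.
Qed.

(** * Energy estimates *)
(* Differentiability on [[0,T]] with a uniform remainder; the exponent [3/2] is what interpolation
   between smallness in time and decay in space leaves in [right_energy_diff]. *)
Definition diff_on (T : R) (f D : R -> R) : Prop :=
  exists K, 0 <= K /\ forall s t, 0 <= s <= T -> 0 <= t <= T ->
    Rabs (f s - f t - (s - t) * D t) <= K * (Rabs (s - t) * sqrt (Rabs (s - t))).

Lemma diff_on_derive T f D c : diff_on T f D -> 0 < c < T -> is_derive (fun t => f (cl T t)) c (D c).
Proof.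
  intros [K [HK H]] Hc. apply is_derive_Reals. intros e He.
  set (r := e / (K + 1)). assert (Hr : 0 < r) by (apply Rdiv_lt_0_compat; lra).
  assert (Hd : 0 < Rmin (Rmin c (T - c)) (r ^ 2)).
  { repeat apply Rmin_pos; try lra. now apply pow_lt. }
  exists (mkposreal _ Hd). intros h Hh0 Hh. simpl in Hh.
  assert (Rabs h < c /\ Rabs h < T - c /\ Rabs h < r ^ 2) as (h1 & h2 & h3).
  { repeat split; (eapply Rlt_le_trans; [apply Hh |]).
    - eapply Rle_trans; apply Rmin_l.
    - eapply Rle_trans; [apply Rmin_l | apply Rmin_r].
    - apply Rmin_r. }
  apply Rabs_def2 in h1, h2.
  rewrite !cl_id by lra.
  specialize (H (c + h) c ltac:(lra) ltac:(lra)).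
  replace (c + h - c) with h in H by ring.
  replace ((f (c + h) - f c) / h - D c) with ((f (c + h) - f c - h * D c) / h) by (field; auto).
  unfold Rdiv. rewrite Rabs_mult, Rabs_inv. pose proof (Rabs_pos_lt h Hh0) as Hp.
  apply Rmult_lt_reg_r with (Rabs h); auto.
  rewrite Rmult_assoc, Rinv_l by lra. rewrite Rmult_1_r.
  eapply Rle_lt_trans; [apply H |].
  assert (Hs : sqrt (Rabs h) < r).
  { rewrite <- (sqrt_pow2 r) by lra. apply sqrt_lt_1_alt. split; [lra | auto]. }
  assert (Er : r * (K + 1) = e) by (unfold r; field; lra).
  assert (Hks : K * sqrt (Rabs h) < e) by nra.
  replace (K * (Rabs h * sqrt (Rabs h))) with (K * sqrt (Rabs h) * Rabs h) by ring.
  now apply Rmult_lt_compat_r.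
Qed.

Lemma diff_on_cont T f D c : 0 < T -> diff_on T f D -> continuity_pt (fun t => f (cl T t)) c.
Proof.
  intros HT [K [HK H]] e He.
  pose proof (cl_bounds T HT) as Hcl.
  set (B := Rabs (D (cl T c)) + K + 1).
  assert (HB : 0 < B) by (unfold B; pose proof (Rabs_pos (D (cl T c))); lra).
  exists (Rmin 1 (e / B)). split; [apply Rmin_pos; [lra | now apply Rdiv_lt_0_compat] |].
  intros x [_ Hx]. simpl in *. unfold Rdist in *.
  assert (Hx1 : Rabs (x - c) < 1) by (eapply Rlt_le_trans; [apply Hx | apply Rmin_l]).
  assert (Hx2 : Rabs (x - c) < e / B) by (eapply Rlt_le_trans; [apply Hx | apply Rmin_r]).
  specialize (H (cl T x) (cl T c) (Hcl x) (Hcl c)).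
  pose proof (cl_Lip T HT x c) as HL. set (h := Rabs (cl T x - cl T c)) in *.
  assert (Hh : 0 <= h) by apply Rabs_pos.
  assert (Hs : sqrt h <= 1) by (rewrite <- sqrt_1; apply sqrt_le_1_alt; lra).
  replace (f (cl T x) - f (cl T c)) with
    ((f (cl T x) - f (cl T c) - (cl T x - cl T c) * D (cl T c)) + (cl T x - cl T c) * D (cl T c)) by ring.
  eapply Rle_lt_trans; [apply Rabs_triang |]. rewrite Rabs_mult. fold h.
  apply Rlt_div_r in Hx2; auto.
  assert (K * (h * sqrt h) <= K * h) by (apply Rmult_le_compat_l; nra).
  unfold B in *. nra.
Qed.

(** The function [f e^(- l t) - b t] is nonincreasing: its derivative is [(D - l f) e^(- l t) - b],
    where [D - l f <= b] and [e^(- l t) <= 1]. *)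
Lemma gronwall T f D l b : 0 < T -> 0 <= l -> 0 <= b -> diff_on T f D ->
  (forall t, 0 <= t <= T -> D t <= l * f t + b) ->
  forall t, 0 <= t <= T -> f t <= exp (l * t) * (f 0 + b * t).
Proof.
  intros HT Hl Hb Hf HD t Ht.
  destruct (Req_dec t 0) as [-> | Ht0]; [rewrite !Rmult_0_r, exp_0; lra |].
  (* Composition with the clamp gives two-sided continuity at the endpoints, as the mean value
     theorem requires. *)
  set (g := fun r => f (cl T r) * exp (- (l * r)) - b * r).
  set (dg := fun r => (D r - l * f (cl T r)) * exp (- (l * r)) - b).
  destruct (MVT_gen g 0 t dg) as [c [Hc E]].
  - intros x. rewrite Rmin_left, Rmax_right by lra. intros Hx. unfold g, dg.
    replace ((D x - l * f (cl T x)) * exp (- (l * x)) - b)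
      with ((D x * exp (- (l * x)) + f (cl T x) * (- l * exp (- (l * x)))) - b) by ring.
    apply (is_derive_minus (fun r => f (cl T r) * exp (- (l * r))) (fun r => b * r)).
    + apply (is_derive_mult (fun r => f (cl T r)) (fun r => exp (- (l * r)))).
      * apply diff_on_derive; auto; lra.
      * auto_derive; auto. ring.
      * intros; apply Rmult_comm.
    + auto_derive; auto. ring.
  - intros x _. unfold g.
    apply (continuity_pt_minus (fun r => f (cl T r) * exp (- (l * r))) (fun r => b * r)).
    + apply (continuity_pt_mult (fun r => f (cl T r)) (fun r => exp (- (l * r)))).
      * eapply diff_on_cont; eauto; lra.
      * apply continuity_pt_filterlim, (ex_derive_continuous (fun r => exp (- (l * r)))). auto_derive; auto.
    + apply continuity_pt_filterlim, (ex_derive_continuous (fun r => b * r)). auto_derive; auto.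
  - rewrite Rmin_left, Rmax_right in Hc by lra.
    assert (Hdg : dg c <= 0).
    { unfold dg. rewrite cl_id by lra. specialize (HD c ltac:(lra)).
      assert (exp (- (l * c)) <= 1) by (rewrite <- exp_0; apply exp_le; nra).
      pose proof (exp_pos (- (l * c))). nra. }
    assert (Hg : g t <= g 0) by nra.
    unfold g in Hg. rewrite !cl_id in Hg by lra.
    rewrite !Rmult_0_r, Ropp_0, exp_0 in Hg.
    assert (E1 : exp (l * t) * exp (- (l * t)) = 1) by (rewrite <- exp_plus, Rplus_opp_r; apply exp_0).
    pose proof (exp_pos (l * t)).
    replace (f t) with (exp (l * t) * (f t * exp (- (l * t)))).
    + apply Rmult_le_compat_l; lra.
    + replace (exp (l * t) * (f t * exp (- (l * t)))) with (f t * (exp (l * t) * exp (- (l * t)))) by ring.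
      rewrite E1. ring.
Qed.

(** Differentiation under the integral: the remainder has to be small in time and integrable in [x]
    simultaneously. *)
Lemma intR_diff_on T (f g : R -> R -> R) K : 0 <= K ->
  (forall t, 0 <= t <= T -> exists M, dom M (fun x => f x t)) ->
  (forall t, 0 <= t <= T -> exists M, dom M (fun x => g x t)) ->
  (forall s t x, 0 <= s <= T -> 0 <= t <= T ->
     Rabs (f x s - f x t - (s - t) * g x t) <= K * (Rabs (s - t) * sqrt (Rabs (s - t))) * om x) ->
  diff_on T (fun t => intR (fun x => f x t)) (fun t => intR (fun x => g x t)).
Proof.
  intros HK Hf Hg H. exists (PI * K). split; [pose proof PI_RGT_0; nra |].
  intros s t Hs Ht.
  destruct (Hf s Hs) as [M1 D1]. destruct (Hf t Ht) as [M2 D2]. destruct (Hg t Ht) as [M3 D3].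
  assert (D12 : dom (M1 + Rabs (-1) * M2) (fun x => f x s - f x t)).
  { apply (dom_ext _ (fun x => f x s + (-1) * f x t)); [intros; ring |].
    apply dom_plus; auto. now apply dom_scal. }
  rewrite <- (intR_minus M1 M2), <- (intR_scal M3) by auto.
  rewrite <- (intR_minus (M1 + Rabs (-1) * M2) (Rabs (s - t) * M3)); auto; [| now apply dom_scal].
  rewrite Rmult_assoc. apply intR_bound. split.
  - intros x. apply (continuous_minus (fun x => f x s - f x t) (fun x => (s - t) * g x t)).
    + apply D12.
    + apply (dom_scal _ _ (s - t) D3).
  - intros x. now apply H.
Qed.

Lemma Cont_derive f df : (forall x, is_Cderive f x (df x)) -> Ccont f.
Proof.
  intros H; split; intros x.
  - apply (ex_derive_continuous (fun y => Re (f y))). exists (Re (df x)). exact (proj1 (H x)).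
  - apply (ex_derive_continuous (fun y => Im (f y))). exists (Im (df x)). exact (proj2 (H x)).
Qed.

Definition N2 (z : C) : R := Re z ^ 2 + Im z ^ 2.

Lemma N2_Cmod z : N2 z = Cmod z ^ 2.
Proof. unfold N2. now rewrite Cmod_sqr. Qed.

Lemma N2_pos z : 0 <= N2 z.
Proof. unfold N2. nra. Qed.

Definition cross (z z1 : C) : R := Re z * Im z1 - Im z * Re z1.

Lemma cross_le z z1 : Rabs (cross z z1) <= Cmod z * Cmod z1.
Proof.
  unfold cross. rewrite <- (Cmod_conj z), <- Cmod_mult.
  eapply Rle_trans; [| apply Im_le_Cmod]. right. f_equal. unfold Re, Im. simpl. ring.
Qed.

(** The derivative of the energy flux, split into real and imaginary parts for automatic
    differentiation. In the dispersive part all terms with second derivatives of the solution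
    cancel. *)
Lemma flux_derive_real (al be : R) (w w1 w2 a b a1 b1 a2 b2 : R -> R) (x w3 a3 b3 : R) :
  is_derive w x (w1 x) -> is_derive w1 x (w2 x) -> is_derive w2 x w3 ->
  is_derive a x (a1 x) -> is_derive a1 x (a2 x) -> is_derive a2 x a3 ->
  is_derive b x (b1 x) -> is_derive b1 x (b2 x) -> is_derive b2 x b3 ->
  is_derive (fun x =>
    - be * (w x * (2 * (a x * a2 x + b x * b2 x) - (a1 x ^ 2 + b1 x ^ 2))
            - 2 * (w1 x * (a x * a1 x + b x * b1 x)) + w2 x * (a x ^ 2 + b x ^ 2))
    + 2 * al * (w x * (a x * b1 x - b x * a1 x))) x
   (- be * (2 * w x * (a x * a3 + b x * b3) - 3 * (w1 x * (a1 x ^ 2 + b1 x ^ 2)) + w3 * (a x ^ 2 + b x ^ 2))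
    + 2 * al * (w1 x * (a x * b1 x - b x * a1 x) + w x * (a x * b2 x - b x * a2 x))).
Proof.
  intros A1 A2 A3 A4 A5 A6 A7 A8 A9.
  auto_derive.
  - repeat split; eexists; eassumption.
  - assert (E1 : Derive (fun y : R => w y) x = w1 x) by (apply is_derive_unique; exact A1).
    assert (E2 : Derive (fun y : R => w1 y) x = w2 x) by (apply is_derive_unique; exact A2).
    assert (E3 : Derive (fun y : R => w2 y) x = w3) by (apply is_derive_unique; exact A3).
    assert (E4 : Derive (fun y : R => a y) x = a1 x) by (apply is_derive_unique; exact A4).
    assert (E5 : Derive (fun y : R => a1 y) x = a2 x) by (apply is_derive_unique; exact A5).
    assert (E6 : Derive (fun y : R => a2 y) x = a3) by (apply is_derive_unique; exact A6).
    assert (E7 : Derive (fun y : R => b y) x = b1 x) by (apply is_derive_unique; exact A7).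
    assert (E8 : Derive (fun y : R => b1 y) x = b2 x) by (apply is_derive_unique; exact A8).
    assert (E9 : Derive (fun y : R => b2 y) x = b3) by (apply is_derive_unique; exact A9).
    rewrite E1, E2, E3, E4, E5, E6, E7, E8, E9. ring.
Qed.

(** * The weighted energy identity *)

Section Flux.
Context (alpha beta : R) (w w1 w2 w3 : R -> R) (v v1 v2 v3 P : R -> C) (m : R -> R) (K : R).
Context (Hw : forall x, is_derive w x (w1 x)) (Hw1 : forall x, is_derive w1 x (w2 x))
  (Hw2 : forall x, is_derive w2 x (w3 x)) (Hw3 : forall x, continuous w3 x).
Context (Hv : forall x, is_Cderive v x (v1 x)) (Hv1 : forall x, is_Cderive v1 x (v2 x))
  (Hv2 : forall x, is_Cderive v2 x (v3 x)) (Hv3 : Ccont v3) (HP : Ccont P).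
Context (Bv : forall x, Cmod (v x) <= m x) (Bv1 : forall x, Cmod (v1 x) <= m x)
  (Bv2 : forall x, Cmod (v2 x) <= m x) (Bv3 : forall x, Cmod (v3 x) <= m x)
  (BP : forall x, Cmod (P x) <= m x).
Context (Bw : forall x, Rabs (w x) * m x ^ 2 <= K * om x) (Bw1 : forall x, Rabs (w1 x) * m x ^ 2 <= K * om x)
  (Bw2 : forall x, Rabs (w2 x) * m x ^ 2 <= K * om x) (Bw3 : forall x, Rabs (w3 x) * m x ^ 2 <= K * om x).

Definition flux_lhs (x : R) : R :=
  w x * (2 * Re (Cconj (v x) * (- (Ci * RtoC alpha * v2 x) - RtoC beta * v3 x + P x))%C).

Definition flux_rhs (x : R) : R :=
  - 3 * beta * (w1 x * N2 (v1 x)) + beta * (w3 x * N2 (v x))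
  - 2 * alpha * (w1 x * cross (v x) (v1 x)) + w x * (2 * Re (Cconj (v x) * P x)%C).

Definition flux_G (x : R) : R :=
  - beta * (w x * (2 * (Re (v x) * Re (v2 x) + Im (v x) * Im (v2 x)) - (Re (v1 x) ^ 2 + Im (v1 x) ^ 2))
            - 2 * (w1 x * (Re (v x) * Re (v1 x) + Im (v x) * Im (v1 x)))
            + w2 x * (Re (v x) ^ 2 + Im (v x) ^ 2))
  + 2 * alpha * (w x * (Re (v x) * Im (v1 x) - Im (v x) * Re (v1 x))).

Lemma flux_G_derive x : is_derive flux_G x (flux_lhs x - flux_rhs x).
Proof.
  destruct (Hv x) as [A1 A2]. destruct (Hv1 x) as [A3 A4]. destruct (Hv2 x) as [A5 A6].
  pose proof (flux_derive_real alpha beta w w1 w2 (fun x => Re (v x)) (fun x => Im (v x))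
    (fun x => Re (v1 x)) (fun x => Im (v1 x)) (fun x => Re (v2 x)) (fun x => Im (v2 x))
    x (w3 x) (Re (v3 x)) (Im (v3 x)) (Hw x) (Hw1 x) (Hw2 x) A1 A3 A5 A2 A4 A6) as H.
  unfold flux_G. eapply is_derive_ext; [| eapply (eq_ind _ (fun l => is_derive _ x l) H)].
  - reflexivity.
  - unfold flux_lhs, flux_rhs, N2, cross, Re, Im. simpl. ring.
Qed.

Lemma weighted_dom (g h : R -> R) B : (forall x, continuous g x) -> (forall x, continuous h x) ->
  0 <= B -> (forall x, Rabs (g x) * m x ^ 2 <= K * om x) -> (forall x, Rabs (h x) <= B * m x ^ 2) ->
  dom (B * K) (fun x => g x * h x).
Proof.
  intros Hg Hh HB H1 H2. split; intros x.
  - apply (continuous_mult g h); auto.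
  - rewrite Rabs_mult. specialize (H1 x). specialize (H2 x). pose proof (Rabs_pos (g x)).
    apply Rle_trans with (Rabs (g x) * (B * m x ^ 2)); [now apply Rmult_le_compat_l |].
    replace (Rabs (g x) * (B * m x ^ 2)) with (B * (Rabs (g x) * m x ^ 2)) by ring.
    rewrite Rmult_assoc. now apply Rmult_le_compat_l.
Qed.

Lemma Re_conj_cont f g : Ccont f -> Ccont g -> forall x, continuous (fun x => 2 * Re (Cconj (f x) * g x)%C) x.
Proof.
  intros Hf Hg x. apply (continuous_scal_r 2 (fun x => Re (Cconj (f x) * g x)%C)).
  exact (proj1 (Ccont_mult _ _ (Ccont_conj f Hf) Hg) x).
Qed.

Lemma Re_conj_le z z1 : Rabs (2 * Re (Cconj z * z1)%C) <= 2 * (Cmod z * Cmod z1).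
Proof.
  rewrite Rabs_mult, (Rabs_pos_eq 2) by lra. apply Rmult_le_compat_l; [lra |].
  eapply Rle_trans; [apply Re_le_Cmod |]. rewrite Cmod_mult, Cmod_conj. lra.
Qed.

Lemma N2_cont f : Ccont f -> forall x, continuous (fun x => N2 (f x)) x.
Proof.
  intros Hf x. apply (continuous_ext (fun x => Re (Cconj (f x) * f x)%C)).
  - intros y. unfold N2, Re, Im. simpl. ring.
  - exact (proj1 (Ccont_mult _ _ (Ccont_conj f Hf) Hf) x).
Qed.

Lemma flux_w_cont : (forall x, continuous w x) /\ (forall x, continuous w1 x).
Proof.
  split; intros x.
  - apply (ex_derive_continuous w). eexists; apply Hw.
  - apply (ex_derive_continuous w1). eexists; apply Hw1.
Qed.

Lemma flux_terms_dom :
  dom K (fun x => w1 x * N2 (v1 x)) /\ dom K (fun x => w3 x * N2 (v x)) /\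
  dom K (fun x => w1 x * cross (v x) (v1 x)) /\ dom (2 * K) (fun x => w x * (2 * Re (Cconj (v x) * P x)%C)).
Proof.
  destruct flux_w_cont as [Cw Cw1].
  assert (E : forall f, (forall x, Cmod (f x) <= m x) -> forall x, Rabs (N2 (f x)) <= 1 * m x ^ 2).
  { intros f Hf x. rewrite Rabs_pos_eq by apply N2_pos. rewrite N2_Cmod, Rmult_1_l.
    apply pow_incr. split; [apply Cmod_ge_0 | apply Hf]. }
  split; [| split; [| split]].
  - rewrite <- (Rmult_1_l K). apply weighted_dom; auto; try lra.
    apply N2_cont, (Cont_derive v1 v2 Hv1).
  - rewrite <- (Rmult_1_l K). apply weighted_dom; auto; try lra.
    apply N2_cont, (Cont_derive v v1 Hv).
  - rewrite <- (Rmult_1_l K). apply weighted_dom; auto; try lra.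
    + intros x. apply (continuous_ext (fun x => Im (Cconj (v x) * v1 x)%C)).
      * intros y. unfold cross, Re, Im. simpl. ring.
      * exact (proj2 (Ccont_mult _ _ (Ccont_conj v (Cont_derive v v1 Hv)) (Cont_derive v1 v2 Hv1)) x).
    + intros x. eapply Rle_trans; [apply cross_le |]. rewrite Rmult_1_l. simpl. rewrite Rmult_1_r.
      apply Rmult_le_compat; auto using Cmod_ge_0.
  - apply weighted_dom; auto; try lra.
    + apply Re_conj_cont; auto. apply (Cont_derive v v1 Hv).
    + intros x. eapply Rle_trans; [apply Re_conj_le |]. apply Rmult_le_compat_l; [lra |].
      simpl. rewrite Rmult_1_r. apply Rmult_le_compat; auto using Cmod_ge_0.
Qed.

Lemma flux_rhs_dom : exists M, dom M flux_rhs.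
Proof.
  destruct flux_terms_dom as (D1 & D2 & D3 & D4).
  eexists. unfold flux_rhs.
  apply (dom_ext _ (fun x => ((- 3 * beta) * (w1 x * N2 (v1 x)) + beta * (w3 x * N2 (v x)))
    + ((- 2 * alpha) * (w1 x * cross (v x) (v1 x)) + w x * (2 * Re (Cconj (v x) * P x)%C))));
    [intros; ring |].
  apply dom_plus; apply dom_plus; try apply dom_scal; eassumption.
Qed.

Lemma flux_lhs_dom : exists M, dom M flux_lhs.
Proof.
  destruct flux_w_cont as [Cw Cw1].
  exists (2 * (Rabs alpha + Rabs beta + 1) * K). unfold flux_lhs.
  pose proof (Rabs_pos alpha). pose proof (Rabs_pos beta).
  apply weighted_dom; auto; try lra.
  - apply Re_conj_cont; [apply (Cont_derive v v1 Hv) |].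
    apply Ccont_plus; auto. apply Ccont_minus.
    + apply Ccont_opp, Ccont_mult; [apply Ccont_const | apply (Cont_derive v2 v3 Hv2)].
    + apply Ccont_mult; [apply Ccont_const | auto].
  - intros x. eapply Rle_trans; [apply Re_conj_le |].
    assert (B : Cmod (- (Ci * RtoC alpha * v2 x) - RtoC beta * v3 x + P x) <= (Rabs alpha + Rabs beta + 1) * m x).
    { eapply Rle_trans; [apply Cmod_triangle |].
      eapply Rle_trans; [apply Rplus_le_compat_r, Cmod_minus_le |].
      rewrite Cmod_opp, !Cmod_mult, Cmod_Ci, !Cmod_R, Rmult_1_l.
      pose proof (Bv2 x). pose proof (Bv3 x). pose proof (BP x). nra. }
    replace (2 * (Rabs alpha + Rabs beta + 1) * m x ^ 2)
      with (2 * (m x * ((Rabs alpha + Rabs beta + 1) * m x))) by ring.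
    apply Rmult_le_compat_l; [lra |]. apply Rmult_le_compat; auto using Cmod_ge_0.
Qed.

Lemma flux_G_bound : exists N, forall x, Rabs (flux_G x) <= N * om x.
Proof.
  exists ((Rabs beta * 12 + 2 * Rabs alpha * 2) * K). intros x. unfold flux_G.
  assert (E : forall f : R -> C, (forall x, Cmod (f x) <= m x) -> Rabs (Re (f x)) <= m x /\ Rabs (Im (f x)) <= m x).
  { intros f Hf. split; (eapply Rle_trans; [| apply Hf]); [apply Re_le_Cmod | apply Im_le_Cmod]. }
  destruct (E v Bv) as [e1 e2]. destruct (E v1 Bv1) as [e3 e4]. destruct (E v2 Bv2) as [e5 e6].
  assert (Pd : forall a b, Rabs a <= m x -> Rabs b <= m x -> Rabs (a * b) <= m x ^ 2).
  { intros a b Ha Hb. rewrite Rabs_mult. simpl. rewrite Rmult_1_r.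
    apply Rmult_le_compat; auto using Rabs_pos. }
  assert (Pw : forall g h c, Rabs g * m x ^ 2 <= K * om x -> 0 <= c -> Rabs h <= c * m x ^ 2 -> Rabs (g * h) <= c * (K * om x)).
  { intros g h c Hg Hc Hh. rewrite Rabs_mult. pose proof (Rabs_pos g).
    apply Rle_trans with (Rabs g * (c * m x ^ 2)); [now apply Rmult_le_compat_l |]. nra. }
  set (p1 := Re (v x) * Re (v2 x)). set (p2 := Im (v x) * Im (v2 x)).
  set (p3 := Re (v x) * Re (v1 x)). set (p4 := Im (v x) * Im (v1 x)).
  set (p5 := Re (v x) * Im (v1 x)). set (p6 := Im (v x) * Re (v1 x)).
  assert (b1 : Rabs p1 <= m x ^ 2) by now apply Pd. assert (b2 : Rabs p2 <= m x ^ 2) by now apply Pd.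
  assert (b3 : Rabs p3 <= m x ^ 2) by now apply Pd. assert (b4 : Rabs p4 <= m x ^ 2) by now apply Pd.
  assert (b5 : Rabs p5 <= m x ^ 2) by now apply Pd. assert (b6 : Rabs p6 <= m x ^ 2) by now apply Pd.
  assert (q1 : Rabs (Re (v1 x) ^ 2) <= m x ^ 2) by (replace (Re (v1 x) ^ 2) with (Re (v1 x) * Re (v1 x)) by ring; now apply Pd).
  assert (q2 : Rabs (Im (v1 x) ^ 2) <= m x ^ 2) by (replace (Im (v1 x) ^ 2) with (Im (v1 x) * Im (v1 x)) by ring; now apply Pd).
  assert (q3 : Rabs (Re (v x) ^ 2) <= m x ^ 2) by (replace (Re (v x) ^ 2) with (Re (v x) * Re (v x)) by ring; now apply Pd).
  assert (q4 : Rabs (Im (v x) ^ 2) <= m x ^ 2) by (replace (Im (v x) ^ 2) with (Im (v x) * Im (v x)) by ring; now apply Pd).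
  apply Rabs_le_between in b1, b2, b3, b4, b5, b6, q1, q2, q3, q4.
  assert (X1 : Rabs (w x * (2 * (p1 + p2) - (Re (v1 x) ^ 2 + Im (v1 x) ^ 2))) <= 6 * (K * om x))
    by (apply Pw; auto; [lra | apply Rabs_le; lra]).
  assert (X2 : Rabs (w1 x * (p3 + p4)) <= 2 * (K * om x))
    by (apply Pw; auto; [lra | apply Rabs_le; lra]).
  assert (X3 : Rabs (w2 x * (Re (v x) ^ 2 + Im (v x) ^ 2)) <= 2 * (K * om x))
    by (apply Pw; auto; [lra | apply Rabs_le; lra]).
  assert (X4 : Rabs (w x * (p5 - p6)) <= 2 * (K * om x))
    by (apply Pw; auto; [lra | apply Rabs_le; lra]).
  eapply Rle_trans; [apply Rabs_triang |]. rewrite (Rabs_mult (- beta)), Rabs_Ropp, (Rabs_mult (2 * alpha)), (Rabs_mult 2), (Rabs_pos_eq 2) by lra.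
  assert (Rabs (w x * (2 * (p1 + p2) - (Re (v1 x) ^ 2 + Im (v1 x) ^ 2)) - 2 * (w1 x * (p3 + p4))
            + w2 x * (Re (v x) ^ 2 + Im (v x) ^ 2)) <= 12 * (K * om x)).
  { apply Rabs_le_between in X1, X2, X3. apply Rabs_le. lra. }
  pose proof (Rabs_pos beta). pose proof (Rabs_pos alpha).
  replace ((Rabs beta * 12 + 2 * Rabs alpha * 2) * K * om x)
    with (Rabs beta * (12 * (K * om x)) + 2 * Rabs alpha * (2 * (K * om x))) by ring.
  apply Rplus_le_compat; apply Rmult_le_compat_l; auto; lra.
Qed.

(** The two integrands differ by the derivative of [flux_G]. The majorant [m] covers two regimes: a
    bounded [v] with integrable weights, and a rapidly decreasing [v] with weights that are only
    bounded. *)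
Lemma flux_identity : intR flux_lhs = intR flux_rhs.
Proof.
  destruct flux_lhs_dom as [M1 D1]. destruct flux_rhs_dom as [M2 D2]. destruct flux_G_bound as [N HN].
  assert (E : intR (fun x => flux_lhs x - flux_rhs x) = 0).
  { apply (intR_deriv_zero (M1 + Rabs (-1) * M2) N flux_G); auto; [apply flux_G_derive |].
    apply (dom_ext _ (fun x => flux_lhs x + (-1) * flux_rhs x)); [intros; ring |].
    apply dom_plus; auto. now apply dom_scal. }
  rewrite (intR_minus M1 M2) in E by auto. lra.
Qed.

End Flux.

(** * Truncated polynomial weights *)
(** The logarithm of the square root of [(1 + x^2) / (1 + d x^2)], which grows like [|x|] up to
    [1 / sqrt d] and is bounded. In logarithmic form every derivative of [wt] is [wt] times a
    polynomial in logarithmic derivatives. *)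
Definition lpsi (d x : R) : R := (ln (1 + x ^ 2) - ln (1 + d * x ^ 2)) / 2.
Definition psi (d x : R) : R := exp (lpsi d x).
Definition wt (m : nat) (d x : R) : R := exp (INR m * lpsi d x) * om x.

(** Half the derivative of [ln (1 + e x^2)]; [pr1] and [pr2] are its next derivatives. Thus [lam0]
    is the logarithmic derivative of [wt]. *)
Definition pr0 (e x : R) : R := e * x / (1 + e * x ^ 2).
Definition pr1 (e x : R) : R := e * (1 - e * x ^ 2) / (1 + e * x ^ 2) ^ 2.
Definition pr2 (e x : R) : R := - 2 * e ^ 2 * x * (3 - e * x ^ 2) / (1 + e * x ^ 2) ^ 3.

Definition lam0 (m : nat) (d x : R) : R := INR m * (pr0 1 x - pr0 d x) - 2 * pr0 1 x.
Definition lam1 (m : nat) (d x : R) : R := INR m * (pr1 1 x - pr1 d x) - 2 * pr1 1 x.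
Definition lam2 (m : nat) (d x : R) : R := INR m * (pr2 1 x - pr2 d x) - 2 * pr2 1 x.

Lemma le1_of_sq y : y ^ 2 <= 1 -> y <= 1.
Proof. intros H. nra. Qed.

(** A factor [1 / q] is gained uniformly in [e]: with [z = 1 + e x^2], both [e x^2] and [e q^2] are
    at most [z]. *)
Lemma pr_bounds e x q : 0 < e <= 1 -> 0 <= q -> q ^ 2 <= 1 + x ^ 2 ->
  Rabs (pr0 e x) * q <= 1 /\ Rabs (pr1 e x) * q <= 1 /\ Rabs (pr2 e x) * q <= 6.
Proof.
  intros He Hq Hqx. set (z := 1 + e * x ^ 2).
  assert (Hz : 1 <= z) by (unfold z; pose proof (pow2_ge_0 x); nra).
  assert (Hez : e * (1 + x ^ 2) <= z) by (unfold z; nra).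
  assert (Hzi : z * / z = 1) by (field; lra).
  assert (Hi : 0 < / z) by (apply Rinv_0_lt_compat; lra).
  assert (A0 : Rabs (pr0 e x) * q <= 1).
  { apply le1_of_sq. rewrite Rpow_mult_distr, pow2_abs.
    replace (pr0 e x ^ 2) with ((e * (e * x ^ 2)) * (/ z) ^ 2) by (unfold pr0; fold z; field; lra).
    assert (e * (e * x ^ 2) * q ^ 2 <= z * z).
    { replace (e * (e * x ^ 2) * q ^ 2) with ((e * x ^ 2) * (e * q ^ 2)) by ring.
      apply Rmult_le_compat; nra. }
    replace 1 with (z * z * (/ z) ^ 2) by (field; lra).
    replace (e * (e * x ^ 2) * (/ z) ^ 2 * q ^ 2) with (e * (e * x ^ 2) * q ^ 2 * (/ z) ^ 2) by ring.
    apply Rmult_le_compat_r; [apply pow2_ge_0 | auto]. }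
  split; [auto |]. split.
  - apply Rle_trans with (e * / z * q).
    + apply Rmult_le_compat_r; auto.
      replace (pr1 e x) with ((e * / z) * ((1 - e * x ^ 2) * / z)) by (unfold pr1; fold z; field; lra).
      rewrite Rabs_mult, (Rabs_pos_eq (e * / z)) by nra.
      rewrite <- (Rmult_1_r (e * / z)) at 2. apply Rmult_le_compat_l; [nra |].
      rewrite Rabs_mult, (Rabs_pos_eq (/ z)) by lra.
      apply Rle_trans with (z * / z); [| lra].
      apply Rmult_le_compat_r; [lra |]. apply Rabs_le. unfold z. nra.
    + apply le1_of_sq.
      replace ((e * / z * q) ^ 2) with (e * (e * q ^ 2) * (/ z) ^ 2) by ring.
      replace 1 with (z * z * (/ z) ^ 2) by (field; lra).
      apply Rmult_le_compat_r; [apply pow2_ge_0 |]. apply Rmult_le_compat; nra.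
  - apply Rle_trans with (6 * (Rabs (pr0 e x) * q)); [| lra].
    rewrite <- Rmult_assoc. apply Rmult_le_compat_r; auto.
    replace (pr2 e x) with (pr0 e x * (-2 * e * / z * ((3 - e * x ^ 2) * / z)))
      by (unfold pr2, pr0; fold z; field; lra).
    rewrite Rabs_mult, Rmult_comm. apply Rmult_le_compat_r; [apply Rabs_pos |].
    assert (B1 : Rabs ((3 - e * x ^ 2) * / z) <= 3).
    { rewrite Rabs_mult, (Rabs_pos_eq (/ z)) by lra.
      apply Rle_trans with (3 * z * / z); [| rewrite Rmult_assoc, Hzi; lra].
      apply Rmult_le_compat_r; [lra |]. apply Rabs_le. unfold z. nra. }
    rewrite !Rabs_mult, (Rabs_pos_eq (/ z)), (Rabs_pos_eq e) in * by lra.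
    replace (Rabs (-2)) with 2 by (rewrite Rabs_left; lra).
    pose proof (Rabs_pos (3 - e * x ^ 2)).
    assert (0 <= Rabs (3 - e * x ^ 2) * / z) by nra.
    assert (2 * e * / z <= 2) by nra. nra.
Qed.

Lemma psi_sq d x : 0 < d -> psi d x ^ 2 * (1 + d * x ^ 2) = 1 + x ^ 2.
Proof.
  intros Hd. pose proof (pow2_ge_0 x).
  assert (H1 : 0 < 1 + d * x ^ 2) by nra. assert (H2 : 0 < 1 + x ^ 2) by lra.
  unfold psi. replace (exp (lpsi d x) ^ 2) with (exp (lpsi d x) * exp (lpsi d x)) by ring.
  assert (E : exp (lpsi d x) * exp (lpsi d x) = exp (ln (1 + x ^ 2)) * exp (- ln (1 + d * x ^ 2)))
    by (rewrite <- !exp_plus; f_equal; unfold lpsi; field).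
  rewrite E, exp_Ropp, !exp_ln by auto. field. lra.
Qed.

Lemma psi_pos d x : 0 < psi d x.
Proof. apply exp_pos. Qed.

Lemma psi_sq_le d x : 0 < d -> psi d x ^ 2 <= 1 + x ^ 2.
Proof.
  intros Hd. pose proof (psi_sq d x Hd).
  assert (0 <= psi d x ^ 2 * (d * x ^ 2))
    by (apply Rmult_le_pos; [apply pow2_ge_0 | pose proof (pow2_ge_0 x); nra]).
  lra.
Qed.

Lemma psi_ge1 d x : 0 < d <= 1 -> 1 <= psi d x.
Proof.
  intros Hd. pose proof (psi_sq d x ltac:(lra)) as H. pose proof (psi_pos d x).
  destruct (Rle_lt_dec 1 (psi d x)); auto. exfalso.
  assert (psi d x ^ 2 < 1) by nra. assert (1 + d * x ^ 2 <= 1 + x ^ 2) by nra.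
  nra.
Qed.

Lemma psi_le_inv d x : 0 < d <= 1 -> psi d x <= / d.
Proof.
  intros Hd. pose proof (psi_sq d x ltac:(lra)) as H.
  assert (d * psi d x ^ 2 <= 1).
  {
    nra. }
  apply Rmult_le_reg_l with d; [lra |]. rewrite Rinv_r by lra. nra.
Qed.

Lemma psi_le_qq d x : 0 < d -> psi d x <= qq x.
Proof.
  intros Hd. pose proof (psi_sq_le d x Hd).
  unfold qq. pose proof (Rabs_pos x). pose proof (pow2_abs x). nra.
Qed.

Lemma wt_psi m d x : wt m d x = psi d x ^ m * om x.
Proof.
  unfold wt, psi. f_equal. induction m as [| m IH].
  - simpl. now rewrite Rmult_0_l, exp_0.
  - rewrite S_INR, Rmult_plus_distr_r, Rmult_1_l, exp_plus, IH. simpl. ring.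
Qed.

Lemma wt_S m d x : wt (S m) d x = wt m d x * psi d x.
Proof. rewrite !wt_psi. simpl. ring. Qed.

Lemma wt_pos m d x : 0 < wt m d x.
Proof. apply Rmult_lt_0_compat; [apply exp_pos | apply om_pos]. Qed.

Lemma wt_le_om m d x : 0 < d <= 1 -> wt m d x <= (/ d) ^ m * om x.
Proof.
  intros Hd. rewrite wt_psi. apply Rmult_le_compat_r; [left; apply om_pos |].
  apply pow_incr. split; [left; apply psi_pos | now apply psi_le_inv].
Qed.

Lemma wt_le_qq m d x : 0 < d -> wt m d x <= qq x ^ m * om x.
Proof.
  intros Hd. rewrite wt_psi. apply Rmult_le_compat_r; [left; apply om_pos |].
  apply pow_incr. split; [left; apply psi_pos | now apply psi_le_qq].
Qed.

Definition wt1 m d x := wt m d x * lam0 m d x.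
Definition wt2 m d x := wt m d x * (lam1 m d x + lam0 m d x ^ 2).
Definition wt3 m d x := wt m d x * (lam2 m d x + 3 * lam0 m d x * lam1 m d x + lam0 m d x ^ 3).

Lemma pr0_derive e x : 0 < e -> is_derive (pr0 e) x (pr1 e x).
Proof.
  intros He. unfold pr0, pr1. assert (0 < 1 + e * x ^ 2) by (pose proof (pow2_ge_0 x); nra).
  auto_derive; [lra |]. field. lra.
Qed.

Lemma pr1_derive e x : 0 < e -> is_derive (pr1 e) x (pr2 e x).
Proof.
  intros He. unfold pr1, pr2. assert (H : 0 < 1 + e * x ^ 2) by (pose proof (pow2_ge_0 x); nra).
  auto_derive; [| field; lra].
  replace ((1 + e * (x * (x * 1))) * ((1 + e * (x * (x * 1))) * 1)) with ((1 + e * x ^ 2) ^ 2) by ring.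
  apply pow_nonzero; lra.
Qed.

Lemma lam0_derive m d x : 0 < d -> is_derive (lam0 m d) x (lam1 m d x).
Proof.
  intros Hd. unfold lam0, lam1.
  pose proof (pr0_derive 1 x ltac:(lra)) as H1. pose proof (pr0_derive d x Hd) as H2.
  apply (is_derive_minus (fun x => INR m * (pr0 1 x - pr0 d x)) (fun x => 2 * pr0 1 x)).
  - apply (is_derive_scal (fun x => pr0 1 x - pr0 d x)), (is_derive_minus (pr0 1) (pr0 d)); auto.
  - now apply (is_derive_scal (pr0 1)).
Qed.

Lemma lam1_derive m d x : 0 < d -> is_derive (lam1 m d) x (lam2 m d x).
Proof.
  intros Hd. unfold lam1, lam2.
  pose proof (pr1_derive 1 x ltac:(lra)) as H1. pose proof (pr1_derive d x Hd) as H2.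
  apply (is_derive_minus (fun x => INR m * (pr1 1 x - pr1 d x)) (fun x => 2 * pr1 1 x)).
  - apply (is_derive_scal (fun x => pr1 1 x - pr1 d x)), (is_derive_minus (pr1 1) (pr1 d)); auto.
  - now apply (is_derive_scal (pr1 1)).
Qed.

Lemma lpsi_derive d x : 0 < d -> is_derive (lpsi d) x (pr0 1 x - pr0 d x).
Proof.
  intros Hd. unfold lpsi, pr0. pose proof (pow2_ge_0 x).
  assert (0 < 1 + d * x ^ 2) by nra.
  auto_derive; [simpl in *; repeat split; lra |]. field. split; lra.
Qed.

Lemma om_derive x : is_derive om x (- 2 * pr0 1 x * om x).
Proof.
  unfold om, pr0. assert (0 < 1 + x ^ 2) by (pose proof (pow2_ge_0 x); lra).
  auto_derive; [simpl in *; lra |]. field. lra.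
Qed.

Lemma wt_derive m d x : 0 < d -> is_derive (wt m d) x (wt1 m d x).
Proof.
  intros Hd. unfold wt.
  replace (wt1 m d x) with
    ((INR m * (pr0 1 x - pr0 d x)) * exp (INR m * lpsi d x) * om x
      + exp (INR m * lpsi d x) * (- 2 * pr0 1 x * om x)) by (unfold wt1, wt, lam0; ring).
  apply (is_derive_mult (fun x => exp (INR m * lpsi d x)) om).
  - apply (is_derive_comp exp (fun x => INR m * lpsi d x)).
    + apply is_derive_Reals, derivable_pt_lim_exp.
    + apply (is_derive_scal (lpsi d)). now apply lpsi_derive.
  - apply om_derive.
  - intros; apply Rmult_comm.
Qed.

Lemma wt1_derive m d x : 0 < d -> is_derive (wt1 m d) x (wt2 m d x).
Proof.
  intros Hd. unfold wt1 at 1.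
  replace (wt2 m d x) with (wt1 m d x * lam0 m d x + wt m d x * lam1 m d x) by (unfold wt2, wt1; ring).
  apply (is_derive_mult (wt m d) (lam0 m d)).
  - now apply wt_derive.
  - now apply lam0_derive.
  - intros; apply Rmult_comm.
Qed.

Lemma wt2_derive m d x : 0 < d -> is_derive (wt2 m d) x (wt3 m d x).
Proof.
  intros Hd. unfold wt2.
  replace (wt3 m d x) with (wt1 m d x * (lam1 m d x + lam0 m d x ^ 2)
     + wt m d x * (lam2 m d x + (lam1 m d x * lam0 m d x + lam0 m d x * lam1 m d x)))
    by (unfold wt3, wt1; ring).
  apply (is_derive_mult (wt m d) (fun x => lam1 m d x + lam0 m d x ^ 2)).
  - now apply wt_derive.
  - apply (is_derive_plus (lam1 m d) (fun x => lam0 m d x ^ 2)); [now apply lam1_derive |].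
    apply (is_derive_ext (fun x => lam0 m d x * lam0 m d x)); [intros; simpl; ring |].
    apply (is_derive_mult (lam0 m d) (lam0 m d)); try (now apply lam0_derive).
    intros; apply Rmult_comm.
  - intros; apply Rmult_comm.
Qed.

Lemma wt3_cont m d x : 0 < d -> continuous (wt3 m d) x.
Proof.
  intros Hd. apply (ex_derive_continuous (wt3 m d)).
  unfold wt3, wt, lam2, lam1, lam0, pr2, pr1, pr0, lpsi, om. pose proof (pow2_ge_0 x).
  assert (H1 : 0 < 1 + d * x ^ 2) by nra.
  assert (forall z n, 0 < z -> z ^ n <> 0) by (intros; apply pow_nonzero; lra).
  auto_derive.
  repeat split; try lra; try (simpl in *; lra); try (apply H0; simpl in *; lra);
    try (apply (H0 _ 2%nat); simpl in *; lra); try (apply (H0 _ 3%nat); simpl in *; lra).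
Qed.

Definition cw (m : nat) : R := 6 * (2 * INR m + 2).
Definition Cw (m : nat) : R := cw m + 3 * cw m ^ 2 + cw m ^ 3.

(** Differentiation lowers the power by one, uniformly in [d]: since [wt (S m) = wt m * psi], the
    derivatives of [wt (S m)] are bounded by a multiple of [wt m]. The induction on the power rests
    on this. *)
Lemma wt_bounds m d x : 0 < d <= 1 ->
  Rabs (wt1 m d x) * psi d x <= Cw m * wt m d x /\
  Rabs (wt2 m d x) * psi d x <= Cw m * wt m d x /\
  Rabs (wt3 m d x) * psi d x <= Cw m * wt m d x.
Proof.
  intros Hd. pose proof (psi_ge1 d x Hd) as Hp. pose proof (psi_sq_le d x ltac:(lra)) as Hp2.
  pose proof (wt_pos m d x) as Hw. pose proof (pos_INR m) as Hm.
  destruct (pr_bounds 1 x (psi d x) ltac:(lra) ltac:(lra) Hp2) as (a0 & a1 & a2).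
  destruct (pr_bounds d x (psi d x) Hd ltac:(lra) Hp2) as (b0 & b1 & b2).
  set (p := psi d x) in *.
  assert (Hl : forall a b k, Rabs a * p <= k -> Rabs b * p <= k -> k <= 6 ->
     Rabs (INR m * (a - b) - 2 * a) * p <= cw m).
  { intros a b k Ha Hb Hk.
    assert (Rabs (INR m * (a - b) - 2 * a) <= INR m * (Rabs a + Rabs b) + 2 * Rabs a).
    { eapply Rle_trans; [apply Rabs_triang |]. rewrite Rabs_Ropp, !Rabs_mult, (Rabs_pos_eq (INR m)), (Rabs_pos_eq 2) by lra.
      apply Rplus_le_compat_r, Rmult_le_compat_l; auto.
      eapply Rle_trans; [apply Rabs_triang |]. rewrite Rabs_Ropp. lra. }
    apply Rle_trans with ((INR m * (Rabs a + Rabs b) + 2 * Rabs a) * p); [apply Rmult_le_compat_r; lra |].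
    unfold cw. nra. }
  assert (L0 : Rabs (lam0 m d x) * p <= cw m) by (apply (Hl _ _ 1); auto; lra).
  assert (L1 : Rabs (lam1 m d x) * p <= cw m) by (apply (Hl _ _ 1); auto; lra).
  assert (L2 : Rabs (lam2 m d x) * p <= cw m) by (apply (Hl _ _ 6); auto; lra).
  pose proof (Rabs_pos (lam0 m d x)) as p0. pose proof (Rabs_pos (lam1 m d x)) as p1.
  assert (M0 : Rabs (lam0 m d x) <= cw m) by nra.
  assert (C2 : 0 <= cw m ^ 2) by apply pow2_ge_0. assert (C3 : 0 <= cw m ^ 3) by (apply pow_le; lra).
  assert (Q00 : Rabs (lam0 m d x) ^ 2 * p <= cw m ^ 2).
  { replace (Rabs (lam0 m d x) ^ 2 * p) with (Rabs (lam0 m d x) * (Rabs (lam0 m d x) * p)) by ring.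
    replace (cw m ^ 2) with (cw m * cw m) by ring. apply Rmult_le_compat; auto. apply Rmult_le_pos; lra. }
  assert (Q01 : Rabs (lam0 m d x) * Rabs (lam1 m d x) * p <= cw m ^ 2).
  { rewrite Rmult_assoc. replace (cw m ^ 2) with (cw m * cw m) by ring.
    apply Rmult_le_compat; auto. apply Rmult_le_pos; lra. }
  assert (Q000 : Rabs (lam0 m d x) ^ 3 * p <= cw m ^ 3).
  { replace (Rabs (lam0 m d x) ^ 3 * p) with (Rabs (lam0 m d x) * (Rabs (lam0 m d x) ^ 2 * p)) by ring.
    replace (cw m ^ 3) with (cw m * cw m ^ 2) by ring. apply Rmult_le_compat; auto.
    apply Rmult_le_pos; [apply pow2_ge_0 | lra]. }
  assert (key : forall l, Rabs l * p <= Cw m -> Rabs (wt m d x * l) * p <= Cw m * wt m d x).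
  { intros l Hl'. rewrite Rabs_mult, (Rabs_pos_eq (wt m d x)) by lra. nra. }
  unfold wt1, wt2, wt3. split; [| split]; apply key; unfold Cw.
  - lra.
  - apply Rle_trans with ((Rabs (lam1 m d x) + Rabs (lam0 m d x) ^ 2) * p); [| lra].
    apply Rmult_le_compat_r; [lra |]. rewrite RPow_abs. apply Rabs_triang.
  - apply Rle_trans with ((Rabs (lam2 m d x) + 3 * (Rabs (lam0 m d x) * Rabs (lam1 m d x)) + Rabs (lam0 m d x) ^ 3) * p); [| lra].
    apply Rmult_le_compat_r; [lra |]. rewrite RPow_abs.
    eapply Rle_trans; [apply Rabs_triang |]. apply Rplus_le_compat_r.
    eapply Rle_trans; [apply Rabs_triang |]. apply Rplus_le_compat_l.
    rewrite !Rabs_mult, (Rabs_pos_eq 3) by lra. lra.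
Qed.

Lemma Cw_pos m : 0 < Cw m.
Proof.
  unfold Cw. assert (0 < cw m) by (unfold cw; pose proof (pos_INR m); lra).
  pose proof (pow_lt _ 2 H). pose proof (pow_lt _ 3 H). lra.
Qed.

(** * Rapid decay of the solution *)
Fixpoint Sq (u : nat -> R -> R -> C) (j : nat) (x t : R) : R :=
  match j with O => 0 | S j => Sq u j x t + N2 (u j x t) end.

Lemma Sq_pos u j x t : 0 <= Sq u j x t.
Proof. induction j; simpl; [lra |]. pose proof (N2_pos (u j x t)). lra. Qed.

Lemma Sq_mono u i j x t : (i <= j)%nat -> Sq u i x t <= Sq u j x t.
Proof.
  induction 1 as [| j H IH]; [lra |]. simpl. pose proof (N2_pos (u j x t)). lra.
Qed.

Lemma N2_plus z z' : N2 (z + z')%C <= 2 * N2 z + 2 * N2 z'.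
Proof.
  unfold N2, Re, Im. simpl. pose proof (pow2_ge_0 (fst z - fst z')). pose proof (pow2_ge_0 (snd z - snd z')). nra.
Qed.

Lemma N2_mult z z' : N2 (z * z')%C = N2 z * N2 z'.
Proof. unfold N2, Re, Im. simpl. ring. Qed.

Lemma N2_le z k : Cmod z <= k -> N2 z <= k ^ 2.
Proof. intros H. rewrite N2_Cmod. apply pow_incr. split; [apply Cmod_ge_0 | auto]. Qed.

(** All derivatives of [V] are bounded, so the source is controlled by derivatives of [u] of order
    at most [a + j], pointwise and hence under any weight. *)
Lemma Pr_sq u V j : tower V -> forall a b, exists K, 0 <= K /\
  forall x t, N2 (Pr u V j a b x t) <= K * Sq u (S (a + j)) x t.
Proof.
  intros [HV _]. induction j as [| j IH]; intros a b.
  - destruct (HV b) as [K [HK0 HK]]. exists (K ^ 2). split; [apply pow2_ge_0 |].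
    intros x t. simpl Pr. rewrite N2_mult, Nat.add_0_r. simpl Sq.
    pose proof (N2_le _ _ (HK x t)). pose proof (N2_pos (u a x t)).
    pose proof (Sq_pos u a x t). nra.
  - destruct (IH (S a) b) as [K1 [HK1 H1]]. destruct (IH a (S b)) as [K2 [HK2 H2]].
    exists (2 * K1 + 2 * K2). split; [lra |]. intros x t. cbn [Pr].
    eapply Rle_trans; [apply N2_plus |]. specialize (H1 x t). specialize (H2 x t).
    replace (a + S j)%nat with (S a + j)%nat by lia.
    pose proof (Sq_mono u (S (a + j)) (S (S a + j)) x t ltac:(lia)). nra.
Qed.

(** An exact identity, by which the time remainder of [|u|^2] is quadratic as soon as that of [u]
    is. *)
Lemma N2_expand (zs zt d : C) (r : R) :
  N2 zs - N2 zt - r * (2 * Re (Cconj zt * d)%C)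
  = N2 (zs - zt)%C + 2 * Re (Cconj zt * (zs - zt - RtoC r * d))%C.
Proof. unfold N2, Re, Im. simpl. ring. Qed.

Lemma N2_time_rem (zs zt d : C) (r k : R) : Rabs r <= 1 -> 0 <= k ->
  Cmod zt <= k -> Cmod d <= k -> Cmod (zs - zt - RtoC r * d) <= k * r ^ 2 ->
  Rabs (N2 zs - N2 zt - r * (2 * Re (Cconj zt * d)%C)) <= 6 * k ^ 2 * r ^ 2.
Proof.
  intros Hr Hk Hz Hd HR. rewrite N2_expand.
  assert (Hr2 : r ^ 2 <= Rabs r) by (rewrite <- pow2_abs; pose proof (Rabs_pos r); nra).
  assert (H1 : Cmod (zs - zt) <= 2 * k * Rabs r).
  { replace (zs - zt)%C with ((zs - zt - RtoC r * d) + RtoC r * d)%C by ring.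
    eapply Rle_trans; [apply Cmod_triangle |]. rewrite Cmod_mult, Cmod_R.
    nra. }
  assert (H2 : N2 (zs - zt)%C <= 4 * k ^ 2 * r ^ 2).
  { eapply Rle_trans; [apply N2_le, H1 |]. rewrite <- (pow2_abs r). right. ring. }
  assert (H3 : Rabs (2 * Re (Cconj zt * (zs - zt - RtoC r * d))%C) <= 2 * k ^ 2 * r ^ 2).
  { eapply Rle_trans; [apply Re_conj_le |].
    replace (2 * k ^ 2 * r ^ 2) with (2 * (k * (k * r ^ 2))) by ring.
    apply Rmult_le_compat_l; [lra |]. apply Rmult_le_compat; auto using Cmod_ge_0. }
  eapply Rle_trans; [apply Rabs_triang |]. rewrite (Rabs_pos_eq (N2 _)) by apply N2_pos. lra.
Qed.

Lemma sq_le_pow32 r : Rabs r <= 1 -> r ^ 2 <= Rabs r * sqrt (Rabs r).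
Proof.
  intros H. rewrite <- (pow2_abs r). pose proof (Rabs_pos r) as Hp.
  set (h := Rabs r) in *. assert (h <= sqrt h); [| nra].
  pose proof (sqrt_pos h). pose proof (sqrt_sqrt h Hp).
  nra.
Qed.

Definition rhs_t (alpha beta : R) (u V : nat -> R -> R -> C) (j : nat) (x t : R) : C :=
  (- (Ci * RtoC alpha * u (S (S j)) x t) - RtoC beta * u (S (S (S j))) x t + Pr u V j 0 0 x t)%C.

Lemma tower_cont u j t : tower u -> Ccont (fun x => u j x t).
Proof. intros [_ H]. apply (Cont_derive _ (fun x => u (S j) x t)). intros x. apply H. Qed.

Lemma Pr_cont u V j a b t : tower u -> tower V -> Ccont (fun x => Pr u V j a b x t).
Proof.
  intros Hu HV. apply (Cont_derive _ (fun x => Pr u V (S j) a b x t)). intros x. now apply Pr_derive.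
Qed.

Lemma Pr_bounded u V j : tower u -> tower V -> forall a b, exists K, 0 <= K /\
  forall x t, Cmod (Pr u V j a b x t) <= K.
Proof.
  intros [Hu _] [HV _]. induction j as [| j IH]; intros a b.
  - destruct (Hu a) as [K1 [H1 B1]]. destruct (HV b) as [K2 [H2 B2]].
    exists (K1 * K2). split; [nra |]. intros x t. simpl. rewrite Cmod_mult.
    apply Rmult_le_compat; auto using Cmod_ge_0.
  - destruct (IH (S a) b) as [K1 [H1 B1]]. destruct (IH a (S b)) as [K2 [H2 B2]].
    exists (K1 + K2). split; [lra |]. intros x t. cbn [Pr].
    eapply Rle_trans; [apply Cmod_triangle |]. specialize (B1 x t). specialize (B2 x t). lra.
Qed.

Lemma dom_weighted (w : R -> R) (f : R -> R) A B : (forall x, continuous w x) -> (forall x, continuous f x) ->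
  (forall x, Rabs (w x) <= A * om x) -> (forall x, Rabs (f x) <= B) -> dom (A * B) (fun x => w x * f x).
Proof.
  intros Hw Hf HA HB. split; intros x.
  - apply (continuous_mult w f); auto.
  - rewrite Rabs_mult. specialize (HA x). specialize (HB x).
    replace (A * B * om x) with (A * om x * B) by ring.
    apply Rmult_le_compat; auto using Rabs_pos.
Qed.

Section Moments.
Context (alpha beta T : R) (u V : nat -> R -> R -> C).
Context (HT : 0 < T <= 1) (Hu : tower u) (HV : tower V).
Context (Hrem : forall j, exists K, 0 <= K /\ forall x s t, 0 <= s <= T -> 0 <= t <= T ->
      Cmod (u j x s - u j x t - RtoC (s - t) * rhs_t alpha beta u V j x t) <= K * (s - t) ^ 2).

Lemma rhs_bounded j : exists K, 0 <= K /\ forall x t,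
  Cmod (u j x t) <= K /\ Cmod (u (S j) x t) <= K /\ Cmod (u (S (S j)) x t) <= K /\
  Cmod (u (S (S (S j))) x t) <= K /\ Cmod (Pr u V j 0 0 x t) <= K /\ Cmod (rhs_t alpha beta u V j x t) <= K.
Proof.
  destruct Hu as [B _].
  destruct (B j) as [K0 [h0 B0]]. destruct (B (S j)) as [K1 [h1 B1]].
  destruct (B (S (S j))) as [K2 [h2 B2]]. destruct (B (S (S (S j)))) as [K3 [h3 B3]].
  destruct (Pr_bounded u V j Hu HV 0 0) as [K4 [h4 B4]].
  pose proof (Rabs_pos alpha) as ha. pose proof (Rabs_pos beta) as hb.
  assert (0 <= Rabs alpha * K2) by nra. assert (0 <= Rabs beta * K3) by nra.
  exists (K0 + K1 + K2 + K3 + K4 + Rabs alpha * K2 + Rabs beta * K3). split; [lra |].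
  intros x t. specialize (B0 x t); specialize (B1 x t); specialize (B2 x t);
    specialize (B3 x t); specialize (B4 x t).
  repeat split; try lra.
  unfold rhs_t. eapply Rle_trans; [apply Cmod_triangle |].
  eapply Rle_trans; [apply Rplus_le_compat_r, Cmod_minus_le |].
  rewrite Cmod_opp, !Cmod_mult, Cmod_Ci, !Cmod_R, Rmult_1_l.
  assert (Rabs alpha * Cmod (u (S (S j)) x t) <= Rabs alpha * K2) by now apply Rmult_le_compat_l.
  assert (Rabs beta * Cmod (u (S (S (S j))) x t) <= Rabs beta * K3) by now apply Rmult_le_compat_l.
  lra.
Qed.

Lemma energy_diff w A j : 0 <= A -> (forall x, continuous w x) -> (forall x, Rabs (w x) <= A * om x) ->
  diff_on T (fun t => intR (fun x => w x * N2 (u j x t)))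
    (fun t => intR (fun x => w x * (2 * Re (Cconj (u j x t) * rhs_t alpha beta u V j x t)%C))).
Proof.
  intros HA Hw HwA. destruct (rhs_bounded j) as [K [HK B]]. destruct (Hrem j) as [Kr [HKr R]].
  set (k := K + Kr). assert (Hk : 0 <= k) by (unfold k; lra).
  apply (intR_diff_on T (fun x t => w x * N2 (u j x t))
    (fun x t => w x * (2 * Re (Cconj (u j x t) * rhs_t alpha beta u V j x t)%C)) (6 * k ^ 2 * A)).
  - apply Rmult_le_pos; auto. pose proof (pow2_ge_0 k). lra.
  - intros t _. exists (A * K ^ 2). apply dom_weighted; auto.
    + apply N2_cont. now apply tower_cont.
    + intros x. rewrite Rabs_pos_eq by apply N2_pos. apply N2_le, B.
  - intros t _. exists (A * (2 * (K * K))). apply dom_weighted; auto.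
    + apply Re_conj_cont; [now apply tower_cont |]. unfold rhs_t.
      apply Ccont_plus; [| now apply Pr_cont]. apply Ccont_minus.
      * apply Ccont_opp, Ccont_mult; [apply Ccont_const | now apply tower_cont].
      * apply Ccont_mult; [apply Ccont_const | now apply tower_cont].
    + intros x. eapply Rle_trans; [apply Re_conj_le |]. apply Rmult_le_compat_l; [lra |].
      apply Rmult_le_compat; auto using Cmod_ge_0; apply B.
  - intros s t x Hs Ht.
    assert (Hr : Rabs (s - t) <= 1) by (apply Rabs_le; lra).
    replace (w x * N2 (u j x s) - w x * N2 (u j x t) -
       (s - t) * (w x * (2 * Re (Cconj (u j x t) * rhs_t alpha beta u V j x t)%C)))
      with (w x * (N2 (u j x s) - N2 (u j x t) -
         (s - t) * (2 * Re (Cconj (u j x t) * rhs_t alpha beta u V j x t)%C))) by ring.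
    rewrite Rabs_mult.
    replace (6 * k ^ 2 * A * (Rabs (s - t) * sqrt (Rabs (s - t))) * om x)
      with (A * om x * (6 * k ^ 2 * (Rabs (s - t) * sqrt (Rabs (s - t))))) by ring.
    apply Rmult_le_compat; auto using Rabs_pos.
    eapply Rle_trans.
    + apply (N2_time_rem _ _ _ _ k); auto.
      * destruct (B x t) as (b & _). unfold k. lra.
      * destruct (B x t) as (_ & _ & _ & _ & _ & b). unfold k. lra.
      * eapply Rle_trans; [now apply R |]. pose proof (pow2_ge_0 (s - t)). unfold k. nra.
    + apply Rmult_le_compat_l; [pose proof (pow2_ge_0 k); lra |]. now apply sq_le_pow32.
Qed.

Lemma wt_dom m d j t : 0 < d <= 1 -> exists M, dom M (fun x => wt m d x * N2 (u j x t)).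
Proof.
  intros Hd. destruct (proj1 Hu j) as [K [HK B]]. exists ((/ d) ^ m * K ^ 2).
  apply dom_weighted.
  - intros x. apply (ex_derive_continuous (wt m d)). eexists. apply wt_derive; lra.
  - apply N2_cont. now apply tower_cont.
  - intros x. rewrite Rabs_pos_eq by (left; apply wt_pos). now apply wt_le_om.
  - intros x. rewrite Rabs_pos_eq by apply N2_pos. apply N2_le, B.
Qed.

Lemma wt_dom_Sq m d j t : 0 < d <= 1 -> exists M, dom M (fun x => wt m d x * Sq u j x t).
Proof.
  intros Hd. induction j as [| j [M D]].
  - exists (0 * 1). apply (dom_ext _ (fun x => om x * 0)); [intros; simpl; ring |].
    apply (dom_ext _ (fun x => 0 * om x)); [intros; ring |].
    replace (0 * 1) with (Rabs 0 * 1) by (rewrite Rabs_R0; ring). apply dom_scal, dom_om.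
  - destruct (wt_dom m d j t Hd) as [M' D']. exists (M + M').
    apply (dom_ext _ (fun x => wt m d x * Sq u j x t + wt m d x * N2 (u j x t)));
      [intros; simpl; ring |]. now apply dom_plus.
Qed.

Lemma energy_flux m d j t : 0 < d <= 1 ->
  intR (fun x => wt m d x * (2 * Re (Cconj (u j x t) * rhs_t alpha beta u V j x t)%C))
  = intR (flux_rhs alpha beta (wt m d) (wt1 m d) (wt3 m d) (fun x => u j x t) (fun x => u (S j) x t)
       (fun x => Pr u V j 0 0 x t)) /\
  exists M, dom M (flux_rhs alpha beta (wt m d) (wt1 m d) (wt3 m d) (fun x => u j x t) (fun x => u (S j) x t)
       (fun x => Pr u V j 0 0 x t)).
Proof.
  intros Hd. destruct (rhs_bounded j) as [K [HK B]].
  assert (Hwb : forall w, (forall x, Rabs (w x) * psi d x <= Cw m * wt m d x) ->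
     forall x, Rabs (w x) * K ^ 2 <= Cw m * (/ d) ^ m * K ^ 2 * om x).
  { intros w Hw x. specialize (Hw x). pose proof (psi_ge1 d x Hd). pose proof (wt_le_om m d x Hd).
    pose proof (Cw_pos m). pose proof (Rabs_pos (w x)). pose proof (pow2_ge_0 K).
    assert (Rabs (w x) <= Cw m * ((/ d) ^ m * om x)).
    { apply Rle_trans with (Cw m * wt m d x); [nra |]. apply Rmult_le_compat_l; lra. }
    replace (Cw m * (/ d) ^ m * K ^ 2 * om x) with (Cw m * ((/ d) ^ m * om x) * K ^ 2) by ring.
    now apply Rmult_le_compat_r. }
  assert (Hw0 : forall x, Rabs (wt m d x) * K ^ 2 <= (1 + Cw m) * (/ d) ^ m * K ^ 2 * om x).
  { intros x. rewrite (Rabs_pos_eq (wt m d x)) by (left; apply wt_pos).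
    pose proof (wt_le_om m d x Hd). pose proof (Cw_pos m). pose proof (pow2_ge_0 K). pose proof (wt_pos m d x).
    replace ((1 + Cw m) * (/ d) ^ m * K ^ 2 * om x) with ((1 + Cw m) * ((/ d) ^ m * om x) * K ^ 2) by ring.
    apply Rmult_le_compat_r; auto. nra. }
  assert (Hup : forall x, Cw m * (/ d) ^ m * K ^ 2 * om x <= (1 + Cw m) * (/ d) ^ m * K ^ 2 * om x).
  { intros x. apply Rmult_le_compat_r; [left; apply om_pos |].
    apply Rmult_le_compat_r; [apply pow2_ge_0 |]. apply Rmult_le_compat_r; [| lra].
    apply pow_le. left. apply Rinv_0_lt_compat. lra. }
  destruct Hu as [_ Du].
  assert (Hd0 : 0 < d) by lra.
  pose proof (fun x => wt_derive m d x Hd0) as W1.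
  pose proof (fun x => wt1_derive m d x Hd0) as W2.
  pose proof (fun x => wt2_derive m d x Hd0) as W3.
  pose proof (fun x => wt3_cont m d x Hd0) as W4.
  assert (b1 : forall x, Rabs (wt1 m d x) * K ^ 2 <= (1 + Cw m) * (/ d) ^ m * K ^ 2 * om x)
    by (intros x; eapply Rle_trans; [apply Hwb; intros; now apply wt_bounds | apply Hup]).
  assert (b2 : forall x, Rabs (wt2 m d x) * K ^ 2 <= (1 + Cw m) * (/ d) ^ m * K ^ 2 * om x)
    by (intros x; eapply Rle_trans; [apply Hwb; intros; now apply wt_bounds | apply Hup]).
  assert (b3 : forall x, Rabs (wt3 m d x) * K ^ 2 <= (1 + Cw m) * (/ d) ^ m * K ^ 2 * om x)
    by (intros x; eapply Rle_trans; [apply Hwb; intros; now apply wt_bounds | apply Hup]).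
  split.
  - apply (flux_identity alpha beta (wt m d) (wt1 m d) (wt2 m d) (wt3 m d)
      (fun x => u j x t) (fun x => u (S j) x t) (fun x => u (S (S j)) x t) (fun x => u (S (S (S j))) x t)
      (fun x => Pr u V j 0 0 x t) (fun _ => K) ((1 + Cw m) * (/ d) ^ m * K ^ 2));
      auto; try (intros x; apply B); [now apply tower_cont | now apply Pr_cont].
  - apply (flux_rhs_dom alpha beta (wt m d) (wt1 m d) (wt2 m d) (wt3 m d)
      (fun x => u j x t) (fun x => u (S j) x t) (fun x => u (S (S j)) x t)
      (fun x => Pr u V j 0 0 x t) (fun _ => K) ((1 + Cw m) * (/ d) ^ m * K ^ 2));
      auto; try (intros x; apply B). now apply Pr_cont.
Qed.

(** All derivatives are taken together at each power, since raising the power for [u j] uses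
    [u (S j)] at the lower power. Uniformity in [d] stands for finiteness of the untruncated
    moment. *)
Definition Mom (m : nat) : Prop := forall j, exists K, 0 <= K /\
  forall d t, 0 < d <= 1 -> 0 <= t <= T -> intR (fun x => wt m d x * N2 (u j x t)) <= K.

Lemma Mom_0 : Mom 0.
Proof.
  intros j. destruct (proj1 Hu j) as [K [HK B]]. exists (PI * K ^ 2).
  split; [pose proof PI_RGT_0; pose proof (pow2_ge_0 K); nra |]. intros d t Hd Ht.
  eapply Rle_trans; [apply Rle_abs |]. rewrite Rmult_comm, (Rmult_comm (K ^ 2)).
  replace (PI * K ^ 2) with (PI * ((/ d) ^ 0 * K ^ 2)) by (simpl; ring).
  apply intR_bound. destruct (wt_dom 0 d j t Hd) as [M [D1 D2]]. split; auto.
  intros x. rewrite Rabs_pos_eq by (apply Rmult_le_pos; [left; apply wt_pos | apply N2_pos]).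
  pose proof (wt_le_om 0 d x Hd). pose proof (N2_le _ _ (B x t)).
  pose proof (wt_pos 0 d x). simpl pow in *. nra.
Qed.

Context (Hinit : forall j n, exists K, 0 <= K /\ forall x, qq x ^ n * Cmod (u j x 0) <= K).

Lemma init_energy m j : exists K, 0 <= K /\
  forall d, 0 < d <= 1 -> intR (fun x => wt m d x * N2 (u j x 0)) <= K.
Proof.
  destruct (Hinit j m) as [K1 [H1 B1]]. destruct (Hinit j 0) as [K2 [H2 B2]].
  exists (PI * (K1 * K2)). split; [apply Rmult_le_pos; [pose proof PI_RGT_0; lra | nra] |]. intros d Hd.
  eapply Rle_trans; [apply Rle_abs |]. apply intR_bound.
  destruct (wt_dom m d j 0 Hd) as [M [D1 D2]]. split; auto.
  intros x. rewrite Rabs_pos_eq by (apply Rmult_le_pos; [left; apply wt_pos | apply N2_pos]).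
  pose proof (wt_le_qq m d x ltac:(lra)) as Hw. specialize (B1 x). specialize (B2 x).
  simpl in B2. rewrite Rmult_1_l in B2. rewrite N2_Cmod.
  pose proof (Cmod_ge_0 (u j x 0)) as Hc. pose proof (om_pos x).
  assert (0 <= qq x ^ m) by (apply pow_le; pose proof (qq_ge1 x); lra).
  apply Rle_trans with (qq x ^ m * om x * Cmod (u j x 0) ^ 2).
  - apply Rmult_le_compat_r; [apply pow2_ge_0 | auto].
  - replace (qq x ^ m * om x * Cmod (u j x 0) ^ 2) with (qq x ^ m * Cmod (u j x 0) * Cmod (u j x 0) * om x) by ring.
    apply Rmult_le_compat_r; [lra |]. apply Rmult_le_compat; auto. nra.
Qed.

(** Derivatives of the weight drop to power [m], where both [u j] and [u (S j)] are already
    controlled; this weight is not monotone, so the term with [u (S j)] has no sign. The source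
    keeps power [S m] but contains no derivative beyond [u j]. *)
Lemma flux_pointwise m d j KP x t : 0 < d <= 1 -> 0 <= KP ->
  (forall x t, N2 (Pr u V j 0 0 x t) <= KP * Sq u (S j) x t) ->
  flux_rhs alpha beta (wt (S m) d) (wt1 (S m) d) (wt3 (S m) d) (fun x => u j x t) (fun x => u (S j) x t)
       (fun x => Pr u V j 0 0 x t) x
  <= (3 * Rabs beta + Rabs alpha) * Cw (S m) * (wt m d x * N2 (u j x t) + wt m d x * N2 (u (S j) x t))
     + (1 + KP) * (wt (S m) d x * Sq u j x t + wt (S m) d x * N2 (u j x t)).
Proof.
  intros Hd HKP HP. unfold flux_rhs.
  destruct (wt_bounds (S m) d x Hd) as (b1 & _ & b3).
  pose proof (psi_pos d x) as Hpsi. pose proof (wt_pos m d x) as Hwm. pose proof (wt_pos (S m) d x) as Hwm1.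
  rewrite wt_S in b1, b3.
  assert (c1 : Rabs (wt1 (S m) d x) <= Cw (S m) * wt m d x).
  { apply Rmult_le_reg_r with (psi d x); auto. lra. }
  assert (c3 : Rabs (wt3 (S m) d x) <= Cw (S m) * wt m d x).
  { apply Rmult_le_reg_r with (psi d x); auto. lra. }
  set (v := u j x t). set (v1 := u (S j) x t). set (P := Pr u V j 0 0 x t).
  pose proof (N2_pos v) as hv. pose proof (N2_pos v1) as hv1. pose proof (N2_pos P) as hP.
  assert (hc : Rabs (cross v v1) <= (N2 v + N2 v1) / 2).
  { eapply Rle_trans; [apply cross_le |]. rewrite !N2_Cmod. pose proof (pow2_ge_0 (Cmod v - Cmod v1)). lra. }
  assert (hr : 2 * Re (Cconj v * P)%C <= N2 v + N2 P).
  { eapply Rle_trans; [apply Rle_abs |]. eapply Rle_trans; [apply Re_conj_le |].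
    rewrite !N2_Cmod. pose proof (pow2_ge_0 (Cmod v - Cmod P)). lra. }
  specialize (HP x t). fold P in HP. simpl in HP. fold v in HP.
  pose proof (Sq_pos u j x t) as hS.
  set (q := Cw (S m) * wt m d x) in *.
  assert (hq : 0 <= q) by (unfold q; pose proof (Cw_pos (S m)); nra).
  assert (e1 : - 3 * beta * (wt1 (S m) d x * N2 v1) <= 3 * Rabs beta * (q * N2 v1)).
  { eapply Rle_trans; [apply Rle_abs |]. rewrite !Rabs_mult, (Rabs_pos_eq (N2 v1)), Rabs_left by lra.
    replace (- (-3)) with 3 by ring. apply Rmult_le_compat_l; [pose proof (Rabs_pos beta); lra |].
    now apply Rmult_le_compat_r. }
  assert (e2 : beta * (wt3 (S m) d x * N2 v) <= Rabs beta * (q * N2 v)).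
  { eapply Rle_trans; [apply Rle_abs |]. rewrite !Rabs_mult, (Rabs_pos_eq (N2 v)) by lra.
    apply Rmult_le_compat_l; [apply Rabs_pos |]. now apply Rmult_le_compat_r. }
  assert (e3 : - (2 * alpha * (wt1 (S m) d x * cross v v1)) <= Rabs alpha * (q * (N2 v + N2 v1))).
  { eapply Rle_trans; [apply Rle_abs |]. rewrite Rabs_Ropp, !Rabs_mult, (Rabs_pos_eq 2) by lra.
    replace (Rabs alpha * (q * (N2 v + N2 v1))) with (2 * Rabs alpha * (q * ((N2 v + N2 v1) / 2))) by field.
    apply Rmult_le_compat_l; [pose proof (Rabs_pos alpha); lra |].
    apply Rmult_le_compat; auto using Rabs_pos. }
  assert (e4 : wt (S m) d x * (2 * Re (Cconj v * P)%C)
       <= (1 + KP) * (wt (S m) d x * Sq u j x t + wt (S m) d x * N2 v)).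
  { apply Rle_trans with (wt (S m) d x * ((1 + KP) * (Sq u j x t + N2 v))).
    - apply Rmult_le_compat_l; [lra |]. nra.
    - right; ring. }
  replace ((3 * Rabs beta + Rabs alpha) * Cw (S m) * (wt m d x * N2 v + wt m d x * N2 v1))
    with ((3 * Rabs beta + Rabs alpha) * (q * N2 v + q * N2 v1)) by (unfold q; ring).
  assert (0 <= Rabs beta * (q * N2 v)) by (apply Rmult_le_pos; [apply Rabs_pos | nra]).
  lra.
Qed.

Lemma Mom_S m : Mom m -> Mom (S m).
Proof.
  intros HM.
  (* An inner induction on [j], stated for the sum [Sq], because the source of order [j] contains
     all lower derivatives at the same power. *)
  assert (key : forall j, exists K, 0 <= K /\ forall d t, 0 < d <= 1 -> 0 <= t <= T ->
     intR (fun x => wt (S m) d x * Sq u j x t) <= K).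
  { induction j as [| j IH].
    - exists 0. split; [lra |]. intros d t Hd Ht. simpl.
      rewrite (intR_ext _ (fun x => 0 * om x)) by (intros; ring).
      rewrite (intR_scal 1) by apply dom_om. lra.
    - destruct IH as [K1 [HK1 B1]]. destruct (HM j) as [K2 [HK2 B2]].
      destruct (HM (S j)) as [K3 [HK3 B3]]. destruct (init_energy (S m) j) as [K4 [HK4 B4]].
      destruct (Pr_sq u V j HV 0 0) as [KP [HKP BP]]. simpl in BP.
      set (c := (3 * Rabs beta + Rabs alpha) * Cw (S m)).
      assert (Hc : 0 <= c).
      { unfold c. pose proof (Rabs_pos alpha). pose proof (Rabs_pos beta). pose proof (Cw_pos (S m)). nra. }
      set (l := 1 + KP). assert (Hl : 0 <= l) by (unfold l; lra).
      (* [K2] and [K3] come from the lower power, [K1] from the lower derivatives; the remaining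
         part of the flux is [l] times the energy itself. *)
      set (b := c * (K2 + K3) + l * K1). assert (Hb : 0 <= b) by (unfold b; nra).
      exists (K1 + exp (l * T) * (K4 + b * T)).
      assert (He : 0 <= exp (l * T) * (K4 + b * T)) by (apply Rmult_le_pos; [left; apply exp_pos | nra]).
      split; [lra |]. intros d t Hd Ht.
      destruct (wt_dom_Sq (S m) d j t Hd) as [M1 D1]. destruct (wt_dom (S m) d j t Hd) as [M2 D2].
      rewrite (intR_ext _ (fun x => wt (S m) d x * Sq u j x t + wt (S m) d x * N2 (u j x t)))
        by (intros; simpl; ring).
      rewrite (intR_plus M1 M2) by auto. apply Rplus_le_compat; [now apply B1 |].
      pose proof (gronwall T (fun t => intR (fun x => wt (S m) d x * N2 (u j x t)))
        (fun t => intR (fun x => wt (S m) d x * (2 * Re (Cconj (u j x t) * rhs_t alpha beta u V j x t)%C)))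
        l b (proj1 HT) Hl Hb) as G. cbv beta in G.
      eapply Rle_trans; [apply G; auto |].
      + apply (energy_diff _ ((/ d) ^ (S m))).
        * apply pow_le. left. apply Rinv_0_lt_compat. lra.
        * intros x. apply (ex_derive_continuous (wt (S m) d)). eexists. now apply wt_derive.
        * intros x. rewrite Rabs_pos_eq by (left; apply wt_pos). now apply wt_le_om.
      + intros r Hr. destruct (energy_flux (S m) d j r Hd) as [E [Mf Df]]. rewrite E.
        destruct (wt_dom_Sq (S m) d j r Hd) as [M1' D1']. destruct (wt_dom (S m) d j r Hd) as [M2' D2'].
        destruct (wt_dom m d j r Hd) as [M3' D3']. destruct (wt_dom m d (S j) r Hd) as [M4' D4'].
        assert (Dp := dom_plus _ _ _ _ (dom_scal _ _ c (dom_plus _ _ _ _ D3' D4'))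
             (dom_scal _ _ l (dom_plus _ _ _ _ D1' D2'))). cbv beta in Dp.
        eapply Rle_trans; [apply (intR_le _ _ _ _ Df Dp) |].
        * intros x. apply flux_pointwise; auto.
        * rewrite (intR_plus _ _ _ _ (dom_scal _ _ c (dom_plus _ _ _ _ D3' D4'))
             (dom_scal _ _ l (dom_plus _ _ _ _ D1' D2'))).
          rewrite (intR_scal _ _ c (dom_plus _ _ _ _ D3' D4')), (intR_scal _ _ l (dom_plus _ _ _ _ D1' D2')).
          rewrite (intR_plus _ _ _ _ D3' D4'), (intR_plus _ _ _ _ D1' D2').
          specialize (B1 d r Hd Hr). specialize (B2 d r Hd Hr). specialize (B3 d r Hd Hr).
          set (E3 := intR (fun x => wt m d x * N2 (u j x r))) in *.
          set (E4 := intR (fun x => wt m d x * N2 (u (S j) x r))) in *.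
          set (E1 := intR (fun x => wt (S m) d x * Sq u j x r)) in *.
          set (E2 := intR (fun x => wt (S m) d x * N2 (u j x r))) in *.
          unfold b. nra.
      + specialize (B4 d Hd).
        assert (E0 : 0 <= intR (fun x => wt (S m) d x * N2 (u j x 0))).
        { destruct (wt_dom (S m) d j 0 Hd) as [M5 D5]. apply (intR_pos M5); auto.
          intros x. apply Rmult_le_pos; [left; apply wt_pos | apply N2_pos]. }
        apply Rmult_le_compat.
        * left; apply exp_pos.
        * nra.
        * apply exp_le. nra.
        * nra. }
  intros j. destruct (key (S j)) as [K [HK B]]. exists K. split; auto. intros d t Hd Ht.
  destruct (wt_dom_Sq (S m) d (S j) t Hd) as [M1 D1]. destruct (wt_dom (S m) d j t Hd) as [M2 D2].
  eapply Rle_trans; [| now apply (B d t)]. apply (intR_le M2 M1); auto.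
  intros x. apply Rmult_le_compat_l; [left; apply wt_pos |]. simpl. pose proof (Sq_pos u j x t). lra.
Qed.

Lemma Mom_all m : Mom m.
Proof. induction m; [apply Mom_0 | now apply Mom_S]. Qed.

(** The Sobolev bound for [wt |u|^2] is uniform in [d], so the truncation may depend on the point:
    with [d = om x] one has [psi ^ 2 >= (1 + x^2) / 2] at [x] itself. *)
Theorem schwartz_bounds j n : exists K, 0 <= K /\
  forall x t, 0 <= t <= T -> qq x ^ n * Cmod (u j x t) <= K.
Proof.
  (* [2 n] powers for the square of the [n]-th power, and two more to compensate the factor [om] in
     [wt]. *)
  set (m := (2 * S n)%nat).
  destruct (Mom_all m j) as [K1 [HK1 B1]]. destruct (Mom_all m (S j)) as [K2 [HK2 B2]].
  set (Z := (Cw m + 1) * K1 + K2).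
  pose proof (Cw_pos m) as HC. assert (HZ : 0 <= Z) by (unfold Z; nra).
  assert (H : forall d x t, 0 < d <= 1 -> 0 <= t <= T -> wt m d x * N2 (u j x t) <= Z).
  { intros d x t Hd Ht.
    destruct (wt_dom m d j t Hd) as [M1 D1]. destruct (wt_dom m d (S j) t Hd) as [M2 D2].
    apply Rle_trans with (intR (fun x => (Cw m + 1) * (wt m d x * N2 (u j x t)) + wt m d x * N2 (u (S j) x t))).
    - apply (pointwise_le_intR (Rabs (Cw m + 1) * M1 + M2) M1 _ (fun x => wt m d x * N2 (u j x t))
        (fun x => wt1 m d x * N2 (u j x t) + wt m d x * (2 * Re (Cconj (u j x t) * u (S j) x t)%C))
        (fun x => (Cw m + 1) * (wt m d x * N2 (u j x t)) + wt m d x * N2 (u (S j) x t))).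
      + intros y. apply (is_derive_mult (wt m d) (fun x => N2 (u j x t))).
        * now apply wt_derive.
        * destruct (proj2 Hu j y t) as [A1 A2]. unfold N2.
          replace (2 * Re (Cconj (u j y t) * u (S j) y t)%C) with
            ((Re (u (S j) y t) * Re (u j y t) + Re (u j y t) * Re (u (S j) y t))
             + (Im (u (S j) y t) * Im (u j y t) + Im (u j y t) * Im (u (S j) y t)))
            by (unfold Re, Im; simpl; ring).
          apply (is_derive_ext (fun x => Re (u j x t) * Re (u j x t) + Im (u j x t) * Im (u j x t)));
            [intros; simpl; ring |].
          apply (is_derive_plus (fun x => Re (u j x t) * Re (u j x t)) (fun x => Im (u j x t) * Im (u j x t))).
          -- apply (is_derive_mult (fun x => Re (u j x t)) (fun x => Re (u j x t))); auto. intros; apply Rmult_comm.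
          -- apply (is_derive_mult (fun x => Im (u j x t)) (fun x => Im (u j x t))); auto. intros; apply Rmult_comm.
        * intros; apply Rmult_comm.
      + intros y. apply (continuous_plus (fun x => wt1 m d x * N2 (u j x t))
          (fun x => wt m d x * (2 * Re (Cconj (u j x t) * u (S j) x t)%C))).
        * apply (continuous_mult (wt1 m d) (fun x => N2 (u j x t))).
          -- apply (ex_derive_continuous (wt1 m d)). eexists. now apply wt1_derive.
          -- apply N2_cont. now apply tower_cont.
        * apply (continuous_mult (wt m d) (fun x => 2 * Re (Cconj (u j x t) * u (S j) x t)%C)).
          -- apply (ex_derive_continuous (wt m d)). eexists. now apply wt_derive.
          -- apply Re_conj_cont; now apply tower_cont.
      + intros y. destruct (wt_bounds m d y Hd) as (b1 & _).
        pose proof (psi_ge1 d y Hd). pose proof (wt_pos m d y). pose proof (N2_pos (u j y t)).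
        assert (c1 : Rabs (wt1 m d y) <= Cw m * wt m d y) by (pose proof (Rabs_pos (wt1 m d y)); nra).
        eapply Rle_trans; [apply Rabs_triang |]. rewrite !Rabs_mult.
        rewrite (Rabs_pos_eq (N2 _)), (Rabs_pos_eq (wt m d y)), (Rabs_pos_eq 2) by lra.
        assert (hr : 2 * Rabs (Re (Cconj (u j y t) * u (S j) y t)%C) <= N2 (u j y t) + N2 (u (S j) y t)).
        { pose proof (Re_conj_le (u j y t) (u (S j) y t)) as Hq. rewrite Rabs_mult, (Rabs_pos_eq 2) in Hq by lra.
          eapply Rle_trans; [apply Hq |]. rewrite !N2_Cmod.
          pose proof (pow2_ge_0 (Cmod (u j y t) - Cmod (u (S j) y t))). lra. }
        assert (Rabs (wt1 m d y) * N2 (u j y t) <= Cw m * wt m d y * N2 (u j y t)) by now apply Rmult_le_compat_r.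
        assert (wt m d y * (2 * Rabs (Re (Cconj (u j y t) * u (S j) y t)%C))
           <= wt m d y * (N2 (u j y t) + N2 (u (S j) y t))) by (apply Rmult_le_compat_l; lra).
        lra.
      + apply dom_plus; auto. now apply dom_scal.
      + apply D1.
      + reflexivity.
    - rewrite (intR_plus (Rabs (Cw m + 1) * M1) M2); [| now apply dom_scal | auto].
      rewrite (intR_scal M1) by auto. specialize (B1 d t Hd Ht). specialize (B2 d t Hd Ht). unfold Z. nra. }
  set (Y := 2 ^ n * 2 ^ S n * Z).
  assert (p2 : 0 < 2 ^ n) by (apply pow_lt; lra). assert (p3 : 0 < 2 ^ S n) by (apply pow_lt; lra).
  assert (HY : 0 <= Y) by (unfold Y; apply Rmult_le_pos; auto; nra).
  exists (Y + 1). split; [lra |]. intros x t Ht.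
  set (d := om x).
  assert (Hd : 0 < d <= 1) by (unfold d; split; [apply om_pos | apply om_le1]).
  specialize (H d x t Hd Ht).
  pose proof (psi_sq d x ltac:(lra)) as Hp. pose proof (om_inv x) as Ho. fold d in Ho.
  assert (Hx : 0 <= x ^ 2) by apply pow2_ge_0.
  assert (Hp2 : 1 + x ^ 2 <= 2 * psi d x ^ 2) by (pose proof (pow2_ge_0 (psi d x)); nra).
  assert (Hw : (1 + x ^ 2) ^ n <= 2 ^ S n * wt m d x).
  { rewrite wt_psi. unfold m. rewrite pow_mult.
    replace (2 ^ S n * ((psi d x ^ 2) ^ S n * om x)) with ((2 * psi d x ^ 2) ^ S n * om x)
      by (rewrite Rpow_mult_distr; ring).
    apply Rle_trans with ((1 + x ^ 2) ^ S n * om x).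
    - simpl. fold d. replace ((1 + x * (x * 1)) * (1 + x * (x * 1)) ^ n * d)
        with ((d * (1 + x ^ 2)) * (1 + x * (x * 1)) ^ n) by ring. rewrite Ho. lra.
    - apply Rmult_le_compat_r; [left; apply om_pos |]. apply pow_incr. lra. }
  assert (Hq : (qq x ^ n) ^ 2 <= 2 ^ n * (1 + x ^ 2) ^ n).
  { rewrite <- pow_mult, Nat.mul_comm, pow_mult, <- Rpow_mult_distr.
    apply pow_incr. split; [apply pow2_ge_0 |]. unfold qq. rewrite <- (pow2_abs x).
    pose proof (pow2_ge_0 (Rabs x - 1)). nra. }
  assert (Hfin : (qq x ^ n * Cmod (u j x t)) ^ 2 <= Y).
  { rewrite Rpow_mult_distr, <- N2_Cmod. pose proof (N2_pos (u j x t)) as HN.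
    apply Rle_trans with (2 ^ n * (2 ^ S n * wt m d x) * N2 (u j x t)).
    - apply Rmult_le_compat_r; auto. eapply Rle_trans; [apply Hq |]. apply Rmult_le_compat_l; lra.
    - unfold Y. replace (2 ^ n * (2 ^ S n * wt m d x) * N2 (u j x t))
        with (2 ^ n * 2 ^ S n * (wt m d x * N2 (u j x t))) by ring.
      apply Rmult_le_compat_l; auto. nra. }
  set (y := qq x ^ n * Cmod (u j x t)) in *. nra.
Qed.

End Moments.

(** * Decay to the right *)
(** A logistic function: [sg' = - k sg (1 - sg)], so every derivative of [rw] is [rw] times a
    polynomial in [sg], whose values lie in [(0, 1]]. *)
Definition sg (k d x : R) : R := / (1 + d * exp (k * x)).
Definition rw (k d x : R) : R := exp (k * x) * sg k d x.
Definition rw1 (k d x : R) : R := k * rw k d x * sg k d x.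
Definition rw2 (k d x : R) : R := k ^ 2 * rw k d x * (sg k d x * (2 * sg k d x - 1)).
Definition rw3 (k d x : R) : R :=
  k ^ 3 * rw k d x * (sg k d x * (6 * sg k d x ^ 2 - 6 * sg k d x + 1)).

Lemma sg_bounds k d x : 0 < d -> 0 < sg k d x <= 1.
Proof.
  intros Hd. unfold sg. pose proof (exp_pos (k * x)).
  assert (0 < d * exp (k * x)) by nra. split.
  - apply Rinv_0_lt_compat. lra.
  - rewrite <- Rinv_1. apply Rinv_le_contravar; lra.
Qed.

Lemma rw_pos k d x : 0 < d -> 0 < rw k d x.
Proof. intros Hd. apply Rmult_lt_0_compat; [apply exp_pos | now apply sg_bounds]. Qed.

Lemma rw_le_exp k d x : 0 < d -> rw k d x <= exp (k * x).
Proof. intros Hd. unfold rw. pose proof (sg_bounds k d x Hd). pose proof (exp_pos (k * x)). nra. Qed.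

Lemma rw_le_inv k d x : 0 < d -> rw k d x <= / d.
Proof.
  intros Hd. unfold rw, sg. pose proof (exp_pos (k * x)).
  assert (H1 : 0 < 1 + d * exp (k * x)) by nra.
  apply Rmult_le_reg_r with (d * (1 + d * exp (k * x))); [nra |].
  replace (exp (k * x) * / (1 + d * exp (k * x)) * (d * (1 + d * exp (k * x)))) with (d * exp (k * x))
    by (field; lra).
  replace (/ d * (d * (1 + d * exp (k * x)))) with (1 + d * exp (k * x)) by (field; lra). lra.
Qed.

Lemma sg_derive k d x : 0 < d -> is_derive (sg k d) x (- k * sg k d x * (1 - sg k d x)).
Proof.
  intros Hd. unfold sg. pose proof (exp_pos (k * x)).
  assert (H1 : 0 < 1 + d * exp (k * x)) by nra.
  auto_derive; [lra |]. field. lra.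
Qed.

Lemma rw_derive k d x : 0 < d -> is_derive (rw k d) x (rw1 k d x).
Proof.
  intros Hd. unfold rw, rw1, sg, rw, sg. pose proof (exp_pos (k * x)).
  assert (H1 : 0 < 1 + d * exp (k * x)) by nra.
  auto_derive; [lra |]. field. lra.
Qed.

Lemma rw1_derive k d x : 0 < d -> is_derive (rw1 k d) x (rw2 k d x).
Proof.
  intros Hd. unfold rw1 at 1.
  replace (rw2 k d x) with (k * rw1 k d x * sg k d x + k * rw k d x * (- k * sg k d x * (1 - sg k d x)))
    by (unfold rw2, rw1; ring).
  apply (is_derive_mult (fun x => k * rw k d x) (sg k d)).
  - apply (is_derive_scal (rw k d)). now apply rw_derive.
  - now apply sg_derive.
  - intros; apply Rmult_comm.
Qed.

Lemma rw2_derive k d x : 0 < d -> is_derive (rw2 k d) x (rw3 k d x).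
Proof.
  intros Hd. unfold rw2 at 1.
  set (s := sg k d x). set (ds := - k * s * (1 - s)).
  replace (rw3 k d x) with (k ^ 2 * rw1 k d x * (s * (2 * s - 1))
      + k ^ 2 * rw k d x * (ds * (2 * s - 1) + s * (2 * ds)))
    by (unfold rw3, rw1, ds; fold s; ring).
  apply (is_derive_mult (fun x => k ^ 2 * rw k d x) (fun x => sg k d x * (2 * sg k d x - 1))).
  - apply (is_derive_scal (rw k d)). now apply rw_derive.
  - pose proof (sg_derive k d x Hd) as H. fold s in H. fold ds in H.
    apply (is_derive_mult (sg k d) (fun x => 2 * sg k d x - 1)); auto.
    + replace (2 * ds) with (2 * ds - 0) by ring.
      apply (is_derive_minus (fun x => 2 * sg k d x) (fun _ => 1)).
      * now apply (is_derive_scal (sg k d)).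
      * apply (is_derive_const 1).
    + intros; apply Rmult_comm.
  - intros; apply Rmult_comm.
Qed.

Lemma rw3_cont k d x : 0 < d -> continuous (rw3 k d) x.
Proof.
  intros Hd. apply (ex_derive_continuous (rw3 k d)). unfold rw3, rw, sg.
  pose proof (exp_pos (k * x)). assert (H1 : 0 < 1 + d * exp (k * x)) by nra.
  auto_derive. repeat split; lra.
Qed.

(** The polynomials in [sg] are at most [1] in absolute value on [[0, 1]]. The constant [1] before
    [k ^ 3] makes the leading growth rate [beta k^3], and the sign of [rw1] gives the dispersive
    term its sign. *)
Lemma rw_bounds k d x : 0 < k -> 0 < d ->
  0 <= rw1 k d x <= k * rw k d x /\ Rabs (rw2 k d x) <= k ^ 2 * rw k d x /\
  Rabs (rw3 k d x) <= k ^ 3 * rw k d x.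
Proof.
  intros Hk Hd. pose proof (sg_bounds k d x Hd) as Hs. pose proof (rw_pos k d x Hd) as Hw.
  unfold rw1, rw2, rw3. set (s := sg k d x) in *. set (w := rw k d x) in *.
  assert (0 < k * w) by nra.
  split; [split; nra |].
  assert (key : forall n l, Rabs l <= 1 -> Rabs (k ^ n * w * l) <= k ^ n * w).
  { intros n l Hl. pose proof (pow_lt k n Hk). assert (0 < k ^ n * w) by nra.
    rewrite Rabs_mult, (Rabs_pos_eq (k ^ n * w)) by lra. nra. }
  split; apply key; apply Rabs_le; [split; nra |].
  assert (-1 <= 6 * s ^ 2 - 6 * s + 1 <= 1) by (pose proof (pow2_ge_0 (s - 1 / 2)); split; nra).
  split; nra.
Qed.

Lemma gauss_om x : exp (- x ^ 2 / 4) <= 4 * om x.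
Proof.
  pose proof (exp_ge_1plus (x ^ 2 / 4)) as H.
  assert (E : exp (- x ^ 2 / 4) * exp (x ^ 2 / 4) = 1)
    by (rewrite <- exp_plus; replace (- x ^ 2 / 4 + x ^ 2 / 4) with 0 by field; apply exp_0).
  apply Rmult_le_reg_r with (1 + x ^ 2); [pose proof (pow2_ge_0 x); lra |].
  rewrite Rmult_assoc, om_inv. nra.
Qed.

Section RightDecay.
Context (alpha beta T : R) (u V : nat -> R -> R -> C).
Context (HT : 0 < T <= 1) (Hbeta : 0 < beta) (Hu : tower u) (HV : tower V).
Context (Hrem : forall j, exists K, 0 <= K /\ forall x s t, 0 <= s <= T -> 0 <= t <= T ->
      Cmod (u j x s - u j x t - RtoC (s - t) * rhs_t alpha beta u V j x t) <= K * (s - t) ^ 2).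
Context (Hsch : forall j n, exists K, 0 <= K /\
  forall x t, 0 <= t <= T -> qq x ^ n * Cmod (u j x t) <= K).
Context (c : R) (Hc : 0 < c) (Hinit : forall x, u 0%nat x 0 = RtoC (c * exp (- x ^ 2 / 4))).

Lemma om2_bound j : exists K, 0 <= K /\ forall x t, 0 <= t <= T -> Cmod (u j x t) <= K * om x ^ 2.
Proof.
  destruct (Hsch j 4) as [K [HK B]]. exists K. split; auto. intros x t Ht. specialize (B x t Ht).
  pose proof (Cmod_ge_0 (u j x t)) as Hn. pose proof (om_inv x) as Ho.
  assert (Hq : (1 + x ^ 2) ^ 2 <= qq x ^ 4).
  { replace (qq x ^ 4) with ((qq x ^ 2) ^ 2) by ring. apply pow_incr. split.
    - pose proof (pow2_ge_0 x); lra.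
    - unfold qq. rewrite <- (pow2_abs x). pose proof (Rabs_pos x). nra. }
  assert (B2 : (1 + x ^ 2) ^ 2 * Cmod (u j x t) <= K).
  { eapply Rle_trans; [| apply B]. now apply Rmult_le_compat_r. }
  replace (Cmod (u j x t)) with ((om x * (1 + x ^ 2)) ^ 2 * Cmod (u j x t)) by (rewrite Ho; ring).
  replace ((om x * (1 + x ^ 2)) ^ 2 * Cmod (u j x t)) with (((1 + x ^ 2) ^ 2 * Cmod (u j x t)) * om x ^ 2) by ring.
  apply Rmult_le_compat_r; [apply pow2_ge_0 | auto].
Qed.

Lemma all_om2 : exists K, 0 <= K /\ forall x t, 0 <= t <= T ->
  Cmod (u 0 x t) <= K * om x ^ 2 /\ Cmod (u 1 x t) <= K * om x ^ 2 /\ Cmod (u 2 x t) <= K * om x ^ 2 /\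
  Cmod (u 3 x t) <= K * om x ^ 2 /\ Cmod (Pr u V 0 0 0 x t) <= K * om x ^ 2 /\
  Cmod (rhs_t alpha beta u V 0 x t) <= K * om x ^ 2.
Proof.
  destruct (om2_bound 0) as [K0 [h0 B0]]. destruct (om2_bound 1) as [K1 [h1 B1]].
  destruct (om2_bound 2) as [K2 [h2 B2]]. destruct (om2_bound 3) as [K3 [h3 B3]].
  destruct (proj1 HV 0%nat) as [Kv [hv Bv]].
  pose proof (Rabs_pos alpha) as ha. pose proof (Rabs_pos beta) as hb.
  assert (g1 : 0 <= Rabs alpha * K2) by nra. assert (g2 : 0 <= Rabs beta * K3) by nra.
  assert (g3 : 0 <= K0 * Kv) by nra.
  exists (K0 + K1 + K2 + K3 + K0 * Kv + Rabs alpha * K2 + Rabs beta * K3). split; [lra |].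
  intros x t Ht. specialize (B0 x t Ht); specialize (B1 x t Ht); specialize (B2 x t Ht);
    specialize (B3 x t Ht); specialize (Bv x t).
  set (o := om x ^ 2) in *. assert (ho : 0 <= o) by apply pow2_ge_0.
  assert (BP : Cmod (Pr u V 0 0 0 x t) <= K0 * Kv * o).
  { simpl. rewrite Cmod_mult. replace (K0 * Kv * o) with (K0 * o * Kv) by ring.
    apply Rmult_le_compat; auto using Cmod_ge_0. }
  assert (f0 : 0 <= K0 * o) by nra. assert (f1 : 0 <= K1 * o) by nra. assert (f2 : 0 <= K2 * o) by nra.
  assert (f3 : 0 <= K3 * o) by nra. assert (f4 : 0 <= K0 * Kv * o) by nra.
  assert (f5 : 0 <= Rabs alpha * K2 * o) by nra. assert (f6 : 0 <= Rabs beta * K3 * o) by nra.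
  repeat split; try lra.
  unfold rhs_t. eapply Rle_trans; [apply Cmod_triangle |].
  eapply Rle_trans; [apply Rplus_le_compat_r, Cmod_minus_le |].
  rewrite Cmod_opp, !Cmod_mult, Cmod_Ci, !Cmod_R, Rmult_1_l.
  assert (Rabs alpha * Cmod (u 2 x t) <= Rabs alpha * (K2 * o)) by now apply Rmult_le_compat_l.
  assert (Rabs beta * Cmod (u 3 x t) <= Rabs beta * (K3 * o)) by now apply Rmult_le_compat_l.
  lra.
Qed.

Lemma rw_cont k d x : 0 < d -> continuous (rw k d) x.
Proof. intros Hd. apply (ex_derive_continuous (rw k d)). eexists. now apply rw_derive. Qed.

Lemma om2_le x : om x ^ 2 <= om x.
Proof. pose proof (om_pos x). pose proof (om_le1 x). nra. Qed.

Lemma om4_le x : om x ^ 2 * om x ^ 2 <= om x.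
Proof. pose proof (om2_le x). nra. Qed.

Lemma dom_bounded_weight (w f : R -> R) A B : (forall x, continuous w x) -> (forall x, continuous f x) ->
  (forall x, Rabs (w x) <= A) -> (forall x, Rabs (f x) <= B * om x) -> dom (A * B) (fun x => w x * f x).
Proof.
  intros Hw Hf HA HB. split; intros x.
  - apply (continuous_mult w f); auto.
  - rewrite Rabs_mult. specialize (HA x). specialize (HB x). rewrite Rmult_assoc.
    apply Rmult_le_compat; auto using Rabs_pos.
Qed.

Lemma rw_dom k d t : 0 < d -> 0 <= t <= T -> exists M, dom M (fun x => rw k d x * N2 (u 0%nat x t)).
Proof.
  intros Hd Ht. destruct all_om2 as [K [HK B]]. exists (/ d * K ^ 2).
  apply dom_bounded_weight.
  - intros; now apply rw_cont.
  - apply N2_cont. now apply tower_cont.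
  - intros x. rewrite Rabs_pos_eq by (left; now apply rw_pos). now apply rw_le_inv.
  - intros x. rewrite Rabs_pos_eq by apply N2_pos. destruct (B x t Ht) as (b & _).
    eapply Rle_trans; [apply N2_le, b |]. pose proof (om4_le x). pose proof (pow2_ge_0 K).
    replace ((K * om x ^ 2) ^ 2) with (K ^ 2 * (om x ^ 2 * om x ^ 2)) by ring.
    now apply Rmult_le_compat_l.
Qed.

(** This weight is bounded but not integrable, and [Hrem] gives no decay in [x]; the integrability
    comes from the Schwartz bounds. *)
Lemma right_energy_diff k d : 0 < d ->
  diff_on T (fun t => intR (fun x => rw k d x * N2 (u 0%nat x t)))
    (fun t => intR (fun x => rw k d x * (2 * Re (Cconj (u 0%nat x t) * rhs_t alpha beta u V 0 x t)%C))).
Proof.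
  intros Hd. destruct all_om2 as [K [HK B]]. destruct (Hrem 0) as [Kr [HKr R]].
  set (q := K + Kr). assert (Hq : 0 <= q) by (unfold q; lra).
  assert (Hid : 0 < / d) by now apply Rinv_0_lt_compat.
  assert (Hw : forall x, Rabs (rw k d x) <= / d).
  { intros x. rewrite Rabs_pos_eq by (left; now apply rw_pos). now apply rw_le_inv. }
  apply (intR_diff_on T (fun x t => rw k d x * N2 (u 0%nat x t))
    (fun x t => rw k d x * (2 * Re (Cconj (u 0%nat x t) * rhs_t alpha beta u V 0 x t)%C)) (/ d * (6 * q ^ 2))).
  - pose proof (pow2_ge_0 q). apply Rmult_le_pos; lra.
  - intros t Ht. now apply rw_dom.
  - intros t Ht. exists (/ d * (2 * K ^ 2)). apply dom_bounded_weight; auto.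
    + intros; now apply rw_cont.
    + apply Re_conj_cont; [now apply tower_cont |]. unfold rhs_t.
      apply Ccont_plus; [| now apply Pr_cont]. apply Ccont_minus.
      * apply Ccont_opp, Ccont_mult; [apply Ccont_const | now apply tower_cont].
      * apply Ccont_mult; [apply Ccont_const | now apply tower_cont].
    + intros x. eapply Rle_trans; [apply Re_conj_le |]. destruct (B x t Ht) as (b & _ & _ & _ & _ & b').
      pose proof (om4_le x). pose proof (pow2_ge_0 K).
      apply Rle_trans with (2 * ((K * om x ^ 2) * (K * om x ^ 2))).
      * apply Rmult_le_compat_l; [lra |]. apply Rmult_le_compat; auto using Cmod_ge_0.
      * replace (2 * (K * om x ^ 2 * (K * om x ^ 2))) with (2 * K ^ 2 * (om x ^ 2 * om x ^ 2)) by ring.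
        apply Rmult_le_compat_l; lra.
  - intros s t x Hs Ht.
    assert (Hr : Rabs (s - t) <= 1) by (apply Rabs_le; lra).
    replace (rw k d x * N2 (u 0%nat x s) - rw k d x * N2 (u 0%nat x t) -
       (s - t) * (rw k d x * (2 * Re (Cconj (u 0%nat x t) * rhs_t alpha beta u V 0 x t)%C)))
      with (rw k d x * (N2 (u 0%nat x s) - N2 (u 0%nat x t) -
         (s - t) * (2 * Re (Cconj (u 0%nat x t) * rhs_t alpha beta u V 0 x t)%C))) by ring.
    set (Q := N2 (u 0%nat x s) - N2 (u 0%nat x t) -
         (s - t) * (2 * Re (Cconj (u 0%nat x t) * rhs_t alpha beta u V 0 x t)%C)).
    rewrite Rabs_mult, !Rmult_assoc. apply Rmult_le_compat; auto using Rabs_pos.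
    destruct (B x s Hs) as (bs & _). destruct (B x t Ht) as (bt & _ & _ & _ & _ & bd).
    pose proof (om_pos x) as Ho. pose proof (om_le1 x) as Ho1.
    assert (Hq2 : 0 <= q ^ 2) by apply pow2_ge_0.
    assert (HKq : K * om x ^ 2 <= q * om x ^ 2)
      by (apply Rmult_le_compat_r; [apply pow2_ge_0 | unfold q; lra]).
    assert (HKq1 : q * om x ^ 2 <= q) by (pose proof (om2_le x); nra).
    (* [Q] is quadratically small in time and decays like [om^4], so it is bounded by their weighted geometric mean. *)
    assert (Q1 : Rabs Q <= 6 * q ^ 2 * (s - t) ^ 2).
    { apply N2_time_rem; auto; try lra.
      eapply Rle_trans; [now apply R |]. pose proof (pow2_ge_0 (s - t)). unfold q. nra. }
    assert (Q2 : Rabs Q <= 6 * q ^ 2 * (om x ^ 2) ^ 2).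
    { unfold Q. eapply Rle_trans; [apply Rabs_triang |]. rewrite Rabs_Ropp, (Rabs_mult (s - t)).
      eapply Rle_trans; [apply Rplus_le_compat_r, Rabs_triang |].
      rewrite Rabs_Ropp, !(Rabs_pos_eq (N2 _)) by apply N2_pos.
      pose proof (N2_le _ _ (Rle_trans _ _ _ bs HKq)). pose proof (N2_le _ _ (Rle_trans _ _ _ bt HKq)).
      assert (Rabs (2 * Re (Cconj (u 0%nat x t) * rhs_t alpha beta u V 0 x t)%C) <= 2 * (q * om x ^ 2) ^ 2).
      { eapply Rle_trans; [apply Re_conj_le |]. apply Rmult_le_compat_l; [lra |].
        replace ((q * om x ^ 2) ^ 2) with ((q * om x ^ 2) * (q * om x ^ 2)) by ring.
        apply Rmult_le_compat; auto using Cmod_ge_0; lra. }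
      pose proof (Rabs_pos (2 * Re (Cconj (u 0%nat x t) * rhs_t alpha beta u V 0 x t)%C)).
      assert (Rabs (s - t) * Rabs (2 * Re (Cconj (u 0%nat x t) * rhs_t alpha beta u V 0 x t)%C)
          <= 2 * (q * om x ^ 2) ^ 2) by (pose proof (Rabs_pos (s - t)); nra).
      replace (6 * q ^ 2 * (om x ^ 2) ^ 2) with (6 * (q * om x ^ 2) ^ 2) by ring. lra. }
    set (h := Rabs (s - t)) in *. set (r := sqrt h). set (o := om x) in *.
    assert (Hh : 0 <= h) by apply Rabs_pos.
    assert (Hr2 : r * r = h) by now apply sqrt_sqrt. assert (Hr0 : 0 <= r) by apply sqrt_pos.
    replace ((s - t) ^ 2) with (r ^ 4) in Q1
      by (rewrite <- (pow2_abs (s - t)); fold h; rewrite <- Hr2; ring).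
    replace (6 * (q ^ 2 * (h * (r * o)))) with (6 * q ^ 2 * (r ^ 3 * o)) by (rewrite <- Hr2; ring).
    (* The smaller of [r^4] and [o^4] is at most [r^3 o], that is [|s - t|^(3/2) om x]. *)
    destruct (Rle_lt_dec r o) as [Hro | Hro].
    + eapply Rle_trans; [apply Q1 |]. apply Rmult_le_compat_l; [lra |].
      replace (r ^ 4) with (r ^ 3 * r) by ring. apply Rmult_le_compat_l; [now apply pow_le | auto].
    + eapply Rle_trans; [apply Q2 |]. apply Rmult_le_compat_l; [lra |].
      replace ((o ^ 2) ^ 2) with (o ^ 3 * o) by ring. apply Rmult_le_compat_r; [lra |].
      apply pow_incr. lra.
Qed.

Context (Kv : R) (HKv : forall x t, Cmod (V 0%nat x t) <= Kv).

(** The three terms come from [w'''], from the cross term after absorption into the dispersive one,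
    and from the potential. *)
Definition rate (k : R) : R := beta * k ^ 3 + alpha ^ 2 / (3 * beta) * k + 2 * Kv.

Lemma Kv_nonneg : 0 <= Kv.
Proof. eapply Rle_trans; [apply Cmod_ge_0 | apply (HKv 0 0)]. Qed.

Lemma right_flux k d t : 0 < k -> 0 < d -> 0 <= t <= T ->
  intR (fun x => rw k d x * (2 * Re (Cconj (u 0%nat x t) * rhs_t alpha beta u V 0 x t)%C))
  <= rate k * intR (fun x => rw k d x * N2 (u 0%nat x t)).
Proof.
  intros Hk Hd Ht. destruct all_om2 as [K [HK B]].
  set (v := fun x => u 0%nat x t). set (v1 := fun x => u 1%nat x t).
  set (P := fun x => Pr u V 0 0 0 x t).
  set (A := (1 + k + k ^ 2 + k ^ 3) * / d).
  pose proof (pow_lt k 2 Hk) as k2. pose proof (pow_lt k 3 Hk) as k3.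
  assert (key : forall w l x, l <= 1 + k + k ^ 2 + k ^ 3 -> 0 <= l -> Rabs w <= l * rw k d x ->
      Rabs w * (K * om x ^ 2) ^ 2 <= A * K ^ 2 * om x).
  { intros w l x Hl Hl0 Hw. pose proof (om4_le x). pose proof (pow2_ge_0 K).
    pose proof (rw_le_inv k d x Hd). pose proof (rw_pos k d x Hd).
    assert (Rabs w <= A).
    { eapply Rle_trans; [apply Hw |]. unfold A. apply Rmult_le_compat; lra. }
    replace ((K * om x ^ 2) ^ 2) with (K ^ 2 * (om x ^ 2 * om x ^ 2)) by ring.
    rewrite (Rmult_assoc A). apply Rmult_le_compat; auto using Rabs_pos.
    - apply Rmult_le_pos; [auto |]. apply Rmult_le_pos; apply pow2_ge_0.
    - now apply Rmult_le_compat_l. }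
  assert (b0 : forall x, Rabs (rw k d x) * (K * om x ^ 2) ^ 2 <= A * K ^ 2 * om x).
  { intros x. apply (key _ 1); try lra. rewrite Rabs_pos_eq by (left; now apply rw_pos). lra. }
  assert (b1 : forall x, Rabs (rw1 k d x) * (K * om x ^ 2) ^ 2 <= A * K ^ 2 * om x).
  { intros x. destruct (rw_bounds k d x Hk Hd) as ((e1 & e2) & _).
    apply (key _ k); try lra. rewrite Rabs_pos_eq; auto. }
  assert (b2 : forall x, Rabs (rw2 k d x) * (K * om x ^ 2) ^ 2 <= A * K ^ 2 * om x).
  { intros x. destruct (rw_bounds k d x Hk Hd) as (_ & e & _). apply (key _ (k ^ 2)); lra. }
  assert (b3 : forall x, Rabs (rw3 k d x) * (K * om x ^ 2) ^ 2 <= A * K ^ 2 * om x).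
  { intros x. destruct (rw_bounds k d x Hk Hd) as (_ & _ & e). apply (key _ (k ^ 3)); lra. }
  pose proof (fun x => rw_derive k d x Hd) as W1.
  pose proof (fun x => rw1_derive k d x Hd) as W2.
  pose proof (fun x => rw2_derive k d x Hd) as W3.
  pose proof (fun x => rw3_cont k d x Hd) as W4.
  destruct Hu as [_ Du].
  assert (E : intR (fun x => rw k d x * (2 * Re (Cconj (u 0%nat x t) * rhs_t alpha beta u V 0 x t)%C))
     = intR (flux_rhs alpha beta (rw k d) (rw1 k d) (rw3 k d) v v1 P)).
  { apply (flux_identity alpha beta (rw k d) (rw1 k d) (rw2 k d) (rw3 k d)
      v v1 (fun x => u 2%nat x t) (fun x => u 3%nat x t) P (fun x => K * om x ^ 2) (A * K ^ 2));
      auto; try (intros x; apply (B x t Ht)); try (intros x; apply Du);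
      [now apply tower_cont | now apply Pr_cont]. }
  assert (D : exists M, dom M (flux_rhs alpha beta (rw k d) (rw1 k d) (rw3 k d) v v1 P)).
  { apply (flux_rhs_dom alpha beta (rw k d) (rw1 k d) (rw2 k d) (rw3 k d)
      v v1 (fun x => u 2%nat x t) P (fun x => K * om x ^ 2) (A * K ^ 2));
      auto; try (intros x; apply (B x t Ht)); try (intros x; apply Du).
      now apply Pr_cont. }
  rewrite E. destruct D as [M D]. destruct (rw_dom k d t Hd Ht) as [M' D'].
  rewrite <- (intR_scal M') by auto.
  apply (intR_le M (Rabs (rate k) * M')); auto; [now apply dom_scal |].
  intros x. unfold flux_rhs. fold (v x).
  destruct (rw_bounds k d x Hk Hd) as ((e1 & e2) & _ & e3). pose proof (rw_pos k d x Hd) as Hw.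
  pose proof (N2_pos (v x)) as hv.
  assert (f3 : rw3 k d x * N2 (v x) <= k ^ 3 * rw k d x * N2 (v x)).
  { apply Rmult_le_compat_r; auto. eapply Rle_trans; [apply Rle_abs | auto]. }
  (* AM-GM: the dispersive term [-3 beta w' |v_x|^2] absorbs the cross term. *)
  assert (f1 : - 3 * beta * (rw1 k d x * N2 (v1 x)) - 2 * alpha * (rw1 k d x * cross (v x) (v1 x))
      <= alpha ^ 2 / (3 * beta) * (rw1 k d x * N2 (v x))).
  { replace (- 3 * beta * (rw1 k d x * N2 (v1 x)) - 2 * alpha * (rw1 k d x * cross (v x) (v1 x)))
      with (rw1 k d x * (- 3 * beta * N2 (v1 x) - 2 * alpha * cross (v x) (v1 x))) by ring.
    replace (alpha ^ 2 / (3 * beta) * (rw1 k d x * N2 (v x)))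
      with (rw1 k d x * (alpha ^ 2 / (3 * beta) * N2 (v x))) by ring.
    apply Rmult_le_compat_l; auto.
    apply Rmult_le_reg_l with (3 * beta); [lra |].
    replace (3 * beta * (alpha ^ 2 / (3 * beta) * N2 (v x))) with (alpha ^ 2 * N2 (v x)) by (field; lra).
    unfold N2, cross.
    pose proof (pow2_ge_0 (3 * beta * Im (v1 x) + alpha * Re (v x))).
    pose proof (pow2_ge_0 (3 * beta * Re (v1 x) - alpha * Im (v x))). nra. }
  assert (f2 : alpha ^ 2 / (3 * beta) * (rw1 k d x * N2 (v x)) <= alpha ^ 2 / (3 * beta) * k * (rw k d x * N2 (v x))).
  { replace (alpha ^ 2 / (3 * beta) * k * (rw k d x * N2 (v x)))
      with (alpha ^ 2 / (3 * beta) * (k * rw k d x * N2 (v x))) by ring.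
    apply Rmult_le_compat_l.
    - apply Rmult_le_pos; [apply pow2_ge_0 | left; apply Rinv_0_lt_compat; lra].
    - now apply Rmult_le_compat_r. }
  assert (f4 : rw k d x * (2 * Re (Cconj (v x) * P x)%C) <= 2 * Kv * (rw k d x * N2 (v x))).
  { replace (2 * Kv * (rw k d x * N2 (v x))) with (rw k d x * (2 * (N2 (v x) * Kv))) by ring.
    apply Rmult_le_compat_l; [lra |]. eapply Rle_trans; [apply Rle_abs |].
    eapply Rle_trans; [apply Re_conj_le |]. apply Rmult_le_compat_l; [lra |].
    unfold P. simpl. fold (v x). rewrite Cmod_mult, N2_Cmod.
    replace (Cmod (v x) ^ 2 * Kv) with (Cmod (v x) * (Cmod (v x) * Kv)) by ring.
    apply Rmult_le_compat_l; [apply Cmod_ge_0 |]. apply Rmult_le_compat_l; [apply Cmod_ge_0 | apply HKv]. }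
  unfold rate.
  assert (beta * (rw3 k d x * N2 (v x)) <= beta * (k ^ 3 * rw k d x * N2 (v x))) by (apply Rmult_le_compat_l; lra).
  lra.
Qed.

(** One factor [exp (- x^2 / 4)] of [|u|^2] is spent on the weight, by
    [k x - x^2 / 4 = k^2 - (k - x / 2)^2]; the other gives integrability. *)
Lemma right_init k d : 0 < d -> intR (fun x => rw k d x * N2 (u 0%nat x 0)) <= 4 * PI * c ^ 2 * exp (k ^ 2).
Proof.
  intros Hd. destruct (rw_dom k d 0 Hd ltac:(lra)) as [M [D1 D2]].
  eapply Rle_trans; [apply Rle_abs |].
  replace (4 * PI * c ^ 2 * exp (k ^ 2)) with (PI * (4 * c ^ 2 * exp (k ^ 2))) by ring.
  apply intR_bound. split; auto. intros x.
  rewrite Rabs_pos_eq by (apply Rmult_le_pos; [left; now apply rw_pos | apply N2_pos]).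
  rewrite Hinit, N2_Cmod, Cmod_R, Rabs_pos_eq by (pose proof (exp_pos (- x ^ 2 / 4)); nra).
  pose proof (rw_le_exp k d x Hd) as Hw. pose proof (rw_pos k d x Hd).
  set (g := exp (- x ^ 2 / 4)). assert (Hg : 0 < g) by apply exp_pos.
  apply Rle_trans with (exp (k * x) * (c * g) ^ 2).
  - apply Rmult_le_compat_r; [apply pow2_ge_0 | auto].
  - replace (exp (k * x) * (c * g) ^ 2) with (c ^ 2 * (exp (k * x) * g * g)) by ring.
    replace (4 * c ^ 2 * exp (k ^ 2) * om x) with (c ^ 2 * (exp (k ^ 2) * (4 * om x))) by ring.
    apply Rmult_le_compat_l; [apply pow2_ge_0 |].
    apply Rmult_le_compat; try lra.
    + nra.
    + unfold g. rewrite <- exp_plus. apply exp_le. pose proof (pow2_ge_0 (k - x / 2)). nra.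
    + apply gauss_om.
Qed.

Lemma right_energy k d t : 0 < k -> 0 < d -> 0 <= t <= T ->
  intR (fun x => rw k d x * N2 (u 0%nat x t)) <= exp (rate k * T) * (4 * PI * c ^ 2 * exp (k ^ 2)).
Proof.
  intros Hk Hd Ht.
  assert (Hl : 0 <= rate k).
  { unfold rate. pose proof Kv_nonneg. pose proof (pow_lt k 3 Hk).
    assert (0 <= alpha ^ 2 / (3 * beta)) by (apply Rmult_le_pos; [apply pow2_ge_0 | left; apply Rinv_0_lt_compat; lra]).
    assert (0 <= alpha ^ 2 / (3 * beta) * k) by (apply Rmult_le_pos; lra).
    assert (0 <= beta * k ^ 3) by (apply Rmult_le_pos; lra). lra. }
  pose proof (gronwall T _ _ (rate k) 0 (proj1 HT) Hl (Rle_refl 0) (right_energy_diff k d Hd)) as G.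
  cbv beta in G. eapply Rle_trans; [apply G; auto |].
  - intros r Hr. rewrite Rplus_0_r. now apply right_flux.
  - rewrite Rmult_0_l, Rplus_0_r. destruct (rw_dom k d 0 Hd ltac:(lra)) as [M D].
    apply Rmult_le_compat.
    + left; apply exp_pos.
    + apply (intR_pos M); auto. intros x. apply Rmult_le_pos; [left; now apply rw_pos | apply N2_pos].
    + apply exp_le. apply Rmult_le_compat_l; lra.
    + now apply right_init.
Qed.

(* The fourth power is used because the derivative of [w |u|^4] is controlled by [w |u|^2] alone,
   without a weighted bound on [u_x]. *)
Lemma right_pointwise : exists K, 0 < K /\ forall k x t, 0 < k -> 0 <= t <= T ->
  Cmod (u 0%nat x t) ^ 4 <= K * ((1 + k) * exp (rate k * T + k ^ 2 - k * x)).
Proof.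
  destruct all_om2 as [K [HK B]].
  set (q := K ^ 2 + 1). assert (Hq : 0 < q) by (unfold q; pose proof (pow2_ge_0 K); lra).
  exists (2 * (4 * q) * (4 * PI * c ^ 2)).
  pose proof PI_RGT_0 as Hpi. pose proof (pow_lt c 2 Hc) as Hc2.
  assert (HPc : 0 < 4 * PI * c ^ 2) by (apply Rmult_lt_0_compat; lra).
  split; [apply Rmult_lt_0_compat; lra |].
  (* With this [d] the denominator of the weight equals [2] at the point [x]. *)
  intros k x t Hk Ht. set (d := exp (- (k * x))). assert (Hd : 0 < d) by apply exp_pos.
  destruct (rw_dom k d t Hd Ht) as [M D].
  assert (BN : forall y, N2 (u 0%nat y t) <= K ^ 2).
  { intros y. apply N2_le. destruct (B y t Ht) as (b & _).
    eapply Rle_trans; [apply b |]. pose proof (om2_le y). pose proof (om_le1 y). nra. }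
  assert (BR : forall y, Rabs (2 * Re (Cconj (u 0%nat y t) * u 1%nat y t)%C) <= 2 * K ^ 2).
  { intros y. eapply Rle_trans; [apply Re_conj_le |]. destruct (B y t Ht) as (b & b' & _).
    pose proof (om2_le y). pose proof (om_le1 y).
    replace (2 * K ^ 2) with (2 * (K * K)) by ring. apply Rmult_le_compat_l; [lra |].
    apply Rmult_le_compat; auto using Cmod_ge_0; nra. }
  assert (G : rw k d x * (N2 (u 0%nat x t) * N2 (u 0%nat x t))
      <= intR (fun y => 4 * q * (1 + k) * (rw k d y * N2 (u 0%nat y t)))).
  { apply (pointwise_le_intR (Rabs (4 * q * (1 + k)) * M) (M * K ^ 2) _
      (fun y => rw k d y * (N2 (u 0%nat y t) * N2 (u 0%nat y t)))
      (fun y => rw1 k d y * (N2 (u 0%nat y t) * N2 (u 0%nat y t)) + rw k d y *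
         (2 * Re (Cconj (u 0%nat y t) * u 1%nat y t)%C * N2 (u 0%nat y t)
          + N2 (u 0%nat y t) * (2 * Re (Cconj (u 0%nat y t) * u 1%nat y t)%C)))
      (fun y => 4 * q * (1 + k) * (rw k d y * N2 (u 0%nat y t)))).
    - intros y.
      assert (HN : is_derive (fun y => N2 (u 0%nat y t)) y (2 * Re (Cconj (u 0%nat y t) * u 1%nat y t)%C)).
      { destruct (proj2 Hu 0%nat y t) as [A1 A2]. unfold N2.
        replace (2 * Re (Cconj (u 0%nat y t) * u 1%nat y t)%C) with
            ((Re (u 1%nat y t) * Re (u 0%nat y t) + Re (u 0%nat y t) * Re (u 1%nat y t))
             + (Im (u 1%nat y t) * Im (u 0%nat y t) + Im (u 0%nat y t) * Im (u 1%nat y t)))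
            by (unfold Re, Im; simpl; ring).
        apply (is_derive_ext (fun x => Re (u 0%nat x t) * Re (u 0%nat x t) + Im (u 0%nat x t) * Im (u 0%nat x t)));
            [intros; simpl; ring |].
        apply (is_derive_plus (fun x => Re (u 0%nat x t) * Re (u 0%nat x t)) (fun x => Im (u 0%nat x t) * Im (u 0%nat x t))).
        - apply (is_derive_mult (fun x => Re (u 0%nat x t)) (fun x => Re (u 0%nat x t))); auto. intros; apply Rmult_comm.
        - apply (is_derive_mult (fun x => Im (u 0%nat x t)) (fun x => Im (u 0%nat x t))); auto. intros; apply Rmult_comm. }
      apply (is_derive_mult (rw k d) (fun y => N2 (u 0%nat y t) * N2 (u 0%nat y t))).
      + now apply rw_derive.
      + apply (is_derive_mult (fun y => N2 (u 0%nat y t)) (fun y => N2 (u 0%nat y t))); auto. intros; apply Rmult_comm.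
      + intros; apply Rmult_comm.
    - intros y.
      pose proof (N2_cont _ (tower_cont u 0 t Hu)) as CN.
      pose proof (Re_conj_cont _ _ (tower_cont u 0 t Hu) (tower_cont u 1 t Hu)) as CR.
      apply (continuous_plus (fun y => rw1 k d y * (N2 (u 0%nat y t) * N2 (u 0%nat y t)))
        (fun y => rw k d y * (2 * Re (Cconj (u 0%nat y t) * u 1%nat y t)%C * N2 (u 0%nat y t)
          + N2 (u 0%nat y t) * (2 * Re (Cconj (u 0%nat y t) * u 1%nat y t)%C)))).
      + apply (continuous_mult (rw1 k d) (fun y => N2 (u 0%nat y t) * N2 (u 0%nat y t))).
        * apply (ex_derive_continuous (rw1 k d)). eexists. now apply rw1_derive.
        * apply (continuous_mult (fun y => N2 (u 0%nat y t)) (fun y => N2 (u 0%nat y t))); auto.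
      + apply (continuous_mult (rw k d) (fun y => 2 * Re (Cconj (u 0%nat y t) * u 1%nat y t)%C * N2 (u 0%nat y t)
          + N2 (u 0%nat y t) * (2 * Re (Cconj (u 0%nat y t) * u 1%nat y t)%C))); [now apply rw_cont |].
        apply (continuous_plus (fun y => 2 * Re (Cconj (u 0%nat y t) * u 1%nat y t)%C * N2 (u 0%nat y t))
          (fun y => N2 (u 0%nat y t) * (2 * Re (Cconj (u 0%nat y t) * u 1%nat y t)%C))).
        * apply (continuous_mult (fun y => 2 * Re (Cconj (u 0%nat y t) * u 1%nat y t)%C) (fun y => N2 (u 0%nat y t))); auto.
        * apply (continuous_mult (fun y => N2 (u 0%nat y t)) (fun y => 2 * Re (Cconj (u 0%nat y t) * u 1%nat y t)%C)); auto.
    - intros y. destruct (rw_bounds k d y Hk Hd) as ((e1 & e2) & _). pose proof (rw_pos k d y Hd) as Hw.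
      pose proof (N2_pos (u 0%nat y t)) as hN. specialize (BN y). specialize (BR y).
      set (N := N2 (u 0%nat y t)) in *. set (r := 2 * Re (Cconj (u 0%nat y t) * u 1%nat y t)%C) in *.
      eapply Rle_trans; [apply Rabs_triang |]. rewrite !Rabs_mult.
      rewrite (Rabs_pos_eq (rw1 k d y)), (Rabs_pos_eq (rw k d y)), (Rabs_pos_eq N) by lra.
      replace (r * N + N * r) with (2 * N * r) by ring. rewrite !Rabs_mult, (Rabs_pos_eq N), (Rabs_pos_eq 2) by lra.
      assert (g1 : rw1 k d y * (N * N) <= k * rw k d y * (q * N)).
      { apply Rmult_le_compat; auto; [nra |]. apply Rmult_le_compat_r; auto. unfold q; lra. }
      assert (g2 : rw k d y * (2 * N * Rabs r) <= rw k d y * (4 * q * N)).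
      { apply Rmult_le_compat_l; [lra |]. assert (N * Rabs r <= N * (2 * q)) by (apply Rmult_le_compat_l; unfold q; lra). lra. }
      assert (0 <= k * rw k d y * (q * N)) by (apply Rmult_le_pos; nra).
      lra.
    - now apply dom_scal.
    - intros y. rewrite Rabs_pos_eq.
      + pose proof (proj2 D y) as b. rewrite Rabs_pos_eq in b by (apply Rmult_le_pos; [left; now apply rw_pos | apply N2_pos]).
        replace (M * K ^ 2 * om y) with (M * om y * K ^ 2) by ring. rewrite <- Rmult_assoc.
        apply Rmult_le_compat; auto; [| apply N2_pos].
        apply Rmult_le_pos; [left; now apply rw_pos | apply N2_pos].
      + apply Rmult_le_pos; [left; now apply rw_pos |]. apply Rmult_le_pos; apply N2_pos.
    - reflexivity. }
  rewrite (intR_scal M) in G by auto.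
  pose proof (right_energy k d t Hk Hd Ht) as HE.
  assert (Hrw : rw k d x = exp (k * x) / 2).
  { unfold rw, sg, d. rewrite <- exp_plus, Rplus_opp_l, exp_0. field. }
  rewrite Hrw in G.
  set (E := intR (fun y => rw k d y * N2 (u 0%nat y t))) in *.
  assert (H4 : Cmod (u 0%nat x t) ^ 4 = N2 (u 0%nat x t) * N2 (u 0%nat x t)) by (rewrite N2_Cmod; ring).
  rewrite H4. set (Y := N2 (u 0%nat x t) * N2 (u 0%nat x t)) in *.
  assert (G2 : exp (k * x) / 2 * Y <= 4 * q * (1 + k) * (exp (rate k * T) * (4 * PI * c ^ 2 * exp (k ^ 2)))).
  { eapply Rle_trans; [apply G |]. apply Rmult_le_compat_l; [| auto]. apply Rmult_le_pos; lra. }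
  replace (exp (rate k * T + k ^ 2 - k * x)) with (exp (rate k * T) * exp (k ^ 2) * exp (- (k * x)))
    by (rewrite <- !exp_plus; f_equal; ring).
  assert (Ee : exp (- (k * x)) * exp (k * x) = 1) by (rewrite <- exp_plus, Rplus_opp_l; apply exp_0).
  replace Y with (exp (- (k * x)) * (2 * (exp (k * x) / 2 * Y))) by (transitivity (exp (- (k * x)) * exp (k * x) * Y); [field | rewrite Ee; ring]).
  replace (2 * (4 * q) * (4 * PI * c ^ 2) * ((1 + k) * (exp (rate k * T) * exp (k ^ 2) * exp (- (k * x)))))
    with (exp (- (k * x)) * (2 * (4 * q * (1 + k) * (exp (rate k * T) * (4 * PI * c ^ 2 * exp (k ^ 2)))))) by ring.
  apply Rmult_le_compat_l; [left; apply exp_pos |]. lra.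
Qed.

Context (HbT : 8 * beta * T <= 1 / 3).

(** The gain [k x] and the loss [beta T k^3] are of the same order when [k] is proportional to
    [sqrt x]. *)
Theorem right_decay : exists C, 0 < C /\ forall x t, 1 < x -> 0 <= t <= T ->
  Cmod (u 0%nat x t) <= C * exp (- Rpower x (3 / 2) / 3).
Proof.
  destruct right_pointwise as [K [HK B]].
  (* [a] collects the coefficients of [y = sqrt x], its [2] coming from [1 + 2 y <= exp (2 y)]; as
     [y >= 1], [A = 4 + a] bounds everything of order [y^2], the [4] being that of [k^2]. The
     [9 A^3] in [b] is the price of [A y^2 <= y^3 / 3 + 9 A^3]. *)
  set (a := 2 * (alpha ^ 2 / (3 * beta)) + 2).
  assert (Ha0 : 0 <= alpha ^ 2 / (3 * beta)) by (apply Rmult_le_pos; [apply pow2_ge_0 | left; apply Rinv_0_lt_compat; lra]).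
  set (A := 4 + a). assert (HA : 0 < A) by (unfold A, a; lra).
  set (b := 2 * Kv + 9 * A ^ 3).
  set (C := 1 + K * exp b).
  assert (HKb : 0 < K * exp b) by (apply Rmult_lt_0_compat; [auto | apply exp_pos]).
  assert (HC : 1 <= C) by (unfold C; lra).
  exists C. split; [lra |]. intros x t Hx Ht.
  set (y := sqrt x). assert (Hy0 : 0 < y) by (apply sqrt_lt_R0; lra).
  assert (Hyx : y * y = x) by (apply sqrt_sqrt; lra).
  assert (Hp : Rpower x (3 / 2) = y ^ 3).
  { unfold y. rewrite <- Rpower_sqrt by lra. rewrite <- Rpower_pow by apply exp_pos.
    rewrite Rpower_mult. f_equal. simpl. field. }
  rewrite Hp.
  specialize (B (2 * y) x t ltac:(lra) Ht).
  assert (Hy1 : 1 <= y) by nra.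
  assert (Hexp : (1 + 2 * y) * exp (rate (2 * y) * T + (2 * y) ^ 2 - 2 * y * x) <= exp (b - 4 / 3 * y ^ 3)).
  { pose proof (exp_ge_1plus (2 * y)).
    apply Rle_trans with (exp (2 * y) * exp (rate (2 * y) * T + (2 * y) ^ 2 - 2 * y * x)).
    - apply Rmult_le_compat_r; [left; apply exp_pos | auto].
    - rewrite <- exp_plus. apply exp_le. unfold rate.
      pose proof Kv_nonneg as HKv0. pose proof (pow_lt y 3 Hy0) as Hy3.
      assert (r1 : beta * (2 * y) ^ 3 * T <= 1 / 3 * y ^ 3).
      { replace (beta * (2 * y) ^ 3 * T) with (8 * beta * T * y ^ 3) by ring. apply Rmult_le_compat_r; lra. }
      assert (r2 : alpha ^ 2 / (3 * beta) * (2 * y) * T <= 2 * (alpha ^ 2 / (3 * beta)) * y).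
      { replace (alpha ^ 2 / (3 * beta) * (2 * y) * T) with (2 * (alpha ^ 2 / (3 * beta)) * y * T) by ring.
        rewrite <- (Rmult_1_r (2 * (alpha ^ 2 / (3 * beta)) * y)) at 2. apply Rmult_le_compat_l; [| lra].
        apply Rmult_le_pos; lra. }
      assert (r3 : 2 * Kv * T <= 2 * Kv) by nra.
      assert (r4 : A * y ^ 2 <= y ^ 3 / 3 + 9 * A ^ 3).
      { destruct (Rle_lt_dec y (3 * A)).
        - assert (y ^ 2 <= (3 * A) ^ 2) by (apply pow_incr; lra).
          assert (A * y ^ 2 <= A * (3 * A) ^ 2) by (apply Rmult_le_compat_l; lra). lra.
        - assert (0 < A ^ 3) by (apply pow_lt; lra).
          assert (3 * A * y ^ 2 <= y * y ^ 2) by (apply Rmult_le_compat_r; lra). lra. }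
      assert (r5 : a * y <= a * y ^ 2) by (apply Rmult_le_compat_l; [unfold a; lra | nra]).
      rewrite <- Hyx. unfold b, A in *. unfold a in *. lra. }
  assert (B2 : Cmod (u 0%nat x t) ^ 4 <= (C * exp (- y ^ 3 / 3)) ^ 4).
  { eapply Rle_trans; [apply B |].
    apply Rle_trans with (K * exp (b - 4 / 3 * y ^ 3)); [apply Rmult_le_compat_l; lra |].
    replace (b - 4 / 3 * y ^ 3) with (b + (- y ^ 3 / 3 + - y ^ 3 / 3 + - y ^ 3 / 3 + - y ^ 3 / 3)) by field.
    rewrite !exp_plus. pose proof (exp_pos (- y ^ 3 / 3)) as He.
    replace (K * (exp b * (exp (- y ^ 3 / 3) * exp (- y ^ 3 / 3) * exp (- y ^ 3 / 3) * exp (- y ^ 3 / 3))))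
      with (K * exp b * exp (- y ^ 3 / 3) ^ 4) by ring.
    rewrite Rpow_mult_distr. apply Rmult_le_compat_r; [apply pow_le; lra |].
    apply Rle_trans with (C ^ 1); [unfold C; lra |]. apply Rle_pow; [auto | lia]. }
  destruct (Rle_lt_dec (Cmod (u 0%nat x t)) (C * exp (- y ^ 3 / 3))) as [| Hlt]; auto.
  exfalso. assert (Hz : 0 <= C * exp (- y ^ 3 / 3)) by (pose proof (exp_pos (- y ^ 3 / 3)); nra).
  set (z := C * exp (- y ^ 3 / 3)) in *. set (r := Cmod (u 0%nat x t)) in *.
  assert (H2 : z ^ 2 < r ^ 2) by nra.
  replace (r ^ 4) with (r ^ 2 * r ^ 2) in B2 by ring.
  replace (z ^ 4) with (z ^ 2 * z ^ 2) in B2 by ring. nra.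
Qed.

End RightDecay.

(** * Conclusion *)
Definition chain (g : nat -> R -> C) : Prop := forall j x, is_Cderive (g j) x (g (S j) x).

Lemma chain_Derive_n g : chain g -> forall n x,
  Derive_n (fun y => Re (g 0%nat y)) n x = Re (g n x) /\
  Derive_n (fun y => Im (g 0%nat y)) n x = Im (g n x).
Proof.
  intros H n. induction n as [| n IH]; intros x; [split; reflexivity |].
  simpl. split.
  - rewrite (Derive_ext _ (fun y => Re (g n y))) by (intros; apply IH).
    apply is_derive_unique, H.
  - rewrite (Derive_ext _ (fun y => Im (g n y))) by (intros; apply IH).
    apply is_derive_unique, H.
Qed.

Lemma chain_CDerive_n g f n x : chain g -> (forall y, f y = g 0%nat y) -> CDerive_n f n x = g n x.
Proof.
  intros H E. destruct (chain_Derive_n g H n x) as [H1 H2]. unfold CDerive_n.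
  rewrite (Derive_n_ext _ (fun y => Re (g 0%nat y))) by (intros; now rewrite E).
  rewrite (Derive_n_ext (fun y => Im (f y)) (fun y => Im (g 0%nat y))) by (intros; now rewrite E).
  rewrite H1, H2. now destruct (g n x).
Qed.

Lemma chain_Csmooth g : chain g -> Csmooth (g 0%nat).
Proof.
  intros H n x. destruct n as [| n]; [split; exact Logic.I |]. simpl. split.
  - apply (ex_derive_ext (fun y => Re (g n y))).
    + intros y. symmetry. apply (chain_Derive_n g H n y).
    + exists (Re (g (S n) x)). exact (proj1 (H n x)).
  - apply (ex_derive_ext (fun y => Im (g n y))).
    + intros y. symmetry. apply (chain_Derive_n g H n y).
    + exists (Im (g (S n) x)). exact (proj2 (H n x)).
Qed.

Lemma chain_minus f g : chain f -> chain g -> chain (fun j x => f j x - g j x)%C.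
Proof.
  intros Hf Hg j x. destruct (Hf j x) as [H1 H2]. destruct (Hg j x) as [H3 H4]. split.
  - apply (is_derive_minus (fun y => Re (f j y)) (fun y => Re (g j y))); auto.
  - apply (is_derive_minus (fun y => Im (f j y)) (fun y => Im (g j y))); auto.
Qed.

Lemma chain_conj f : chain f -> chain (fun j x => Cconj (f j x)).
Proof.
  intros Hf j x. destruct (Hf j x) as [H1 H2]. split; simpl; auto.
  apply (is_derive_opp (fun y => Im (f j y))); auto.
Qed.

Lemma is_derive_on_quad T g t l K : 0 <= K ->
  (forall s, 0 <= s <= T -> Cmod (g s - g t - RtoC (s - t) * l) <= K * (s - t) ^ 2) ->
  is_derive_on T g t l.
Proof.
  intros HK H. unfold is_derive_on. apply filterlim_locally. intros eps.
  assert (He : 0 < eps / (K + 1)) by (apply Rdiv_lt_0_compat; [apply cond_pos | lra]).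
  exists (mkposreal _ He). intros s Hs Hst Hs01. simpl in Hs.
  change (Rabs (s - t) < eps / (K + 1)) in Hs.
  assert (Hst0 : s - t <> 0) by lra.
  assert (Hz : RtoC (s - t) <> RtoC 0) by (intros E; apply RtoC_inj in E; lra).
  set (q := ((g s - g t) / RtoC (s - t))%C).
  assert (Hq : Cmod (q - l) < eps).
  { replace (q - l)%C with ((g s - g t - RtoC (s - t) * l) / RtoC (s - t))%C by (unfold q; field; auto).
    rewrite Cmod_div, Cmod_R by auto. pose proof (Rabs_pos_lt _ Hst0) as Hp.
    apply Rmult_lt_reg_r with (Rabs (s - t)); auto. unfold Rdiv.
    rewrite Rmult_assoc, Rinv_l by lra. rewrite Rmult_1_r.
    eapply Rle_lt_trans; [now apply H |]. rewrite <- pow2_abs.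
    apply Rlt_div_r in Hs; [| lra]. nra. }
  split.
  - change (Rabs (Re q - Re l) < eps). eapply Rle_lt_trans; [| apply Hq]. apply (Re_le_Cmod (q - l)).
  - change (Rabs (Im q - Im l) < eps). eapply Rle_lt_trans; [| apply Hq]. apply (Im_le_Cmod (q - l)).
Qed.

Definition eq_rhs (alpha beta : R) (gamma delta epsilon : C) (u : nat -> R -> R -> C) (x t : R) : C :=
  (- (Ci * RtoC alpha * u 2%nat x t) - RtoC beta * u 3%nat x t
   + u 0%nat x t * potential gamma delta epsilon (u 0%nat x t) (u 1%nat x t))%C.

(** Properties that survive time reversal and shortening of the interval: bounds are uniform in [t],
    and [s] may lie on either side of [t] in [gs_eq]. *)
Record good_solution (alpha beta : R) (gamma delta epsilon : C) (T : R) (u : nat -> R -> R -> C) : Prop := {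
  gs_chain : forall t, chain (fun j x => u j x t);
  gs_schwartz : forall j n, exists K, 0 <= K /\
    forall x t, 0 <= t <= T -> Rabs x ^ n * Cmod (u j x t) <= K;
  gs_Lip : forall j, exists K, 0 <= K /\ forall x s t, 0 <= s <= T -> 0 <= t <= T ->
    Cmod (u j x s - u j x t) <= K * Rabs (s - t);
  gs_eq : exists K, 0 <= K /\ forall x s t, 0 <= s <= T -> 0 <= t <= T ->
    Cmod (u 0%nat x s - u 0%nat x t - RtoC (s - t) * eq_rhs alpha beta gamma delta epsilon u x t)
      <= K * (s - t) ^ 2;
  gs_decay : exists K, 0 < K /\ forall x t, 1 < x -> 0 <= t <= T ->
    Cmod (u 0%nat x t) <= K * exp (- Rpower x (3 / 2) / 3)
}.

Lemma good_restrict alpha beta gamma delta epsilon T T' u : T' <= T ->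
  good_solution alpha beta gamma delta epsilon T u -> good_solution alpha beta gamma delta epsilon T' u.
Proof.
  intros HT [H1 H2 H3 H4 H5]. split; auto.
  - intros j n. destruct (H2 j n) as [K [HK B]]. exists K. split; auto. intros; apply B; lra.
  - intros j. destruct (H3 j) as [K [HK B]]. exists K. split; auto. intros; apply B; lra.
  - destruct H4 as [K [HK B]]. exists K. split; auto. intros; apply B; lra.
  - destruct H5 as [K [HK B]]. exists K. split; auto. intros; apply B; lra.
Qed.

(** Reversal flips the sign of the time derivative, hence of all coefficients. The decay for [x > 1]
    is uniform in time and passes over as it is. *)
Lemma good_reverse alpha beta gamma delta epsilon T u :
  good_solution alpha beta gamma delta epsilon T u ->
  good_solution (- alpha) (- beta) (- gamma) (- delta) (- epsilon) T (fun j x t => u j x (T - t)).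
Proof.
  intros [H1 H2 H3 H4 H5]. split.
  - intros t. apply (H1 (T - t)).
  - intros j n. destruct (H2 j n) as [K [HK B]]. exists K. split; auto. intros; apply B; lra.
  - intros j. destruct (H3 j) as [K [HK B]]. exists K. split; auto. intros x s t Hs Ht.
    replace (Rabs (s - t)) with (Rabs ((T - s) - (T - t))) by (rewrite Rabs_minus_sym; f_equal; ring).
    apply B; lra.
  - destruct H4 as [K [HK B]]. exists K. split; auto. intros x s t Hs Ht.
    replace ((s - t) ^ 2) with (((T - s) - (T - t)) ^ 2) by ring.
    eapply Rle_trans; [| apply (B x (T - s) (T - t)); lra]. right. f_equal.
    replace (T - s - (T - t)) with (- (s - t)) by ring.
    unfold eq_rhs, potential. rewrite !RtoC_opp. ring.
  - destruct H5 as [K [HK B]]. exists K. split; auto. intros; apply B; lra.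
Qed.

(** [gs_Lip] carries no weight in [x], so it is interpolated with the bounds:
    [(|x|^k d)^2 = (|x|^(2 k) d) d], where the first factor is bounded and the second is small. *)
Lemma good_C_Schwartz alpha beta gamma delta epsilon T u :
  good_solution alpha beta gamma delta epsilon T u -> C_Schwartz T (u 0%nat).
Proof.
  intros [H1 H2 H3 _ _]. split.
  - intros t Ht. split.
    + apply (chain_Csmooth _ (H1 t)).
    + intros k j. destruct (H2 j k) as [K [_ B]]. exists K. intros x.
      rewrite (chain_CDerive_n (fun j x => u j x t)); auto.
  - intros k j t0 Ht0 eps He.
    destruct (H2 j (2 * k)%nat) as [K1 [HK1 B1]]. destruct (H3 j) as [K2 [HK2 B2]].
    exists (eps ^ 2 / (2 * K1 * K2 + 1)).
    assert (HP : 0 < 2 * K1 * K2 + 1) by nra.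
    split; [apply Rdiv_lt_0_compat; [now apply pow_lt | auto] |].
    intros t Ht Htt x.
    rewrite (chain_CDerive_n (fun j x => u j x t - u j x t0)%C); auto; [| apply (chain_minus _ _ (H1 t) (H1 t0))].
    set (d := Cmod (u j x t - u j x t0)). assert (Hd : 0 <= d) by apply Cmod_ge_0.
    assert (b1 : Rabs x ^ (2 * k) * d <= 2 * K1).
    { specialize (B1 x t Ht) as e1. specialize (B1 x t0 Ht0).
      assert (0 <= Rabs x ^ (2 * k)) by apply pow_le, Rabs_pos.
      apply Rle_trans with (Rabs x ^ (2 * k) * (Cmod (u j x t) + Cmod (u j x t0))); [| lra].
      apply Rmult_le_compat_l; auto. apply Cmod_minus_le. }
    assert (b2 : d <= K2 * Rabs (t - t0)) by now apply B2.
    assert (Hsq : (Rabs x ^ k * d) ^ 2 <= eps ^ 2).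
    { replace ((Rabs x ^ k * d) ^ 2) with ((Rabs x ^ (2 * k) * d) * d)
        by (rewrite Rpow_mult_distr, <- pow_mult, (Nat.mul_comm k 2); ring).
      apply Rlt_div_r in Htt; auto. pose proof (Rabs_pos (t - t0)).
      apply Rle_trans with (2 * K1 * (K2 * Rabs (t - t0))).
      - apply Rmult_le_compat; auto. apply Rmult_le_pos; auto. apply pow_le, Rabs_pos.
      - nra. }
    set (z := Rabs x ^ k * d) in *. nra.
Qed.

Lemma good_solves alpha beta gamma delta epsilon T u :
  good_solution alpha beta gamma delta epsilon T u ->
  solves_IVP alpha beta gamma delta epsilon T (fun x => u 0%nat x 0) (u 0%nat).
Proof.
  intros [H1 _ _ [K [HK H4]] _]. split; [| reflexivity].
  intros x t Ht. exists (eq_rhs alpha beta gamma delta epsilon u x t). split.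
  - apply (is_derive_on_quad _ _ _ _ K); auto.
  - rewrite !(chain_CDerive_n (fun j x => u j x t)) by auto.
    rewrite (chain_CDerive_n (fun j x => Cconj (u j x t))) by (auto; apply chain_conj, H1).
    rewrite !Cmod2_conj. unfold eq_rhs, potential. ring.
Qed.

Lemma good_conclusion alpha beta gamma delta epsilon T u : 0 < T ->
  good_solution alpha beta gamma delta epsilon T u -> u 0%nat 0 0 <> RtoC 0 ->
  exists (u0 : R -> C) (T : R),
    Schwartz u0 /\ u0 <> (fun _ : R => RtoC 0) /\ 0 < T /\
    exists u : R -> R -> C,
      C_Schwartz T u /\
      solves_IVP alpha beta gamma delta epsilon T u0 u /\
      exists c : R, 0 < c /\
        forall x t : R, 1 < x -> 0 <= t <= T ->
          Cmod (u x t) <= c * exp (- Rpower x (3 / 2) / 3).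
Proof.
  intros HT H Hu0. pose proof (good_C_Schwartz _ _ _ _ _ _ _ H) as HS.
  exists (fun x => u 0%nat x 0), T.
  split; [apply HS; lra |]. split; [| split; [auto |]].
  - intros E. apply Hu0. exact (f_equal (fun f => f 0) E).
  - exists (u 0%nat). split; [auto |]. split; [now apply good_solves | apply H].
Qed.

(** Differentiating [u' = - (x / 2) u] repeatedly gives a recursion of Hermite type, [u (j + 2) = -
    (x / 2) u (j + 1) - ((j + 1) / 2) u j]; decay follows by induction on consecutive pairs. *)
Lemma gaussian_tower_decay c (u : nat -> R -> R -> C) : tower u -> 0 < c ->
  (forall x, u 0%nat x 0 = RtoC (c * exp (- x ^ 2 / 4))) ->
  forall j n, exists K, 0 <= K /\ forall x, qq x ^ n * Cmod (u j x 0) <= K.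
Proof.
  intros [_ Hd] Hc H0.
  assert (Dx : forall x, is_Cderive (fun y => RtoC (- y / 2)) x (RtoC (- / 2))).
  { intros x. apply is_Cderive_RtoC. auto_derive; auto. field. }
  assert (H1 : forall x, u 1%nat x 0 = (RtoC (- x / 2) * u 0%nat x 0)%C).
  { intros x. eapply is_Cderive_unique; [apply Hd |].
    apply (is_Cderive_ext (fun y => RtoC (c * exp (- y ^ 2 / 4)))); [intros; now rewrite H0 |].
    rewrite H0, <- RtoC_mult. apply is_Cderive_RtoC. auto_derive; auto. simpl.
    unfold Rdiv. field. }
  assert (Hrec : forall j x, u (S (S j)) x 0
     = (RtoC (- x / 2) * u (S j) x 0 + RtoC (- (INR j + 1) / 2) * u j x 0)%C).
  { induction j as [| j IH]; intros x.
    - eapply is_Cderive_unique; [apply Hd |].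
      apply (is_Cderive_ext (fun y => RtoC (- y / 2) * u 0%nat y 0)%C); [intros; now rewrite H1 |].
      replace (RtoC (- x / 2) * u 1%nat x 0 + RtoC (- (INR 0 + 1) / 2) * u 0%nat x 0)%C
        with (RtoC (- / 2) * u 0%nat x 0 + RtoC (- x / 2) * u 1%nat x 0)%C.
      + apply (is_Cderive_mult (fun y => RtoC (- y / 2)) (fun y => u 0%nat y 0)); auto.
      + replace (- (INR 0 + 1) / 2) with (- / 2) by (simpl; field). ring.
    - eapply is_Cderive_unique; [apply Hd |].
      apply (is_Cderive_ext (fun y => RtoC (- y / 2) * u (S j) y 0 + RtoC (- (INR j + 1) / 2) * u j y 0)%C);
        [intros; now rewrite IH |].
      replace (RtoC (- x / 2) * u (S (S j)) x 0 + RtoC (- (INR (S j) + 1) / 2) * u (S j) x 0)%C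
        with ((RtoC (- / 2) * u (S j) x 0 + RtoC (- x / 2) * u (S (S j)) x 0)
           + (RtoC 0 * u j x 0 + RtoC (- (INR j + 1) / 2) * u (S j) x 0))%C.
      + apply (is_Cderive_plus (fun y => RtoC (- y / 2) * u (S j) y 0)%C
           (fun y => RtoC (- (INR j + 1) / 2) * u j y 0)%C).
        * apply (is_Cderive_mult (fun y => RtoC (- y / 2)) (fun y => u (S j) y 0)); auto.
        * apply (is_Cderive_mult (fun _ => RtoC (- (INR j + 1) / 2)) (fun y => u j y 0)); auto.
          apply is_Cderive_RtoC. apply (is_derive_const (- (INR j + 1) / 2)).
      + replace (- (INR (S j) + 1) / 2) with (- / 2 + - (INR j + 1) / 2) by (rewrite S_INR; field).
        rewrite (RtoC_plus (- / 2)). ring. }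
  assert (B0 : forall n, exists K, 0 <= K /\ forall x, qq x ^ n * Cmod (u 0%nat x 0) <= K).
  { intros n. destruct (polyexp n 1 Rlt_0_1) as [K [HK B]].
    exists (c * exp 2 * K). pose proof (exp_pos 2) as He.
    split; [apply Rmult_le_pos; [apply Rmult_le_pos |]; lra |]. intros x.
    rewrite H0, Cmod_R, Rabs_pos_eq by (pose proof (exp_pos (- x ^ 2 / 4)); nra).
    (* From [(|x| - 2)^2 >= 0], that is [x^2 / 4 >= |x| - 1]. *)
    assert (E : exp (- x ^ 2 / 4) <= exp 2 * exp (- (1 * qq x))).
    { rewrite <- exp_plus. apply exp_le. unfold qq. rewrite <- (pow2_abs x).
      pose proof (pow2_ge_0 (Rabs x - 2)). nra. }
    assert (Hq : 0 <= qq x ^ n) by (apply pow_le; pose proof (qq_ge1 x); lra). specialize (B x).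
    apply Rle_trans with (qq x ^ n * (c * (exp 2 * exp (- (1 * qq x))))).
    - apply Rmult_le_compat_l; auto. apply Rmult_le_compat_l; lra.
    - replace (qq x ^ n * (c * (exp 2 * exp (- (1 * qq x)))))
        with (c * exp 2 * (qq x ^ n * exp (- (1 * qq x)))) by ring.
      apply Rmult_le_compat_l; auto. apply Rmult_le_pos; lra. }
  assert (Bx : forall f : R -> C, (forall n, exists K, 0 <= K /\ forall x, qq x ^ n * Cmod (f x) <= K) ->
     forall n, exists K, 0 <= K /\ forall x, qq x ^ n * Cmod (RtoC (- x / 2) * f x) <= K).
  { intros f Hf n. destruct (Hf (S n)) as [K [HK B]]. exists K. split; auto. intros x.
    specialize (B x). rewrite Cmod_mult, Cmod_R.
    assert (Rabs (- x / 2) <= qq x).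
    { unfold Rdiv. rewrite Rabs_mult, Rabs_Ropp, (Rabs_pos_eq (/ 2)) by lra.
      unfold qq. pose proof (Rabs_pos x). lra. }
    assert (0 <= qq x ^ n) by (apply pow_le; pose proof (qq_ge1 x); lra).
    eapply Rle_trans; [| apply B]. simpl.
    replace (qq x * qq x ^ n * Cmod (f x)) with (qq x ^ n * (qq x * Cmod (f x))) by ring.
    apply Rmult_le_compat_l; auto. apply Rmult_le_compat_r; [apply Cmod_ge_0 | auto]. }
  assert (key : forall j, (forall n, exists K, 0 <= K /\ forall x, qq x ^ n * Cmod (u j x 0) <= K) /\
     (forall n, exists K, 0 <= K /\ forall x, qq x ^ n * Cmod (u (S j) x 0) <= K)).
  { induction j as [| j [IH1 IH2]].
    - split; auto. intros n. destruct (Bx (fun x => u 0%nat x 0) B0 n) as [K [HK B]].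
      exists K. split; auto. intros x. rewrite H1. apply B.
    - split; auto. intros n. destruct (Bx (fun x => u (S j) x 0) IH2 n) as [K1 [HK1 B1]].
      destruct (IH1 n) as [K2 [HK2 B2]]. pose proof (pos_INR j) as Hj.
      exists (K1 + (INR j + 1) * K2). split; [nra |]. intros x. specialize (B1 x). specialize (B2 x).
      assert (Hq : 0 <= qq x ^ n) by (apply pow_le; pose proof (qq_ge1 x); lra).
      rewrite Hrec. eapply Rle_trans; [apply Rmult_le_compat_l; [auto | apply Cmod_triangle] |].
      rewrite Rmult_plus_distr_l. apply Rplus_le_compat; auto.
      rewrite Cmod_mult, Cmod_R.
      assert (Rabs (- (INR j + 1) / 2) <= INR j + 1) by (apply Rabs_le; lra).
      apply Rle_trans with ((INR j + 1) * (qq x ^ n * Cmod (u j x 0))).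
      + replace (qq x ^ n * (Rabs (- (INR j + 1) / 2) * Cmod (u j x 0)))
          with (Rabs (- (INR j + 1) / 2) * (qq x ^ n * Cmod (u j x 0))) by ring.
        apply Rmult_le_compat_r; auto. apply Rmult_le_pos; auto using Cmod_ge_0.
      + apply Rmult_le_compat_l; lra. }
  intros j. apply key.
Qed.

Theorem good_solution_exists alpha beta gamma delta epsilon : 0 < beta ->
  exists T u, 0 < T /\ good_solution alpha beta gamma delta epsilon T u /\ u 0%nat 0 0 <> RtoC 0.
Proof.
  intros Hb.
  destruct (physical_solution alpha beta gamma delta epsilon)
    as (T0 & c & u & V & HT0 & Hc & Hu & HV & Hrem & Hini & Hpot).
  (* The bound [1 / (24 beta)] is the condition [8 beta T <= 1/3] of [right_decay]. *)
  set (T := Rmin T0 (Rmin 1 (/ (24 * beta)))).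
  assert (Hib : 0 < / (24 * beta)) by (apply Rinv_0_lt_compat; lra).
  assert (HTp : 0 < T) by (unfold T; repeat apply Rmin_pos; lra).
  assert (HTT : T <= T0) by apply Rmin_l.
  assert (HT1 : T <= 1) by (eapply Rle_trans; [apply Rmin_r | apply Rmin_l]).
  assert (HTb : 8 * beta * T <= 1 / 3).
  { assert (T <= / (24 * beta)) by (eapply Rle_trans; [apply Rmin_r | apply Rmin_r]).
    apply Rle_trans with (8 * beta * / (24 * beta)).
    - apply Rmult_le_compat_l; lra.
    - right. field. lra. }
  assert (HTr : 0 < T <= 1) by lra.
  assert (Hrem' : forall j, exists K, 0 <= K /\ forall x s t, 0 <= s <= T -> 0 <= t <= T ->
      Cmod (u j x s - u j x t - RtoC (s - t) * rhs_t alpha beta u V j x t) <= K * (s - t) ^ 2).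
  { intros j. destruct (Hrem j) as [K [HK B]]. exists K. split; auto. intros; apply B; lra. }
  pose proof (schwartz_bounds alpha beta T u V HTr Hu HV Hrem'
    (gaussian_tower_decay c u Hu Hc Hini)) as Hsch.
  exists T, u. split; [auto |]. split.
  - split.
    + intros t j x. apply Hu.
    + intros j n. destruct (Hsch j n) as [K [HK B]]. exists K. split; auto. intros x t Ht.
      eapply Rle_trans; [| apply (B x t Ht)]. apply Rmult_le_compat_r; [apply Cmod_ge_0 |].
      apply pow_incr. split; [apply Rabs_pos | apply abs_le_qq].
    + intros j. destruct (Hrem' j) as [K [HK B]].
      destruct (rhs_bounded alpha beta u V Hu HV j) as [K1 [HK1 B1]].
      exists (K + K1). split; [lra |]. intros x s t Hs Ht.
      destruct (B1 x t) as (_ & _ & _ & _ & _ & b). specialize (B x s t Hs Ht).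
      replace (u j x s - u j x t)%C with ((u j x s - u j x t - RtoC (s - t) * rhs_t alpha beta u V j x t)
          + RtoC (s - t) * rhs_t alpha beta u V j x t)%C by ring.
      eapply Rle_trans; [apply Cmod_triangle |]. rewrite Cmod_mult, Cmod_R.
      pose proof (Rabs_pos (s - t)) as Hp.
      assert (Hr : Rabs (s - t) <= 1) by (apply Rabs_le; lra).
      assert ((s - t) ^ 2 <= Rabs (s - t)) by (rewrite <- pow2_abs; nra).
      nra.
    + destruct (Hrem' 0%nat) as [K [HK B]]. exists K. split; auto. intros x s t Hs Ht.
      specialize (B x s t Hs Ht). unfold rhs_t in B. simpl in B. rewrite Hpot in B. exact B.
    + destruct (proj1 HV 0%nat) as [Kv [_ Bv]].
      exact (right_decay alpha beta T u V HTr Hb Hu HV Hrem' Hsch c Hc Hini Kv Bv HTb).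
  - rewrite Hini. intros E. apply RtoC_inj in E. pose proof (exp_pos (- 0 ^ 2 / 4)). nra.
Qed.

Theorem theorem1p5 (alpha beta : R) (gamma delta epsilon : C) (hbeta : beta <> 0) :
  exists (u0 : R -> C) (T : R),
    Schwartz u0 /\ u0 <> (fun _ : R => RtoC 0) /\ 0 < T /\
    exists u : R -> R -> C,
      C_Schwartz T u /\
      solves_IVP alpha beta gamma delta epsilon T u0 u /\
      exists c : R, 0 < c /\
        forall x t : R, 1 < x -> 0 <= t <= T ->
          Cmod (u x t) <= c * exp (- Rpower x (3 / 2) / 3).
Proof.
  destruct (Rdichotomy _ _ hbeta) as [Hb | Hb].
  - destruct (good_solution_exists (- alpha) (- beta) (- gamma) (- delta) (- epsilon) ltac:(lra))
      as (T & u & HT & Hg & Hu0).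
    destruct (gs_Lip _ _ _ _ _ _ _ Hg 0%nat) as [K [HK BK]].
    assert (Hm : 0 < Cmod (u 0%nat 0 0)) by now apply Cmod_gt_0.
    set (m := Cmod (u 0%nat 0 0)) in *.
    (* The new datum is [u] at time [T'], which must not vanish:
       [|u(0, T') - u(0, 0)| <= K T' < m]. *)
    set (T' := Rmin T (m / (2 * (K + 1)))).
    assert (HT' : 0 < T') by (apply Rmin_pos; [auto | apply Rdiv_lt_0_compat; lra]).
    assert (HTT : T' <= T) by apply Rmin_l.
    pose proof (good_reverse _ _ _ _ _ _ _ (good_restrict _ _ _ _ _ T T' u HTT Hg)) as Hr.
    rewrite !Ropp_involutive in Hr.
    replace (- - gamma)%C with gamma in Hr by ring. replace (- - delta)%C with delta in Hr by ring.
    replace (- - epsilon)%C with epsilon in Hr by ring.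
    apply (good_conclusion _ _ _ _ _ T' _ HT' Hr).
    rewrite Rminus_0_r. intros E.
    specialize (BK 0 T' 0 ltac:(lra) ltac:(lra)). rewrite E in BK.
    replace (RtoC 0 - u 0%nat 0 0)%C with (- u 0%nat 0 0)%C in BK by ring.
    rewrite Cmod_opp, Rminus_0_r, Rabs_pos_eq in BK by lra. fold m in BK.
    assert (HTm : T' <= m / (2 * (K + 1))) by apply Rmin_r.
    apply Rle_div_r in HTm; [| lra]. nra.
  - destruct (good_solution_exists alpha beta gamma delta epsilon Hb) as (T & u & HT & Hg & Hu0).
    now apply (good_conclusion _ _ _ _ _ T u).
Qed.
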